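(* Let $\Gamma$ be a finite combinatorial graph, let $G_\Gamma$ be the associated right-angled Artin group, and let $\mathbb{F}$ be a finite field. Then the cohomology algebra $H^\bullet(G_\Gamma,\mathbb{F})=\bigoplus_{n\ge 0}H^n(G_\Gamma,\mathbb{F})$ is universally Koszul if, and only if, $G_\Gamma$ is of elementary type.
   Context: Graphs: a graph is a pair $\Gamma=(\mathcal{V},\mathcal{E})$ with $\mathcal{V}$ a finite nonempty set of vertices and $\mathcal{E}$ a set of unordered pairs $(v,w)=(w,v)$ of distinct vertices (no loops, no multiple edges). If $\mathcal{V}=\{v_1,\ldots,v_d\}$, the right-angled Artin group (RAAG) associated to $\Gamma$ is the group with presentation $G_\Gamma=\langle v_1,\ldots,v_d\mid [v_i,v_j]=1 \text{ for } (v_i,v_j)\in\mathcal{E}\rangle$. Elementary type: the class of RAAGs of elementary type is the minimal class $\mathcal{C}$ of finitely generated RAAGs such that (a) $\mathbb{Z}$ (the RAAG of a single vertex) belongs to $\mathcal{C}$; (b) if $G_{\Gamma_1}$ and $G_{\Gamma_2}$ belong to $\mathcal{C}$, then so does the free product $G_{\Gamma_1}\ast G_{\Gamma_2}$ (the RAAG of the disjoint union of $\Gamma_1$ and $\Gamma_2$); (c) if $G_\Gamma$ belongs to $\mathcal{C}$, then so does $G_\Gamma\times\mathbb{Z}$ (the RAAG of the cone over $\Gamma$, i.e. the graph obtained by adding to $\Gamma$ one new vertex joined to all vertices of $\Gamma$). Cohomology: $\mathbb{F}$ is a trivial $G_\Gamma$-module and $H^\bullet(G_\Gamma,\mathbb{F})$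 is a graded algebra with the cup-product. (It is well known to be a quadratic algebra.) Quadratic algebras: a graded $\mathbb{F}$-algebra $A_\bullet=\bigoplus_{n\ge0}A_n$ is quadratic if it is isomorphic, as a graded algebra, to $T_\bullet(V)/(\Omega)$, where $V$ is a finite-dimensional $\mathbb{F}$-vector space, $T_\bullet(V)$ is its tensor algebra, $\Omega\le V\otimes V$ is a subspace, and $(\Omega)$ is the two-sided ideal generated by $\Omega$. Ideals $I\trianglelefteq A_\bullet$ are graded, $I=\bigoplus_n I_n$ with $I_n=A_n\cap I$. For ideals $I,J$ of $A_\bullet$, the colon ideal is $I:J=\{a\in A_\bullet\mid a\cdot J\subseteq I\}$; $(b)$ denotes the two-sided ideal generated by $b$. Universal Koszulity: let $\mathcal{L}(A_\bullet)=\{I\trianglelefteq A_\bullet\mid I=A_\bullet\cdot I_1\}$ be the set of ideals generated by a subset of $A_1$. A quadratic algebra $A_\bullet$ is universally Koszul if for every $I\in\mathcal{L}(A_\bullet)$ and every $b\in A_1\smallsetminus I_1$ one has $I:(b)\in\mathcal{L}(A_\bullet)$. *)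

(* Defs.v *)
From HB Require Import structures.
From mathcomp Require Import all_boot all_order all_algebra.
From mathcomp Require Import boolp classical_sets functions.
From mathcomp Require Import zify.

Set Implicit Arguments.
Unset Strict Implicit.
Unset Printing Implicit Defensive.

Import GRing.Theory.

(* The letter (x, true) stands for the generator x, (x, false) for x^-1. *)
Definition word (X : choiceType) := seq (X * bool).

Section Presentation.
Variables (X : choiceType) (R : set (word X)).

Inductive pres_rel : word X -> word X -> Prop :=
| pres_refl w : pres_rel w w
| pres_sym w w' : pres_rel w w' -> pres_rel w' w
| pres_trans w1 w2 w3 : pres_rel w1 w2 -> pres_rel w2 w3 -> pres_rel w1 w3
| pres_cat w1 w1' w2 w2' : pres_rel w1 w1' -> pres_rel w2 w2' ->
    pres_rel (w1 ++ w2) (w1' ++ w2')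
| pres_cancel x b : pres_rel [:: (x, b); (x, ~~ b)] [::]
| pres_relator r : R r -> pres_rel r [::].

Definition pres_relb (w w' : word X) : bool := `[< pres_rel w w' >].

Lemma pres_relb_equiv : equiv_class_of pres_relb.
Proof.
split=> [w|w w'|w1 w2 w3]; first by apply/asboolP; exact: pres_refl.
  by apply/asboolP/asboolP; exact: pres_sym.
by move=> /asboolP h1 /asboolP h2; apply/asboolP; exact: pres_trans h1 h2.
Qed.

Canonical pres_equiv := EquivRelPack pres_relb_equiv.
Canonical pres_encModRel := defaultEncModRel pres_relb.

Local Open Scope quotient_scope.

Definition presented := {eq_quot pres_relb}.
HB.instance Definition _ := Choice.on presented.
HB.instance Definition _ : EqQuotient _ pres_relb presented :=
  EqQuotient.on presented.

Definition pres_word (w : word X) : presented := \pi_presented w.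

Lemma pres_wordP w w' : pres_word w = pres_word w' <-> pres_rel w w'.
Proof.
split=> [/eqP|h]; first by rewrite /pres_word piE => /asboolP.
by apply/eqP; rewrite /pres_word piE; apply/asboolP.
Qed.

Lemma pres_wordK (x : presented) : pres_word (repr x) = x.
Proof. exact: reprK. Qed.

Definition word_inv (w : word X) : word X :=
  rev [seq (p.1, ~~ p.2) | p <- w].

Lemma word_invK : involutive word_inv.
Proof.
move=> w; rewrite /word_inv map_rev revK -map_comp map_id_in // => -[x b] _ /=.
by rewrite negbK.
Qed.

Lemma word_inv_cat w w' : word_inv (w ++ w') = word_inv w' ++ word_inv w.
Proof. by rewrite /word_inv map_cat rev_cat. Qed.

Lemma word_mulV w : pres_rel (w ++ word_inv w) [::].
Proof.
elim: w => [|[x b] w IHw]; first exact: pres_refl.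
rewrite -cat1s word_inv_cat -catA (catA w).
have h : pres_rel ([:: (x, b)] ++ (w ++ word_inv w) ++ word_inv [:: (x, b)])
                  ([:: (x, b)] ++ [::] ++ word_inv [:: (x, b)]).
  by do 2![apply: pres_cat; first by [exact: pres_refl | exact: IHw]];
     exact: pres_refl.
exact: pres_trans h (pres_cancel x b).
Qed.

Lemma word_mulVl w : pres_rel (word_inv w ++ w) [::].
Proof. by have := word_mulV (word_inv w); rewrite word_invK. Qed.

Lemma word_inv_rel w w' : pres_rel w w' -> pres_rel (word_inv w) (word_inv w').
Proof.
move=> h; apply: (@pres_trans _ (word_inv w ++ (w' ++ word_inv w'))).
  rewrite -[X in pres_rel X]cats0; apply: pres_cat; first exact: pres_refl.
  exact/pres_sym/word_mulV.
rewrite catA -[X in pres_rel _ X]cat0s; apply: pres_cat; last exact: pres_refl.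
apply: (@pres_trans _ (word_inv w ++ w)); last exact: word_mulVl.
by apply: pres_cat; [exact: pres_refl | exact: pres_sym].
Qed.

Definition pres_mul (x y : presented) := pres_word (repr x ++ repr y).
Definition pres_inv (x : presented) := pres_word (word_inv (repr x)).
Definition pres_one : presented := pres_word [::].

Lemma pres_mulE w w' :
  pres_mul (pres_word w) (pres_word w') = pres_word (w ++ w').
Proof. by apply/pres_wordP/pres_cat; apply/pres_wordP; rewrite pres_wordK. Qed.

Lemma pres_invE w : pres_inv (pres_word w) = pres_word (word_inv w).
Proof. by apply/pres_wordP/word_inv_rel/pres_wordP; rewrite pres_wordK. Qed.

Lemma pres_mulA : associative pres_mul.
Proof.
move=> x y z; rewrite -[x]pres_wordK -[y]pres_wordK -[z]pres_wordK.
by rewrite !pres_mulE catA.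
Qed.

Lemma pres_mul1 : left_id pres_one pres_mul.
Proof. by move=> x; rewrite -[x]pres_wordK pres_mulE. Qed.

Lemma pres_mul1r : right_id pres_one pres_mul.
Proof. by move=> x; rewrite -[x]pres_wordK pres_mulE cats0. Qed.

Lemma pres_mulV : left_inverse pres_one pres_inv pres_mul.
Proof.
move=> x; rewrite -[x]pres_wordK pres_invE pres_mulE.
exact/pres_wordP/word_mulVl.
Qed.

Lemma pres_mulVr : right_inverse pres_one pres_inv pres_mul.
Proof.
move=> x; rewrite -[x]pres_wordK pres_invE pres_mulE.
exact/pres_wordP/word_mulV.
Qed.

HB.instance Definition _ := isGroup.Build presented
  pres_mulA pres_mul1 pres_mul1r pres_mulV pres_mulVr.

End Presentation.

Record graph := Graph {
  vertex :> finType;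
  edge : rel vertex;
  edge_sym : symmetric edge;
  edge_irr : irreflexive edge;
  vertex_gt0 : (0 < #|vertex|)%N
}.

Definition raag_relators (Gamma : graph) : set (word Gamma) :=
  [set r | exists v w : Gamma, edge v w /\
           r = [:: (v, false); (w, false); (v, true); (w, true)]].

Definition raag (Gamma : graph) : groupType :=
  presented (raag_relators (Gamma := Gamma)).

Definition free_product_relators (G H : groupType) : set (word (G + H)%type) :=
  [set r | (exists g g' : G,
              r = [:: (inl g, true); (inl g', true); (inl (g * g')%g, false)]) \/
           (exists h h' : H,
              r = [:: (inr h, true); (inr h', true); (inr (h * h')%g, false)])].

Definition free_product (G H : groupType) : groupType :=
  presented (free_product_relators (G := G) (H := H)).

Definition group_iso (G H : groupType) : Prop :=
  exists f : {multiplicative G -> H}, bijective f.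

Definition point_edge : rel unit := fun _ _ => false.

Fact point_edge_sym : symmetric point_edge.
Proof. by []. Qed.

Fact point_edge_irr : irreflexive point_edge.
Proof. by []. Qed.

Fact point_gt0 : (0 < #|{: unit}|)%N.
Proof. by rewrite card_unit. Qed.

Definition point_graph : graph :=
  Graph point_edge_sym point_edge_irr point_gt0.

(* The infinite cyclic group, as the RAAG of the graph with one vertex. *)
Definition Zgroup : groupType := raag point_graph.

(* All the groups obtained are RAAGs: the free product corresponds to the
   disjoint union of graphs, the product with Z to the cone. The class is
   closed under isomorphism. *)
Inductive elementary_type : groupType -> Prop :=
| elementary_Z : elementary_type Zgroup
| elementary_free G H : elementary_type G -> elementary_type H ->
    elementary_type (free_product G H)
| elementary_prod G : elementary_type G ->
    elementary_type ((G * Zgroup)%type : groupType)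
| elementary_iso G H : group_iso G H -> elementary_type G -> elementary_type H.

Local Open Scope ring_scope.
Local Open Scope classical_set_scope.

Record gradedAlg (F : fieldType) := GradedAlg {
  gr_alg :> algType F;
  homog : nat -> set gr_alg;
  homog0 : forall n, homog n 0;
  homogP : forall n (a : F) x y, homog n x -> homog n y -> homog n (a *: x + y);
  homog_one : homog 0 1;
  homogM : forall m n x y, homog m x -> homog n y -> homog (m + n)%N (x * y);
  homog_sum : forall x, exists N (c : nat -> gr_alg),
    (forall i, homog i (c i)) /\ x = \sum_(i < N) c i;
  homog_direct : forall N (c : nat -> gr_alg), (forall i, homog i (c i)) ->
    \sum_(i < N) c i = 0 -> forall i, (i < N)%N -> c i = 0
}.

(* The algebra of the F-valued functions on words over X that vanish on all
   sufficiently long words, with the convolution product; the functions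
   supported on words of length n form its component of degree n.
   - For X = 'I_k it is the tensor algebra of F^k: a function on words of
     length n is a tensor in (F^k)^{(x) n}, given by its coordinates.
   - For X a group G, a function on words of length n is an inhomogeneous
     n-cochain G^n -> F, and the product is the cup product of cochains. *)
Section WordAlgebra.
Variables (X : Type) (F : fieldType).

Definition short_support : {pred (seq X -> F^o)} :=
  fun f => `[< exists n, forall s, (n <= size s)%N -> f s = 0 >].

Fact short_support_submod : submod_closed short_support.
Proof.
split; first by apply/asboolP; exists 0%N.
move=> a f g /asboolP[m hm] /asboolP[n hn]; apply/asboolP; exists (m + n)%N => s hs.
have -> : (a *: f + g) s = a * f s + g s by [].
rewrite hm ?hn ?mulr0 ?addr0 //; apply: leq_trans hs.
  exact: leq_addl.
exact: leq_addr.
Qed.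

HB.instance Definition _ :=
  GRing.isSubmodClosed.Build F _ short_support short_support_submod.

Record wordfun := WordFun {
  wordfun_val :> seq X -> F^o;
  wordfun_short : wordfun_val \in short_support
}.

HB.instance Definition _ := [isSub for wordfun_val].
HB.instance Definition _ := [Choice of wordfun by <:].
HB.instance Definition _ := [SubChoice_isSubLmodule of wordfun by <:].

Lemma wordfunP (f g : wordfun) : (forall s, f s = g s) -> f = g.
Proof. by move=> h; apply/val_inj/funext. Qed.

Lemma wordfun_shortP (f : wordfun) :
  exists n, forall s, (n <= size s)%N -> f s = 0.
Proof. by have /asboolP := wordfun_short f. Qed.

Lemma wordfun_linE (a : F) (f g : wordfun) s : (a *: f + g) s = a * f s + g s.
Proof. by []. Qed.

Lemma wordfun_addE (f g : wordfun) s : (f + g) s = f s + g s.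
Proof. by []. Qed.

Lemma wordfun_oppE (f : wordfun) s : (- f) s = - f s.
Proof. by []. Qed.

Lemma wordfun_subE (f g : wordfun) s : (f - g) s = f s - g s.
Proof. by []. Qed.

Lemma wordfun_sumE I (r : seq I) (P : pred I) (c : I -> wordfun) s :
  (\sum_(i <- r | P i) c i) s = \sum_(i <- r | P i) c i s.
Proof. by elim/big_rec2: _ => // i y x _ <-; rewrite wordfun_addE. Qed.

Definition conv (f g : seq X -> F) (s : seq X) : F :=
  \sum_(i < (size s).+1) f (take i s) * g (drop i s).

Fact conv_short (f g : wordfun) : conv f g \in short_support.
Proof.
have [[m hm] [n hn]] := (wordfun_shortP f, wordfun_shortP g).
apply/asboolP; exists (m + n)%N => s hs; apply: big1 => i _.
have [hmi|him] := leqP m i; first by rewrite hm ?mul0r // size_takel // -ltnS.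
rewrite hn ?mulr0 // size_drop leq_subRL; last by rewrite -ltnS.
by rewrite (leq_trans _ hs) // leq_add2r ltnW.
Qed.

Definition wordfun_mul (f g : wordfun) : wordfun := WordFun (conv_short f g).

Definition unit_fun (s : seq X) : F := if s is [::] then 1 else 0.

Fact unit_short : unit_fun \in short_support.
Proof. by apply/asboolP; exists 1%N => -[]. Qed.

Definition wordfun_one : wordfun := WordFun unit_short.

Fact wordfun_mulA : associative wordfun_mul.
Proof.
move=> f g h; apply: wordfunP => s /=; rewrite /conv.
transitivity (\sum_(i < (size s).+1) \sum_(j < (size s).+1 | (i <= j)%N)
   f (take i s) * (g (drop i (take j s)) * h (drop j s))).
  apply: eq_bigr => i _; have hi : (i <= size s)%N by rewrite -ltnS.
  rewrite big_distrr /= size_drop -subSn //.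
  rewrite -(big_mkord xpredT (fun j => f (take i s) *
     (g (take j (drop i s)) * h (drop j (drop i s))))).
  rewrite -(big_geq_mkord _ _ xpredT (fun j => f (take i s) *
     (g (drop i (take j s)) * h (drop j s)))).
  rewrite -[X in index_iota X (size s).+1]add0n big_addn.
  by apply: eq_bigr => j _; rewrite drop_drop take_drop.
rewrite (exchange_big_dep xpredT) //=; apply: eq_bigr => j _.
have hj : (j <= size s)%N by rewrite -ltnS.
rewrite big_distrl /= size_takel // (big_ord_widen_cond _ xpredT
  (fun i => f (take i (take j s)) * g (drop i (take j s)) * h (drop j s)) (ltn_ord j)).
by apply: eq_big => // i hij; rewrite take_takel // mulrA.
Qed.

Fact wordfun_mul1 : left_id wordfun_one wordfun_mul.
Proof.
move=> f; apply: wordfunP => s /=; rewrite /conv big_ord_recl /= take0 drop0.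
rewrite mul1r big1 ?addr0 // => i _; case: s i => [|x s] [i hi] //=.
by rewrite mul0r.
Qed.

Fact wordfun_mul1r : right_id wordfun_one wordfun_mul.
Proof.
move=> f; apply: wordfunP => s /=; rewrite /conv big_ord_recr /= take_size.
rewrite drop_size mulr1 big1 ?add0r // => i _.
have : (0 < size (drop i s))%N by rewrite size_drop subn_gt0.
by case: (drop i s) => //= *; rewrite mulr0.
Qed.

Fact wordfun_mulDl : left_distributive wordfun_mul +%R.
Proof.
move=> f g h; apply: wordfunP => s; rewrite wordfun_addE.
rewrite ![wordfun_val (wordfun_mul _ _) _]/(conv _ _ _) /conv -big_split.
by apply: eq_bigr => i _; rewrite wordfun_addE mulrDl.
Qed.

Fact wordfun_mulDr : right_distributive wordfun_mul +%R.
Proof.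
move=> f g h; apply: wordfunP => s; rewrite wordfun_addE.
rewrite ![wordfun_val (wordfun_mul _ _) _]/(conv _ _ _) /conv -big_split.
by apply: eq_bigr => i _; rewrite wordfun_addE mulrDr.
Qed.

Fact wordfun_one_neq0 : wordfun_one != 0.
Proof.
apply/eqP => /(congr1 (fun f : wordfun => f [::])) /eqP.
by rewrite /= oner_eq0.
Qed.

HB.instance Definition _ := GRing.Zmodule_isNzRing.Build wordfun wordfun_mulA
  wordfun_mul1 wordfun_mul1r wordfun_mulDl wordfun_mulDr wordfun_one_neq0.

Lemma wordfun_mulE (f g : wordfun) : f * g = conv f g :> (seq X -> F).
Proof. by []. Qed.

Lemma wordfun_scaleE (a : F) (f : wordfun) s : (a *: f) s = a * f s.
Proof. by []. Qed.

Fact wordfun_scalerAl (a : F) (f g : wordfun) : a *: (f * g) = (a *: f) * g.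
Proof.
apply: wordfunP => s; rewrite wordfun_scaleE !wordfun_mulE /conv big_distrr.
by apply: eq_bigr => i _; exact: mulrA.
Qed.

HB.instance Definition _ :=
  GRing.Lmodule_isLalgebra.Build F wordfun wordfun_scalerAl.

Fact wordfun_scalerAr (a : F) (f g : wordfun) : a *: (f * g) = f * (a *: g).
Proof.
apply: wordfunP => s; rewrite wordfun_scaleE !wordfun_mulE /conv big_distrr.
by apply: eq_bigr => i _; exact: mulrCA.
Qed.

HB.instance Definition _ :=
  GRing.Lalgebra_isAlgebra.Build F wordfun wordfun_scalerAr.

Definition word_homog (n : nat) : set wordfun :=
  [set f | forall s, size s != n -> f s = 0].

Definition comp_fun (n : nat) (f : seq X -> F) (s : seq X) : F :=
  if size s == n then f s else 0.

Fact comp_short n (f : wordfun) : comp_fun n f \in short_support.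
Proof.
apply/asboolP; exists n.+1 => s hs; rewrite /comp_fun gtn_eqF //.
Qed.

Definition word_comp n (f : wordfun) : wordfun := WordFun (comp_short n f).

Lemma word_comp_homog n f : word_homog n (word_comp n f).
Proof. by move=> s hs; rewrite /= /comp_fun (negbTE hs). Qed.

Lemma word_comp_id n f : word_homog n f -> word_comp n f = f.
Proof.
by move=> hf; apply: wordfunP => s /=; rewrite /comp_fun; case: eqVneq => // /hf.
Qed.

Lemma word_comp_neq m n f : m != n -> word_homog m f -> word_comp n f = 0.
Proof.
move=> mn hf; apply: wordfunP => s /=; rewrite /comp_fun.
by case: eqP => // hs; rewrite hf // hs eq_sym.
Qed.

Lemma word_comp_sum (f : wordfun) n :
  (forall s, (n <= size s)%N -> f s = 0) -> f = \sum_(i < n) word_comp i f.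
Proof.
move=> hn; apply: wordfunP => s; rewrite wordfun_sumE.
have [/hn h|h] := leqP n (size s).
  by rewrite h big1 // => i _; rewrite /= /comp_fun h if_same.
rewrite (bigD1 (Ordinal h)) //= /comp_fun eqxx big1 ?addr0 // => i hi.
by rewrite eq_sym; case: eqP => // e; case/eqP: hi; apply: val_inj.
Qed.

Fact word_comp_is_linear n : linear (word_comp n).
Proof.
move=> a f g; apply: wordfunP => s; rewrite wordfun_linE /= /comp_fun.
by case: eqP; rewrite ?mulr0 ?addr0.
Qed.

HB.instance Definition _ n :=
  GRing.isLinear.Build F wordfun wordfun _ (word_comp n) (word_comp_is_linear n).

Lemma word_comp_of_sum N (c : nat -> wordfun) i :
  (forall i, word_homog i (c i)) -> (i < N)%N ->
  word_comp i (\sum_(j < N) c j) = c i.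
Proof.
move=> hc hi; rewrite linear_sum (bigD1 (Ordinal hi)) //= word_comp_id //.
rewrite big1 ?addr0 // => j hj; apply: word_comp_neq (hc j).
by apply: contra hj => /eqP e; apply/eqP/val_inj.
Qed.

Fact word_homog0 n : word_homog n 0. Proof. by []. Qed.

Fact word_homogP n (a : F) f g :
  word_homog n f -> word_homog n g -> word_homog n (a *: f + g).
Proof. by move=> hf hg s hs; rewrite wordfun_linE hf // hg // mulr0 addr0. Qed.

Fact word_homog_one : word_homog 0 1.
Proof. by case. Qed.

Fact word_homogM m n f g :
  word_homog m f -> word_homog n g -> word_homog (m + n)%N (f * g).
Proof.
move=> hf hg s hs; rewrite wordfun_mulE; apply: big1 => i _.
have hi : (i <= size s)%N by rewrite -ltnS.
have [im|im] := eqVneq (i : nat) m; last by rewrite hf ?mul0r ?size_takel.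
rewrite hg ?mulr0 // size_drop; apply: contra hs => /eqP <-.
by rewrite -im subnKC.
Qed.

Fact word_homog_sum f : exists N (c : nat -> wordfun),
  (forall i, word_homog i (c i)) /\ f = \sum_(i < N) c i.
Proof.
have [n hn] := wordfun_shortP f; exists n, (fun i => word_comp i f).
by split; [move=> i; exact: word_comp_homog | exact: word_comp_sum].
Qed.

Fact word_homog_direct N (c : nat -> wordfun) :
  (forall i, word_homog i (c i)) -> \sum_(i < N) c i = 0 ->
  forall i, (i < N)%N -> c i = 0.
Proof. by move=> hc h0 i hi; rewrite -(word_comp_of_sum hc hi) h0 linear0. Qed.

Definition word_algebra : gradedAlg F :=
  GradedAlg word_homog0 word_homogP word_homog_one word_homogM
    word_homog_sum word_homog_direct.

End WordAlgebra.

Definition tensor_algebra (F : fieldType) (k : nat) : gradedAlg F :=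
  word_algebra 'I_k F.

Section Koszul.
Variable F : fieldType.

Section Ideals.
Variable A : gradedAlg F.

Definition ideal (I : set A) : Prop :=
  [/\ I 0, forall x y, I x -> I y -> I (x + y)
    & forall a x, I x -> I (a * x) /\ I (x * a)].

Definition graded_ideal (I : set A) : Prop :=
  ideal I /\ forall x, I x -> exists N (c : nat -> A),
    (forall i, (I `&` homog i) (c i)) /\ x = \sum_(i < N) c i.

Definition generated_ideal (S : set A) : set A :=
  [set x | exists t : seq (A * A * A),
     (forall p, p \in t -> S p.1.2) /\ x = \sum_(p <- t) p.1.1 * p.1.2 * p.2].

Definition left_multiples (S : set A) : set A :=
  [set x | exists t : seq (A * A),
     (forall p, p \in t -> S p.2) /\ x = \sum_(p <- t) p.1 * p.2].

Definition colon (I J : set A) : set A :=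
  [set a | forall x, J x -> I (a * x)].

(* Membership in L(A): the ideals with I = A . I_1. *)
Definition linear_ideal (I : set A) : Prop :=
  graded_ideal I /\ I = left_multiples (I `&` homog 1).

End Ideals.

(* A graded isomorphism T(V)/(Omega) -> A, for V = F^k and Omega a subspace of
   V (x) V, is given as a surjective morphism of graded algebras T(V) -> A with
   kernel (Omega). *)
Definition quadratic (A : gradedAlg F) : Prop :=
  exists (k : nat) (Omega : set (tensor_algebra F k))
         (phi : {lrmorphism tensor_algebra F k -> A}),
    [/\ Omega `<=` homog 2,
        Omega 0,
        forall (a : F) x y, Omega x -> Omega y -> Omega (a *: x + y),
        [/\ forall n x, homog n x -> homog n (phi x)
          & forall y, exists x, phi x = y]
      & [set x | phi x = 0] = generated_ideal Omega].

Definition universally_koszul (A : gradedAlg F) : Prop :=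
  quadratic A /\
  forall I : set A, linear_ideal I ->
  forall b, (homog 1 `\` (I `&` homog 1)) b ->
    linear_ideal (colon I (generated_ideal [set b])).

End Koszul.

(* The algebra H(G, F) for the trivial G-module F: cocycles modulo coboundaries
   in the algebra of inhomogeneous cochains; see the word algebra above. *)
Section Cohomology.
Variables (G : groupType) (F : fieldType).

Local Notation cochain := (wordfun G F).

(* For s = [:: g_1; ...; g_n] with n > 0:
     face 0 s = [:: g_2; ...; g_n],
     face i s = [:: g_1; ...; g_i * g_(i+1); ...; g_n] for 0 < i < n,
     face n s = [:: g_1; ...; g_(n-1)]. *)
Definition face (i : nat) (s : seq G) : seq G :=
  if i == 0%N then behead s
  else if i == size s then take i.-1 s
  else take i.-1 s ++ (nth 1 s i.-1 * nth 1 s i)%g :: drop i.+1 s.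

(* (d f)(g_1, ..., g_n) = \sum_(0 <= i <= n) (-1)^i f (face i (g_1, ..., g_n)) *)
Definition diff_fun (f : seq G -> F) (s : seq G) : F :=
  if s is [::] then 0 else \sum_(i < (size s).+1) (-1) ^+ i * f (face i s).

Lemma size_face i s : (i <= size s)%N -> size (face i s) = (size s).-1.
Proof.
rewrite /face => hi; case: eqVneq => [_|i0]; first by rewrite size_behead.
case: eqVneq => [->|ni]; first by rewrite size_takel // leq_pred.
have lt_i : (i < size s)%N by rewrite ltn_neqAle ni.
case: i i0 hi ni lt_i => // i _ hi _ lt_i /=.
rewrite size_cat size_takel 1?ltnW //= size_drop -addSnnS -(subnKC lt_i) /=.
by rewrite addKn.
Qed.

Fact diff_short (f : cochain) : diff_fun f \in @short_support G F.
Proof.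
have [n hn] := wordfun_shortP f; apply/asboolP; exists n.+1 => -[|x s] // hs.
rewrite /diff_fun big1 // => i _; rewrite hn ?mulr0 //.
by rewrite size_face // -ltnS.
Qed.

Definition diff (f : cochain) : cochain := WordFun (diff_short f).

Fact diff_is_linear : linear diff.
Proof.
move=> a f g; apply: wordfunP => -[|x s]; rewrite wordfun_linE /= /diff_fun.
  by rewrite mulr0 addr0.
rewrite big_distrr -big_split; apply: eq_bigr => i _.
by rewrite mulrDr; congr (_ + _); exact: mulrCA.
Qed.

HB.instance Definition _ :=
  GRing.isLinear.Build F cochain cochain _ diff diff_is_linear.

Definition sign_fun (f : seq G -> F) (s : seq G) : F := (-1) ^+ size s * f s.

Fact sign_short (f : cochain) : sign_fun f \in @short_support G F.
Proof.
have [n hn] := wordfun_shortP f; apply/asboolP; exists n => s hs.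
by rewrite /sign_fun hn // mulr0.
Qed.

Definition sign_twist (f : cochain) : cochain := WordFun (sign_short f).

Lemma sign_twistK : involutive sign_twist.
Proof.
move=> f; apply: wordfunP => s; rewrite /= /sign_fun mulrA -exprMn.
by rewrite mulrNN mulr1 expr1n mul1r.
Qed.

Lemma sign_twist0 : sign_twist 0 = 0.
Proof. by apply: wordfunP => s; exact: mulr0. Qed.

Lemma diff_sign f : diff (sign_twist f) = - sign_twist (diff f).
Proof.
apply: wordfunP => -[|x s]; rewrite wordfun_oppE /= /sign_fun /diff_fun.
  by rewrite mulr0 oppr0.
rewrite big_distrr /= -sumrN; apply: eq_bigr => i _.
rewrite size_face -1?ltnS // exprS mulN1r mulNr opprK /=.
exact: mulrCA.
Qed.

Lemma face_cat p x y q : face (size p).+1 (p ++ x :: y :: q) = p ++ (x * y)%g :: q.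
Proof.
rewrite /face /= size_cat /= ltn_eqF ?take_size_cat //; last first.
  by rewrite !addnS !ltnS leq_addr.
rewrite !nth_cat ltnn subnn ltnNge leqnSn subSnn /= drop_cat ltnNge ltnW //=.
by rewrite -addn2 addKn /= drop0.
Qed.

Lemma face_last s : face (size s) s = take (size s).-1 s.
Proof. by rewrite /face eqxx; case: s. Qed.

Lemma face_split i (s : seq G) : (0 < i < size s)%N ->
  exists p x y q, s = p ++ x :: y :: q /\ i = (size p).+1.
Proof.
case: i => // i /= hi; exists (take i s), (nth 1%g s i), (nth 1%g s i.+1).
exists (drop i.+2 s); split; last by rewrite size_takel // ltnW // ltnW.
by rewrite -!drop_nth ?cat_take_drop // ltnW.
Qed.

Lemma take_face_le i j (s : seq G) : (i <= j < size s)%N ->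
  take j (face i s) = face i (take j.+1 s).
Proof.
case: i => [|i] /andP[ij js]; first by case: s js.
have [|p [x [y [q [es ei]]]]] := @face_split i.+1 s.
  exact: leq_ltn_trans ij js.
have -> : j = (size p + (j - i.+1).+1)%N by case: ei ij => ->; lia.
set m := (j - i.+1)%N; rewrite {}es {}ei face_cat -addnS !take_cat.
by rewrite !ltnNge !leq_addr /= !addKn /= face_cat.
Qed.

Lemma drop_face_le i j (s : seq G) : (i <= j < size s)%N ->
  drop j (face i s) = drop j.+1 s.
Proof.
case: i => [|i] /andP[ij js]; first by case: s js.
have [|p [x [y [q [es ei]]]]] := @face_split i.+1 s.
  exact: leq_ltn_trans ij js.
have -> : j = (size p + (j - i.+1).+1)%N by case: ei ij => ->; lia.
set m := (j - i.+1)%N; rewrite {}es {}ei face_cat -addnS !drop_cat.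
by rewrite !ltnNge !leq_addr /= !addKn.
Qed.

Lemma take_face_gt i j (s : seq G) : (j < i <= size s)%N ->
  take j (face i s) = take j s.
Proof.
case/andP=> ji; rewrite leq_eqVlt => /orP[/eqP ei|hi].
  by rewrite ei face_last take_takel //; lia.
have [|p [x [y [q [es ei]]]]] := @face_split i s.
  by rewrite hi andbT; lia.
by rewrite es ei face_cat !takel_cat //; lia.
Qed.

Lemma drop_face_gt i j (s : seq G) : (j < i <= size s)%N ->
  drop j (face i s) = face (i - j) (drop j s).
Proof.
case/andP=> ji; rewrite leq_eqVlt => /orP[/eqP ei|hi].
  rewrite ei face_last -size_drop face_last size_drop take_drop.
  by congr (drop _ (take _ _)); lia.
have [|p [x [y [q [es ei]]]]] := @face_split i s.
  by rewrite hi andbT; lia.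
have jp : (j <= size p)%N by lia.
have dropl r : drop j (p ++ r) = drop j p ++ r.
  rewrite drop_cat; case: ltnP => // pj.
  by rewrite (@anti_leq j (size p)) ?jp // subnn drop0 drop_size.
by rewrite es ei face_cat !dropl -face_cat size_drop subSn.
Qed.

Lemma diffM (f g : cochain) :
  diff (f * g) = diff f * g + sign_twist f * diff g.
Proof.
apply: wordfunP => s; rewrite wordfun_addE !wordfun_mulE /conv.
case: (posnP (size s)) => [/size0nil ->|s0].
  by rewrite !big_ord_recl !big_ord0 /= mul0r mulr0 !addr0.
set n := size s in s0 *.
pose a k i := (-1) ^+ i * f (face i (take k s)) * g (drop k s).
pose b k i := (-1) ^+ i * f (take k s) * g (face (i - k) (drop k s)).
have dfE h t : (0 < size t)%N ->
    diff h t = \sum_(0 <= i < (size t).+1) (-1) ^+ i * h (face i t).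
  by case: t => // x t _; rewrite big_mkord.
have -> : diff (f * g) s =
    \sum_(0 <= j < n) (\sum_(0 <= i < j.+1) a j.+1 i +
                       \sum_(j.+1 <= i < n.+1) b j i).
  rewrite dfE //.
  transitivity (\sum_(0 <= i < n.+1) \sum_(0 <= j < n)
      (if (i <= j)%N then a j.+1 i else b j i)).
    apply: eq_big_nat => i /andP[_ hi].
    rewrite wordfun_mulE /conv size_face // -/n prednK // big_mkord.
    rewrite big_distrr; apply: eq_bigr => j _; have jn := ltn_ord j.
    case: leqP => ij; rewrite /a /b -!mulrA.
      by rewrite take_face_le ?drop_face_le // ij.
    by rewrite take_face_gt ?drop_face_gt // ij.
  rewrite exchange_big_nat /=; apply: eq_big_nat => j /andP[_ jn].
  rewrite (@big_cat_nat _ _ _ j.+1 0 n.+1) ?ltnS 1?ltnW //=; congr (_ + _).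
    by apply: eq_big_nat => i /andP[_]; rewrite ltnS => ->.
  by apply: eq_big_nat => i /andP[ji _]; rewrite leqNgt ji.
rewrite -(big_mkord xpredT (fun k => diff f (take k s) * g (drop k s))).
rewrite -(big_mkord xpredT (fun k => sign_twist f (take k s) * diff g (drop k s))).
rewrite big_nat_recl // [X in _ = _ + X]big_nat_recr //= take0 drop_size.
rewrite mul0r add0r mulr0 addr0 -big_split /=.
apply: eq_big_nat => j /andP[_ jn].
have -> : diff f (take j.+1 s) * g (drop j.+1 s) = \sum_(0 <= i < j.+2) a j.+1 i.
  rewrite dfE size_takel // big_distrl /=; exact: eq_bigr.
have -> : sign_twist f (take j s) * diff g (drop j s) =
          \sum_(j <= i < n.+1) b j i.
  rewrite dfE size_drop ?subn_gt0 // -subSn 1?ltnW // -/n.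
  rewrite -[X in index_iota X n.+1]add0n big_addn.
  rewrite big_distrr /=; apply: eq_bigr => i _.
  rewrite /b /sign_fun size_takel 1?ltnW // addnK exprD.
  have aux (x y z w : F) : x * y * (z * w) = z * x * y * w.
    by rewrite mulrACA mulrA (mulrC x).
  exact: aux.
have -> : \sum_(0 <= i < j.+2) a j.+1 i =
    \sum_(0 <= i < j.+1) a j.+1 i + a j.+1 j.+1 by rewrite big_nat_recr.
have -> : \sum_(j <= i < n.+1) b j i = b j j + \sum_(j.+1 <= i < n.+1) b j i.
  by rewrite big_ltn // ltnW.
have ab : a j.+1 j.+1 + b j j = 0.
  rewrite /a /b subnn; have sj : size (take j.+1 s) = j.+1 by rewrite size_takel.
  rewrite -{2}sj face_last sj /= take_takel //.
  have -> : face 0 (drop j s) = drop j.+1 s by rewrite /face -drop1 drop_drop.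
  by rewrite exprS mulN1r !mulNr addNr.
by rewrite -addrA (addrA (a j.+1 j.+1)) ab add0r.
Qed.

Definition cocycle : {pred cochain} := fun f => diff f == 0.

Fact cocycle_subalg : subalg_closed cocycle.
Proof.
split=> [|a f g /eqP df /eqP dg|f g /eqP df /eqP dg]; apply/eqP.
- apply: wordfunP => -[|x [|y s]] //=; rewrite /diff_fun /=.
    by rewrite !big_ord_recl big_ord0 /= expr0 expr1 !mulr1 addr0 subrr.
  apply: big1 => i _; rewrite /= /unit_fun.
  have := @size_face i [:: x, y & s]; rewrite -ltnS => /(_ (ltn_ord i)).
  by case: face => //= *; rewrite mulr0.
- by rewrite diff_is_linear df dg scaler0 addr0.
- by rewrite diffM df dg mul0r mulr0 addr0.
Qed.

HB.instance Definition _ :=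
  GRing.isSubalgClosed.Build F cochain cocycle cocycle_subalg.

Record cocycles := Cocycle {
  cocycle_val :> cochain;
  cocycle_valP : cocycle_val \in cocycle
}.

HB.instance Definition _ := [isSub for cocycle_val].
HB.instance Definition _ := [Choice of cocycles by <:].
HB.instance Definition _ := [SubChoice_isSubAlgebra of cocycles by <:].

Lemma cocycle_diff (z : cocycles) : diff z = 0.
Proof. exact/eqP/cocycle_valP. Qed.

Definition coboundary : {pred cocycles} :=
  fun z => `[< exists h : cochain, diff h = z >].

Fact coboundary_submod : submod_closed coboundary.
Proof.
split; first by apply/asboolP; exists 0; rewrite linear0.
move=> a y z /asboolP[g hg] /asboolP[h hh]; apply/asboolP.
by exists (a *: g + h); rewrite diff_is_linear hg hh.
Qed.

HB.instance Definition _ :=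
  GRing.isSubmodClosed.Build F cocycles coboundary coboundary_submod.

Lemma coboundaryMr (y z : cocycles) : y \in coboundary -> y * z \in coboundary.
Proof.
move=> /asboolP[h hh]; apply/asboolP; exists (h * cocycle_val z).
by rewrite diffM cocycle_diff mulr0 addr0 hh.
Qed.

Lemma coboundaryMl (y z : cocycles) : z \in coboundary -> y * z \in coboundary.
Proof.
move=> /asboolP[h hh]; apply/asboolP; exists (sign_twist (cocycle_val y) * h).
by rewrite diffM diff_sign cocycle_diff sign_twist0 oppr0 mul0r add0r
   sign_twistK hh.
Qed.

Lemma coboundary1 : 1 \notin coboundary.
Proof.
apply/asboolP => -[h] /(congr1 (fun f : cochain => f [::])) /eqP.
by rewrite /= eq_sym oner_eq0.
Qed.

Local Open Scope quotient_scope.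

Definition cohomology := Quotient.quot coboundary.
HB.instance Definition _ := GRing.Zmodule.on cohomology.
HB.instance Definition _ := EqQuotient.on cohomology.

Definition coh_class (z : cocycles) : cohomology := \pi_cohomology z.

Lemma coh_classP (y z : cocycles) :
  coh_class y = coh_class z <-> y - z \in coboundary.
Proof. by rewrite Quotient.idealrBE; split=> [/eqP|/eqP]. Qed.

Lemma coh_class_eq0 (z : cocycles) : coh_class z = 0 <-> z \in coboundary.
Proof.
have -> : 0 = coh_class 0 by rewrite /coh_class [RHS]pi_zeror.
by rewrite coh_classP subr0.
Qed.

Lemma coh_classK (x : cohomology) : coh_class (repr x) = x.
Proof. exact: reprK. Qed.

Lemma coh_classD y z : coh_class (y + z) = coh_class y + coh_class z.
Proof. exact: pi_addr. Qed.

Lemma coh_class0 : coh_class 0 = 0.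
Proof. by apply/coh_class_eq0; exact: rpred0. Qed.

Lemma coh_class_sum N (c : nat -> cocycles) :
  coh_class (\sum_(i < N) c i) = \sum_(i < N) coh_class (c i).
Proof. exact: (big_morph coh_class coh_classD coh_class0). Qed.

Lemma repr_coh_class z : repr (coh_class z) - z \in coboundary.
Proof. by apply/coh_classP; rewrite coh_classK. Qed.

Definition coh_mul (x y : cohomology) := coh_class (repr x * repr y).
Definition coh_scale (a : F) (x : cohomology) := coh_class (a *: repr x).
Definition coh_one := coh_class 1.

Lemma coh_mulE y z : coh_mul (coh_class y) (coh_class z) = coh_class (y * z).
Proof.
apply/coh_classP; set y' := repr _; set z' := repr _.
have -> : y' * z' - y * z = (y' - y) * z' + y * (z' - z).
  by rewrite mulrBl mulrBr addrA subrK.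
by apply: rpredD; [apply: coboundaryMr | apply: coboundaryMl];
   exact: repr_coh_class.
Qed.

Lemma coh_scaleE a z : coh_scale a (coh_class z) = coh_class (a *: z).
Proof.
by apply/coh_classP; rewrite -scalerBr; apply: rpredZ; exact: repr_coh_class.
Qed.

Fact coh_mulA : associative coh_mul.
Proof.
move=> x y z; rewrite -[x]coh_classK -[y]coh_classK -[z]coh_classK.
by rewrite !coh_mulE mulrA.
Qed.

Fact coh_mul1 : left_id coh_one coh_mul.
Proof. by move=> x; rewrite -[x]coh_classK coh_mulE mul1r. Qed.

Fact coh_mul1r : right_id coh_one coh_mul.
Proof. by move=> x; rewrite -[x]coh_classK coh_mulE mulr1. Qed.

Fact coh_mulDl : left_distributive coh_mul +%R.
Proof.
move=> x y z; rewrite -[x]coh_classK -[y]coh_classK -[z]coh_classK.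
by rewrite -coh_classD !coh_mulE -coh_classD mulrDl.
Qed.

Fact coh_mulDr : right_distributive coh_mul +%R.
Proof.
move=> x y z; rewrite -[x]coh_classK -[y]coh_classK -[z]coh_classK.
by rewrite -coh_classD !coh_mulE -coh_classD mulrDr.
Qed.

Fact coh_one_neq0 : coh_one != 0.
Proof. by apply/eqP => /coh_class_eq0; exact/negP/coboundary1. Qed.

HB.instance Definition _ := GRing.Zmodule_isNzRing.Build cohomology
  coh_mulA coh_mul1 coh_mul1r coh_mulDl coh_mulDr coh_one_neq0.

Fact coh_scaleA a b x : coh_scale a (coh_scale b x) = coh_scale (a * b) x.
Proof. by rewrite -[x]coh_classK !coh_scaleE scalerA. Qed.

Fact coh_scale1 : left_id 1 coh_scale.
Proof. by move=> x; rewrite -[x]coh_classK coh_scaleE scale1r. Qed.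

Fact coh_scaleDr : right_distributive coh_scale +%R.
Proof.
move=> a x y; rewrite -[x]coh_classK -[y]coh_classK.
by rewrite -coh_classD !coh_scaleE -coh_classD scalerDr.
Qed.

Fact coh_scaleDl x : {morph coh_scale^~ x : a b / a + b}.
Proof.
move=> a b; rewrite -[x]coh_classK.
by rewrite !coh_scaleE -coh_classD scalerDl.
Qed.

HB.instance Definition _ := GRing.Zmodule_isLmodule.Build F cohomology
  coh_scaleA coh_scale1 coh_scaleDr coh_scaleDl.

Lemma coh_classM y z : coh_class (y * z) = coh_class y * coh_class z.
Proof. by rewrite -coh_mulE. Qed.

Lemma coh_classZ a z : coh_class (a *: z) = a *: coh_class z.
Proof. by rewrite -coh_scaleE. Qed.

Fact coh_scalerAl (a : F) (x y : cohomology) : a *: (x * y) = (a *: x) * y.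
Proof.
rewrite -[x]coh_classK -[y]coh_classK.
by rewrite -coh_classM -!coh_classZ -coh_classM scalerAl.
Qed.

HB.instance Definition _ :=
  GRing.Lmodule_isLalgebra.Build F cohomology coh_scalerAl.

Fact coh_scalerAr (a : F) (x y : cohomology) : a *: (x * y) = x * (a *: y).
Proof.
rewrite -[x]coh_classK -[y]coh_classK.
by rewrite -coh_classM -!coh_classZ -coh_classM scalerAr.
Qed.

HB.instance Definition _ :=
  GRing.Lalgebra_isAlgebra.Build F cohomology coh_scalerAr.

Definition coh_homog (n : nat) : set cohomology :=
  [set x | exists z : cocycles, word_homog n (z : cochain) /\ coh_class z = x].

Lemma diff_comp n (f : cochain) :
  diff (word_comp n f) = word_comp n.+1 (diff f).
Proof.
apply: wordfunP => s; rewrite /= /comp_fun /diff_fun.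
case: s => [|x s]; first by rewrite eq_sym.
have [e|ne] := eqVneq (size (x :: s)) n.+1.
  apply: eq_bigr => i _; rewrite size_face -1?ltnS //.
  by have /= [/eqP ->] := e.
apply: big1 => i _; rewrite size_face -1?ltnS //.
by move: ne; rewrite /= eqSS => /negbTE ->; rewrite mulr0.
Qed.

Lemma diff_comp0 (f : cochain) : word_comp 0 (diff f) = 0.
Proof. by apply: wordfunP => -[|x s]. Qed.

Fact comp_cocycle n (z : cocycles) : word_comp n z \in cocycle.
Proof. by apply/eqP; rewrite diff_comp cocycle_diff linear0. Qed.

Definition cocycle_comp n (z : cocycles) : cocycles :=
  Cocycle (comp_cocycle n z).

Lemma coboundary_comp n z : z \in coboundary -> cocycle_comp n z \in coboundary.
Proof.
case/asboolP=> h hh; apply/asboolP; rewrite /= -hh.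
case: n => [|n]; first by exists 0; rewrite diff_comp0 linear0.
by exists (word_comp n h); rewrite diff_comp.
Qed.

Lemma cocycle_sumE N (c : nat -> cocycles) :
  cocycle_val (\sum_(i < N) c i) = \sum_(i < N) cocycle_val (c i).
Proof. exact: (big_morph cocycle_val). Qed.

Fact coh_homog0 n : coh_homog n 0.
Proof. by exists 0; split=> //; exact: coh_class0. Qed.

Fact coh_homogP n (a : F) x y :
  coh_homog n x -> coh_homog n y -> coh_homog n (a *: x + y).
Proof.
move=> [z [hz <-]] [t [ht <-]]; exists (a *: z + t).
by split; [exact: word_homogP | rewrite coh_classD coh_classZ].
Qed.

Fact coh_homog_one : coh_homog 0 1.
Proof. by exists 1; split=> //; exact: word_homog_one. Qed.

Fact coh_homogM m n x y :
  coh_homog m x -> coh_homog n y -> coh_homog (m + n)%N (x * y).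
Proof.
move=> [z [hz <-]] [t [ht <-]]; exists (z * t).
by split; [exact: word_homogM | rewrite coh_classM].
Qed.

Fact coh_homog_sum x : exists N (c : nat -> cohomology),
  (forall i, coh_homog i (c i)) /\ x = \sum_(i < N) c i.
Proof.
have [n hn] := wordfun_shortP (repr x : cocycles).
exists n, (fun i => coh_class (cocycle_comp i (repr x))); split=> [i|].
  by exists (cocycle_comp i (repr x)); split=> //; exact: word_comp_homog.
rewrite -(coh_class_sum n (fun i => cocycle_comp i (repr x))).
rewrite -[LHS]coh_classK; congr coh_class; apply: val_inj.
rewrite -[RHS]/(cocycle_val _) (cocycle_sumE n (fun i => cocycle_comp i (repr x))).
exact: word_comp_sum.
Qed.

Fact coh_homog_direct N (c : nat -> cohomology) :
  (forall i, coh_homog i (c i)) -> \sum_(i < N) c i = 0 ->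
  forall i, (i < N)%N -> c i = 0.
Proof.
move=> /choice[z hz] h0 i hi; rewrite -(hz i).2; apply/coh_class_eq0.
have zE : \sum_(j < N) z j \in coboundary.
  apply/coh_class_eq0; rewrite coh_class_sum -[RHS]h0.
  by apply: eq_bigr => j _; rewrite (hz j).2.
suff <- : cocycle_comp i (\sum_(j < N) z j) = z i by exact: coboundary_comp.
apply: val_inj.
rewrite -[LHS]/(word_comp i (cocycle_val _)) cocycle_sumE.
exact: (word_comp_of_sum (fun j => (hz j).1) hi).
Qed.

Definition cohomology_algebra : gradedAlg F :=
  GradedAlg coh_homog0 coh_homogP coh_homog_one coh_homogM
    coh_homog_sum coh_homog_direct.

End Cohomology.

(* Main.v *)
From HB Require Import structures.
Require Import Defs.
From mathcomp Require Import all_boot all_algebra perm.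
From mathcomp Require Import boolp classical_sets.
From mathcomp Require Import zify ring.

(** Write G for the group of the graph Gamma and A for its cohomology algebra.

If A is universally Koszul, then Gamma has no four vertices a, b, c, d such
that ab, bc, cd are edges, a <> c and b <> d, and neither ac nor bd is an edge:
no induced path on four vertices and no induced square. Degree-one classes are
homomorphisms G -> F. The product of two of them, f and g, is zero as soon as
f(v) g(w) = f(w) g(v) for every edge vw ([raag_cup]), and evaluation on the
cycle [v|w] - [w|v] of an edge vw detects f(v) g(w) - f(w) g(v). For such a
quadruple let a*, b*, c*, d* be the dual classes, let I be the ideal generated
by the degree-one classes vanishing on a, b, c, d, and let y = a* + d*. Then
b* c* kills y. On the other hand a degree-one class q with q y in I vanishes
on b (evaluate on ab) and on c (evaluate on cd), so every multiple of such a q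
evaluates to 0 on bc, where b* c* evaluates to 1. So the colon ideal I : (y)
is not generated in degree one ([universally_koszul_no_quadruple]).
A graph without such quadruples has a dominating vertex or is disconnected, as
one sees at a vertex of maximal degree ([quadruple_free_split]); then G is a
product with an infinite cyclic group or a free product, and one concludes by
induction on the number of vertices ([quadruple_free_elementary]).

For the converse no graph is needed. The condition [strictly_koszul] on a
graded algebra implies universal Koszulity and is inherited by two
constructions: an algebra whose part of positive degree is the product of those
of B and C ([strictly_koszul_direct_sum]), and an algebra of the form B + t B
with t of degree one and t t = 0 ([strictly_koszul_exterior]). These are the
shapes of the cohomology of a free product and of a product with an infinite
cyclic group; the induction starts from the trivial group, since Z is 1 x Z.

Both shapes are read off from the bar complex. There a group acts on the
cochains in such a way that f is a cocycle if and only if x |-> f(x, .) is a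
derivation, and a coboundary if and only if this derivation is inner. A cocycle
is thus determined by its values on generators in the first argument. The prism
operator [prism] provides the homotopies: it replaces a cocycle whose
restriction to a retract is a coboundary by one that vanishes whenever its
first argument lies in the retract ([shapiro_retract]), and it shows that
conjugation by a central element is trivial ([prism_central]). For a free
product of G and K what remains is to write a function on the group as a
G-invariant plus a K-invariant one; for a product with Z it is to integrate a
function along Z. Both are instances of [presented_potential]: increments
along the generators of a presented group integrate to a function when they sum
to zero around the relators. *)

Set Implicit Arguments.
Unset Strict Implicit.
Unset Printing Implicit Defensive.

Import GRing.Theory.
Local Open Scope ring_scope.


(** * Groups given by generators and relations *)

Lemma gmul1 (G K : groupType) (p : {multiplicative G -> K}) : p 1%g = 1%g.
Proof. by apply: (mulgI (p 1%g)); rewrite -gmulfM !mulg1. Qed.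

Lemma gmulV (G K : groupType) (p : {multiplicative G -> K}) x : p x^-1%g = (p x)^-1%g.
Proof. by apply: (mulgI (p x)); rewrite -gmulfM !mulgV gmul1. Qed.

Lemma multiplicative_of (G K : groupType) (f : G -> K) :
  {morph f : x y / (x * y)%g} -> exists h : {multiplicative G -> K}, h =1 f.
Proof.
move=> fM; pose m := isMultiplicative.Build G K f fM.
by exists (HB.pack_for {multiplicative G -> K} f m).
Qed.

Section Presented.
Variables (X : choiceType) (R : set (word X)).
Local Notation P := (presented R).

Definition pgen (x : X) : P := pres_word R [:: (x, true)].

Lemma pres_word_cat w w' : pres_word R (w ++ w') = (pres_word R w * pres_word R w')%g.
Proof. by rewrite [RHS]pres_mulE. Qed.

Lemma pres_word_nil : pres_word R [::] = 1%g.
Proof. by []. Qed.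

Lemma pres_word_letter x b :
  pres_word R [:: (x, b)] = if b then pgen x else (pgen x)^-1%g.
Proof. by case: b => //; rewrite [RHS]pres_invE. Qed.

Lemma pres_word_cons x b w : pres_word R ((x, b) :: w) =
  ((if b then pgen x else (pgen x)^-1) * pres_word R w)%g.
Proof. by rewrite -cat1s pres_word_cat pres_word_letter. Qed.

Lemma presented_ind (Q : P -> Prop) : Q 1%g ->
  (forall x y, Q x -> Q y -> Q (x * y)%g) ->
  (forall x, Q (pgen x)) -> (forall x, Q (pgen x)^-1%g) -> forall x, Q x.
Proof.
move=> Q1 QM Qg QV x; rewrite -[x]pres_wordK.
elim: (repr x) => [|[y b] w IHw] //.
by rewrite pres_word_cons; apply: QM => //; case: b.
Qed.

Section Lift.
Variables (K : groupType) (phi : X -> K).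

Definition word_val (w : word X) : K :=
  foldr (fun p k => (if p.2 then phi p.1 else (phi p.1)^-1) * k)%g 1%g w.

Lemma word_val_cat w w' : word_val (w ++ w') = (word_val w * word_val w')%g.
Proof. by elim: w => [|p w IHw] /=; rewrite ?mul1g // IHw mulgA. Qed.

Lemma presented_lift : (forall r, R r -> word_val r = 1%g) ->
  exists f : {multiplicative P -> K}, forall x, f (pgen x) = phi x.
Proof.
move=> hR.
have inv w w' : pres_rel R w w' -> word_val w = word_val w'.
  elim=> {w w'} [//|//|w1 w2 w3 _ -> //|w1 w1' w2 w2' _ e1 _ e2|x b|r /hR -> //].
    by rewrite !word_val_cat e1 e2.
  by case: b => /=; rewrite mulg1 ?mulgV ?mulVg.
have fE w : word_val (repr (pres_word R w)) = word_val w.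
  by apply/inv/pres_wordP; rewrite pres_wordK.
have [|f hf] := @multiplicative_of P K (fun x => word_val (repr x)).
  by move=> x y; rewrite -[x]pres_wordK -[y]pres_wordK -pres_word_cat !fE word_val_cat.
by exists f => x; rewrite hf fE /= mulg1.
Qed.
End Lift.

Lemma presented_hom_ext (K : groupType) (f g : {multiplicative P -> K}) :
  (forall x, f (pgen x) = g (pgen x)) -> f =1 g.
Proof.
move=> fg; apply: presented_ind => [|x y ex ey|//|x]; first by rewrite !gmul1.
  by rewrite !gmulfM ex ey.
by rewrite !gmulV fg.
Qed.

Section Potential.
Variables (F : fieldType) (psi : X -> P -> F).

(** A letter x^-1 undoes the increment that x would add from the other end. *)
Definition letter_step (p : X * bool) (u : P) : F :=
  if p.2 then psi p.1 u else - psi p.1 ((pgen p.1)^-1 * u)%g.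

Fixpoint word_sum (w : word X) (u : P) : F :=
  if w is p :: w' then word_sum w' u + letter_step p (pres_word R w' * u)%g else 0.

Lemma word_sum_cat w w' u :
  word_sum (w ++ w') u = word_sum w' u + word_sum w (pres_word R w' * u)%g.
Proof.
elim: w => [|p w IHw] /=; first by rewrite addr0.
by rewrite IHw addrA pres_word_cat mulgA.
Qed.

(** A closed one-form on the Cayley graph is exact: the sum of the increments along
a word depends only on the group element, because the elementary moves on words
insert and delete cancelling pairs and relators at arbitrary base points. *)
Lemma presented_potential : (forall r, R r -> forall u, word_sum r u = 0) ->
  exists E : P -> F, E 1%g = 0 /\ forall x u, E (pgen x * u)%g = E u + psi x u.
Proof.
move=> hR.
have inv w w' : pres_rel R w w' -> forall u, word_sum w u = word_sum w' u.
  elim=> {w w'} [//|w w' _ e u|w1 w2 w3 _ e1 _ e2 u|w1 w1' w2 w2' h1 e1 h2 e2 u|x b u|r /hR //].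
  - by rewrite e.
  - by rewrite e1 e2.
  - by rewrite !word_sum_cat e2 e1; move/pres_wordP: h2 => ->.
  - rewrite /= pres_word_letter pres_word_nil mul1g add0r /letter_step.
    by case: b => /=; rewrite ?mulKg ?addNr ?subrr.
have EE w : word_sum (repr (pres_word R w)) 1%g = word_sum w 1%g.
  by apply: inv; apply/pres_wordP; rewrite pres_wordK.
exists (fun x => word_sum (repr x) 1%g); split; first by rewrite -pres_word_nil EE.
move=> x u; rewrite -[u]pres_wordK -pres_word_cat !EE /=.
by rewrite /letter_step /= mulg1.
Qed.

End Potential.

Lemma potentialV (F : fieldType) (psi : X -> P -> F) (E : P -> F) x u :
  (forall x u, E (pgen x * u)%g = E u + psi x u) ->
  E ((pgen x)^-1 * u)%g = E u - psi x ((pgen x)^-1 * u)%g.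
Proof. by move=> hE; rewrite -[in E u](mulVKg (pgen x) u) hE addrK. Qed.

Lemma presented_to_field (F : fieldType) (c : X -> F) :
  (forall r, R r -> forall u, word_sum (fun x _ => c x) r u = 0) ->
  exists t : P -> F, (forall x y, t (x * y)%g = t x + t y) /\
    forall x, t (pgen x) = c x.
Proof.
move=> /presented_potential[E [E1 hE]]; exists E; split; last first.
  by move=> x; rewrite -[pgen x]mulg1 hE E1 add0r.
apply: presented_ind => [y|x x' ex ex' y|x y|x y]; first by rewrite mul1g E1 add0r.
- by rewrite -mulgA !ex !ex' addrA.
- by rewrite hE -[in E (pgen x)](mulg1 (pgen x)) hE E1 add0r addrC.
- rewrite (potentialV _ _ hE) -[in RHS](mulg1 (pgen x)^-1%g) (potentialV _ _ hE).
  by rewrite E1 add0r addrC.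
Qed.

End Presented.

(** * Decomposing graphs and their groups *)

Local Notation rgen Gamma := (@pgen (vertex Gamma) (@raag_relators Gamma)).

Section RaagGenerators.
Variable Gamma : graph.
Local Notation gen := (@pgen Gamma (@raag_relators Gamma)).

Lemma raag_gen_comm v w : edge v w -> (gen v * gen w = gen w * gen v)%g.
Proof.
move=> vw; have : pres_word (@raag_relators Gamma)
    [:: (v, false); (w, false); (v, true); (w, true)] = 1%g.
  by apply/pres_wordP/pres_relator; exists v, w.
rewrite !pres_word_cons pres_word_nil mulg1 => e.
by rewrite -[RHS]mulg1 -e !mulgA mulgK mulgV mul1g.
Qed.

End RaagGenerators.

Lemma raag_relator_val (K : groupType) (Gam : graph) (phi : Gam -> K) :
  (forall v w, edge v w -> (phi v * phi w = phi w * phi v)%g) ->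
  forall r, raag_relators r -> word_val phi r = 1%g.
Proof.
move=> comm _ [v [w [vw ->]]] /=; rewrite mulg1 comm // mulKg mulVg //.
Qed.

Section Induced.
Variables (Gamma : graph) (S : {set Gamma}).
Hypothesis S0 : S != finset.set0.

Definition induced_edge : rel {v | v \in S} := fun v w => edge (val v) (val w).

Fact induced_sym : symmetric induced_edge.
Proof. by move=> v w; exact: edge_sym. Qed.

Fact induced_irr : irreflexive induced_edge.
Proof. by move=> v; exact: edge_irr. Qed.

Fact induced_gt0 : (0 < #|{: {v | v \in S}}|)%N.
Proof. by rewrite card_sig (eq_card (_ : _ =i S)) ?card_gt0. Qed.

Definition induced : graph := Graph induced_sym induced_irr induced_gt0.

Lemma card_induced : #|induced| = #|S|.
Proof. by rewrite card_sig. Qed.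

Lemma raag_induced_hom : exists h : {multiplicative raag induced -> raag Gamma},
  forall s : induced, h (rgen induced s) = rgen Gamma (val s).
Proof.
apply: presented_lift; apply: raag_relator_val => v w vw.
exact: (@raag_gen_comm Gamma (val v) (val w) vw).
Qed.
End Induced.

Lemma group_isoI (G K : groupType) (f : {multiplicative G -> K})
  (g : K -> G) : cancel f g -> cancel g f -> group_iso G K.
Proof. by move=> fg gf; exists f, g. Qed.

Lemma raag_single (Gamma : graph) : (#|Gamma| <= 1)%N -> group_iso Zgroup (raag Gamma).
Proof.
move=> G1.
have [v _] : exists v : Gamma, true by have /card_gt0P[v _] := vertex_gt0 Gamma; exists v.
have vE w : w = v by have /fintype_le1P/(_ v) := G1; apply.
have [|f hf] := @presented_lift _ (@raag_relators point_graph) (raag Gamma)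
  (fun=> rgen Gamma v).
  by move=> r [[] [[] [] //]].
have [|g hg] := @presented_lift _ (@raag_relators Gamma) Zgroup (fun=> rgen point_graph tt).
  by apply: raag_relator_val.
apply: (@group_isoI _ _ f g).
  apply: (presented_hom_ext (f := (g \o f : {multiplicative _ -> _})) (g := idfun)).
  by case; rewrite /= hf hg.
apply: (presented_hom_ext (f := (f \o g : {multiplicative _ -> _})) (g := idfun)).
by move=> w; rewrite /= hg hf (vE w).
Qed.

(** The element of the dominating vertex commutes with the subgroup of the other
vertices, so that multiplication is a homomorphism from the product; its inverse
is defined on generators. *)
Lemma raag_cone (Gamma : graph) (v : Gamma) (S0 : [set~ v] != finset.set0) :
  (forall w, w != v -> edge v w) ->
  group_iso ((raag (induced S0) * Zgroup)%type : groupType) (raag Gamma).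
Proof.
move=> cone; pose D := induced S0.
have [h1 h1E] := raag_induced_hom S0.
have [|h2 h2E] := @presented_lift _ (@raag_relators point_graph) (raag Gamma)
  (fun=> rgen Gamma v).
  by move=> r [[] [[] [] //]].
have comm1 (s : D) k : (rgen Gamma (val s) * h2 k = h2 k * rgen Gamma (val s))%g.
  have cg : (rgen Gamma (val s) * rgen Gamma v = rgen Gamma v * rgen Gamma (val s))%g.
    by apply/esym/raag_gen_comm/cone; have := valP s; rewrite !inE.
  move: k; apply: presented_ind => [|x y cx cy|[]|[]]; rewrite ?gmul1 ?gmulfM ?gmulV ?h2E //.
  - by rewrite mulg1 mul1g.
  - by rewrite mulgA cx -mulgA cy mulgA.
  - by apply: (mulgI (rgen Gamma v)); rewrite mulgA -cg mulgK mulVKg.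
have comm x k : (h1 x * h2 k = h2 k * h1 x)%g.
  move: x; apply: presented_ind => [|x y cx cy|s|s]; rewrite ?gmul1 ?gmulfM ?gmulV ?h1E //.
  - by rewrite mulg1 mul1g.
  - by rewrite -mulgA cy mulgA cx mulgA.
  - by apply: (mulgI (rgen Gamma (val s))); rewrite mulVKg mulgA comm1 mulgK.
pose L : groupType := (raag D * Zgroup)%type.
have [|b bE] := @multiplicative_of L (raag Gamma) (fun x => (h1 x.1 * h2 x.2)%g).
  by move=> [x k] [y l] /=; rewrite !gmulfM -!mulgA (mulgA (h2 k)) -comm !mulgA.
pose zeta : Zgroup := rgen point_graph tt.
pose phi u : L := if insub u is Some s then (rgen D s, 1%g) else (1%g, zeta).
have [|f fE] := @presented_lift _ (@raag_relators Gamma) L phi.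
  apply: raag_relator_val => u w uw; rewrite /phi.
  case: insubP => [s _ us|nu]; case: insubP => [t _ wt|nw].
  - congr (_, _); rewrite ?mulg1 //; apply: raag_gen_comm.
    by rewrite /edge /= /induced_edge us wt.
  - by congr (_, _); rewrite ?mulg1 ?mul1g.
  - by congr (_, _); rewrite ?mulg1 ?mul1g.
  - by [].
have fs (s : D) : f (rgen Gamma (val s)) = (rgen D s, 1%g).
  by rewrite fE /phi valK.
have fv : f (rgen Gamma v) = (1%g, zeta).
  by rewrite fE /phi insubF // !inE eqxx.
apply: (@group_isoI _ _ b f).
  have fh1 x : f (h1 x) = (x, 1%g).
    move: x; apply: presented_ind => [|x y cx cy|s|s].
    - by rewrite !gmul1.
    - by rewrite !gmulfM cx cy; congr (_, _); rewrite mulg1.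
    - by rewrite h1E fs.
    - by rewrite !gmulV h1E fs; congr (_, _); rewrite invg1.
  have fh2 k : f (h2 k) = (1%g, k).
    move: k; apply: presented_ind => [|x y cx cy|[]|[]].
    - by rewrite !gmul1.
    - by rewrite !gmulfM cx cy; congr (_, _); rewrite mulg1.
    - by rewrite h2E fv.
    - by rewrite !gmulV h2E fv; congr (_, _); rewrite invg1.
  move=> [x k]; rewrite bE /= gmulfM fh1 fh2; congr (_, _); first exact: mulg1.
  exact: mul1g.
apply: (presented_hom_ext (f := (b \o f : {multiplicative _ -> _})) (g := idfun)) => u /=.
have [->|uv] := eqVneq u v; first by rewrite fv bE /= gmul1 mul1g h2E.
have uS : u \in [set~ v] by rewrite !inE.
have -> : u = val (Sub u uS : D) by [].
by rewrite fs bE /= gmul1 mulg1 h1E.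
Qed.

Section FreeProductInjections.
Variables G K : groupType.

Lemma free_product_inl : exists i : {multiplicative G -> free_product G K},
  i =1 (fun g => pgen _ (inl g)).
Proof.
apply: multiplicative_of => x y.
have : pres_word (free_product_relators (G := G) (H := K))
    [:: (inl x, true); (inl y, true); (inl (x * y)%g, false)] = 1%g.
  by apply/pres_wordP/pres_relator; left; exists x, y.
by rewrite !pres_word_cons pres_word_nil mulg1 mulgA => /divg1_eq.
Qed.

Lemma free_product_inr : exists i : {multiplicative K -> free_product G K},
  i =1 (fun k => pgen _ (inr k)).
Proof.
apply: multiplicative_of => x y.
have : pres_word (free_product_relators (G := G) (H := K))
    [:: (inr x, true); (inr y, true); (inr (x * y)%g, false)] = 1%g.
  by apply/pres_wordP/pres_relator; right; exists x, y.
by rewrite !pres_word_cons pres_word_nil mulg1 mulgA => /divg1_eq.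
Qed.

Lemma free_product_lift (L : groupType) (f : {multiplicative G -> L})
    (g : {multiplicative K -> L}) : exists h : {multiplicative free_product G K -> L},
  (forall x, h (pgen _ (inl x)) = f x) /\ (forall y, h (pgen _ (inr y)) = g y).
Proof.
have [|h hE] := @presented_lift _ (free_product_relators (G := G) (H := K)) L
    (fun x => match x with inl x => f x | inr y => g y end).
  by move=> _ [[x [y ->]]|[x [y ->]]] /=; rewrite mulg1 gmulfM mulgA mulgV.
by exists h; split=> x; rewrite hE.
Qed.

End FreeProductInjections.

Lemma raag_disjoint (Gamma : graph) (S : {set Gamma}) (S0 : S != finset.set0)
    (T0 : ~: S != finset.set0) :
  (forall v w, v \in S -> w \notin S -> ~~ edge v w) ->
  group_iso (free_product (raag (induced S0)) (raag (induced T0))) (raag Gamma).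
Proof.
move=> sep; set D1 := induced S0; set D2 := induced T0.
have [h1 h1E] := raag_induced_hom S0; have [h2 h2E] := raag_induced_hom T0.
have [b [b1 b2]] := free_product_lift h1 h2.
have [i1 i1E] := free_product_inl (raag D1) (raag D2).
have [i2 i2E] := free_product_inr (raag D1) (raag D2).
pose phi (u : Gamma) : free_product (raag D1) (raag D2) :=
  if insub u is Some s then i1 (rgen D1 s)
  else if insub u is Some s then i2 (rgen D2 s) else 1%g.
have phi1 (s : D1) : phi (val s) = i1 (rgen D1 s) by rewrite /phi valK.
have phi2 (s : D2) : phi (val s) = i2 (rgen D2 s).
  by rewrite /phi insubF ?valK //; apply/negbTE; have := valP s; rewrite inE.
have inT u : u \notin S -> u \in ~: S by rewrite inE.
have [|f fE] := @presented_lift _ (@raag_relators Gamma) _ phi.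
  apply: raag_relator_val => u w uw.
  have [uS|uS] := boolP (u \in S); have [wS|wS] := boolP (w \in S).
  - rewrite (phi1 (Sub u uS)) (phi1 (Sub w wS)) -!gmulfM; congr (i1 _).
    exact: (@raag_gen_comm D1).
  - by have := sep _ _ uS wS; rewrite uw.
  - by have := sep _ _ wS uS; rewrite edge_sym uw.
  - rewrite (phi2 (Sub u (inT _ uS))) (phi2 (Sub w (inT _ wS))) -!gmulfM; congr (i2 _).
    exact: (@raag_gen_comm D2).
have f1 (s : D1) : f (rgen Gamma (val s)) = i1 (rgen D1 s) by rewrite fE phi1.
have f2 (s : D2) : f (rgen Gamma (val s)) = i2 (rgen D2 s) by rewrite fE phi2.
apply: (@group_isoI _ _ b f).
  apply: (presented_hom_ext (f := (f \o b : {multiplicative _ -> _})) (g := idfun)) => -[x|x] /=.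
    rewrite b1 -i1E.
    apply: (presented_hom_ext (f := (f \o h1 : {multiplicative _ -> _})) (g := i1)) => s /=.
    by rewrite h1E f1.
  rewrite b2 -i2E.
  apply: (presented_hom_ext (f := (f \o h2 : {multiplicative _ -> _})) (g := i2)) => s /=.
  by rewrite h2E f2.
apply: (presented_hom_ext (f := (b \o f : {multiplicative _ -> _})) (g := idfun)) => u /=.
have [uS|uS] := boolP (u \in S).
  have -> : u = val (Sub u uS : D1) by [].
  by rewrite f1 i1E b1 h1E.
have uT : u \in ~: S by rewrite inE.
have -> : u = val (Sub u uT : D2) by [].
by rewrite f2 i2E b2 h2E.
Qed.

(** An induced path on four vertices (a and d not adjacent) and an induced square
(a and d adjacent) are excluded at once: all that matters about a and d is that
they are the ends. *)
Definition quadruple_free (Gamma : graph) := forall a b c d : Gamma,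
  edge a b -> edge b c -> edge c d -> a != c -> b != d -> edge a c || edge b d.

Lemma quadruple_free_induced (Gamma : graph) (S : {set Gamma}) (S0 : S != finset.set0) :
  quadruple_free Gamma -> quadruple_free (induced S0).
Proof. by move=> qf a b c d ab bc cd ac bd; apply: qf ab bc cd ac bd. Qed.

(** Let v have maximal degree, with closed neighbourhood C. If an edge uw leaves C,
then w is a neighbour of u but not of v, so by maximality v has a neighbour x
that u does not have, and x, v, u, w is a forbidden quadruple. Hence C is a
union of connected components, or everything. *)
Lemma quadruple_free_split (Gamma : graph) : quadruple_free Gamma ->
  (exists v : Gamma, forall w, w != v -> edge v w) \/
  (exists S : {set Gamma}, [/\ S != finset.set0, ~: S != finset.set0 &
     forall v w, v \in S -> w \notin S -> ~~ edge v w]).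
Proof.
move=> qf; have /card_gt0P[v0 _] := vertex_gt0 Gamma.
pose N (v : Gamma) := [set w | edge v w]%SET.
case: (@arg_maxnP _ v0 xpredT (fun v => #|N v|)) => // v _ vmax.
pose C := v |: N v.
have [CT|CT] := eqVneq (~: C) finset.set0.
  left; exists v => w wv; have : w \in C.
    by apply/negPn; rewrite -finset.in_setC CT finset.in_set0.
  by rewrite !inE (negbTE wv).
right; exists C; split=> //.
  by apply/set0Pn; exists v; rewrite !inE eqxx.
move=> u w uC wC; apply/negP => uw.
have /norP[wv vw] : ~~ ((w == v) || edge v w) by move: wC; rewrite !inE.
have vu : edge v u.
  by move: uC; rewrite !inE => /orP[/eqP uv|//]; rewrite -uv uw in vw.
(* Otherwise v, w and the neighbours of v other than u are all neighbours of u,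
   which makes the degree of u larger than that of v. *)
have [x xN] : exists x, (x \in N v) && (x \notin u |: N u).
  have [/existsP //|] := boolP [exists x, (x \in N v) && (x \notin u |: N u)].
  rewrite negb_exists => /forallP h; exfalso.
  have sub : w |: (v |: (N v :\ u)) \subset N u.
    apply/fintype.subsetP => y; rewrite !inE => /orP[/eqP -> //|/orP[/eqP ->|/andP[yu vy]]].
      by rewrite edge_sym.
    have := h y; rewrite !inE vy /= negbK => /orP[/eqP e|//].
    by rewrite e eqxx in yu.
  have := subset_leq_card sub; rewrite !cardsU1 !inE edge_irr.
  rewrite andbF (negbTE wv) (negbTE vw) andbF /=.
  have := cardsD1 u (N v); rewrite inE vu => e.
  by have := vmax u isT; rewrite /= => h2 h3; lia.
move: xN; rewrite !inE => /andP[vx /norP[xu ux]].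
have := qf x v u w; rewrite edge_sym vx vu uw xu eq_sym wv => /(_ isT isT isT isT isT).
by rewrite edge_sym (negbTE ux) (negbTE vw).
Qed.

Lemma quadruple_free_elementary (Gamma : graph) :
  quadruple_free Gamma -> elementary_type (raag Gamma).
Proof.
have [n] := ubnP #|Gamma|; elim: n Gamma => // n IHn Gamma hn qf.
have [G1|G1] := leqP #|Gamma| 1.
  exact: elementary_iso (raag_single G1) elementary_Z.
have [[v cone]|[S [S0 T0 sep]]] := quadruple_free_split qf.
  have cv := cardsC1 v.
  have S0 : [set~ v] != finset.set0 by rewrite -card_gt0 cv; lia.
  apply: elementary_iso (raag_cone S0 cone) _; apply/elementary_prod/IHn.
    by rewrite card_induced cv; lia.
  exact: quadruple_free_induced.
have cS := cardsC S; have cS0 : (0 < #|S|)%N by rewrite card_gt0.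
have cT0 : (0 < #|~: S|)%N by rewrite card_gt0.
apply: elementary_iso (raag_disjoint S0 T0 sep) _.
by apply: elementary_free; apply: IHn;
  rewrite ?card_induced; [lia | exact: quadruple_free_induced |
  lia | exact: quadruple_free_induced].
Qed.

(** * The inhomogeneous bar complex *)

Section BarComplex.
Variable F : fieldType.

(** The right action of the group on cochains for which f - f.x is the contraction
of the differential of f by x. The unit acts as a projection and not as the
identity, because cochains are not normalized. Recursion on the arguments avoids
the indices of the faces. *)
Fixpoint bar_act (G : groupType) (x : G) (f : seq G -> F) (s : seq G) : F :=
  if s is y :: s' then f ((x * y)%g :: s') - bar_act y (fun r => f (x :: r)) s'
  else f [::].

Definition bar_diff (G : groupType) (f : seq G -> F) (s : seq G) : F :=
  if s is x :: s' then f s' - bar_act x f s' else 0.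

Section OneGroup.
Variable G : groupType.
Implicit Types (f g h : seq G -> F) (x y : G) (s : seq G).

Lemma eq_bar_act x f g : f =1 g -> bar_act x f =1 bar_act x g.
Proof.
move=> fg s; elim: s x f g fg => [|y s IHs] x f g fg /=; first exact: fg.
by rewrite fg; congr (_ - _); apply: IHs => r; exact: fg.
Qed.

Lemma eq_bar_diff f g : f =1 g -> bar_diff f =1 bar_diff g.
Proof. by move=> fg [|x s] //=; rewrite fg (eq_bar_act x fg). Qed.

Lemma bar_actB x f g s :
  bar_act x (fun r => f r - g r) s = bar_act x f s - bar_act x g s.
Proof. by elim: s x f g => [|y s IHs] x f g //=; rewrite IHs; ring. Qed.

Lemma bar_actD x f g s :
  bar_act x (fun r => f r + g r) s = bar_act x f s + bar_act x g s.
Proof. by elim: s x f g => [|y s IHs] x f g //=; rewrite IHs; ring. Qed.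

Lemma bar_actZ (a : F) x f s :
  bar_act x (fun r => a * f r) s = a * bar_act x f s.
Proof. by elim: s x f => [|y s IHs] x f //=; rewrite IHs; ring. Qed.

Lemma bar_act0 x f s : (forall r, f r = 0) -> bar_act x f s = 0.
Proof. by move=> f0; elim: s x f f0 => [|y s IHs] x f f0 //=; rewrite IHs // f0 subr0. Qed.

Lemma bar_diffB f g s :
  bar_diff (fun r => f r - g r) s = bar_diff f s - bar_diff g s.
Proof. by case: s => [|x s] /=; rewrite ?bar_actB; ring. Qed.

Lemma bar_diffD f g s :
  bar_diff (fun r => f r + g r) s = bar_diff f s + bar_diff g s.
Proof. by case: s => [|x s] /=; rewrite ?bar_actD; ring. Qed.

Lemma bar_diff0 f s : (forall r, f r = 0) -> bar_diff f s = 0.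
Proof. by case: s => [|x s] f0 //=; rewrite f0 bar_act0 ?subr0. Qed.

(** The cancellation of the terms of this identity is the one that gives d d = 0. *)
Lemma bar_actM x y f s : bar_act y (bar_act x f) s = bar_act (x * y)%g f s.
Proof.
elim: s x y f => [|w s IHs] x y f //=.
by rewrite bar_actB IHs mulgA; ring.
Qed.

Lemma bar_diffK f s : bar_diff (bar_diff f) s = 0.
Proof.
case: s => [|x [|y s]] //=; first by rewrite subr0.
by rewrite bar_actB bar_actM; ring.
Qed.

(** The cocycle condition says that x |-> f(x, .) is a derivation for the action. *)
Lemma bar_cocycleM f x y s : bar_diff f [:: x, y & s] = 0 ->
  f ((x * y)%g :: s) = f (y :: s) + bar_act y (fun r => f (x :: r)) s.
Proof. by move=> /= /eqP; rewrite subr_eq0 => /eqP ->; rewrite subrK. Qed.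

Lemma bar_diff_cocycle f x s : bar_diff f (x :: s) = 0 -> bar_act x f s = f s.
Proof. by move=> /= /eqP; rewrite subr_eq0 => /eqP <-. Qed.

Lemma face_cons i x y s : face i.+2 [:: x, y & s] = x :: face i.+1 (y :: s).
Proof. by rewrite /face /= !eqSS; case: (i == size s). Qed.

Lemma bar_actE f x s :
  bar_act x f s = \sum_(i < (size s).+1) (-1) ^+ i * f (face i.+1 (x :: s)).
Proof.
elim: s x f => [|y s IHs] x f; first by rewrite big_ord1 mul1r.
rewrite big_ord_recl mul1r /= IHs -sumrN; congr (_ + _).
  by rewrite /face /= drop0.
by apply: eq_bigr => i _; rewrite face_cons exprS mulN1r mulNr.
Qed.

Lemma bar_diffE f : diff_fun f =1 bar_diff f.
Proof.
case=> [|x s] //=; rewrite big_ord_recl mul1r bar_actE -sumrN; congr (_ + _).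
by apply: eq_bigr => i _; rewrite exprS mulN1r mulNr.
Qed.

Lemma bar_diff_local f g s :
  (forall r, size r = (size s).-1 -> f r = g r) -> bar_diff f s = bar_diff g s.
Proof.
move=> fg; rewrite -!bar_diffE; case: s fg => //= x s fg.
by apply: eq_bigr => i _; rewrite fg // size_face -1?ltnS.
Qed.

Section Agree.
Variables (f g : seq G -> F).
Hypotheses (df : forall s, bar_diff f s = 0) (dg : forall s, bar_diff g s = 0).
Let agree x := forall s, f (x :: s) = g (x :: s).

(** Derivations that agree on generators agree on the subgroup they generate. *)
Lemma agreeM x y : agree x -> agree y -> agree (x * y)%g.
Proof.
move=> fgx fgy s; rewrite !bar_cocycleM // fgy; congr (_ + _).
exact: eq_bar_act.
Qed.

(** The difference of the two derivations at x^-1 is killed by x, because of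
x^-1 x = 1, hence also by the unit x x^-1; and the unit fixes it, because of
x^-1 1 = x^-1 and the agreement at 1. *)
Lemma agreeV x : agree 1%g -> agree x -> agree x^-1%g.
Proof.
move=> fg1 fgx s.
pose h r := f (x^-1%g :: r) - g (x^-1%g :: r).
have h0 r : bar_act x h r = 0.
  have := fg1 r; rewrite -(mulVg x) !bar_cocycleM // fgx => /addrI e.
  by rewrite bar_actB e subrr.
apply/eqP; rewrite -subr_eq0 -[x^-1%g]mulg1 !bar_cocycleM // fg1.
rewrite opprD addrACA subrr add0r -bar_actB -/h.
have -> : bar_act 1%g h s = bar_act x^-1%g (bar_act x h) s.
  by rewrite bar_actM mulgV.
by rewrite bar_act0.
Qed.
End Agree.

End OneGroup.

Section TwoGroups.
Variables G K : groupType.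

Lemma bar_act_map (p : {multiplicative G -> K}) f x s :
  bar_act x (fun r => f (map p r)) s = bar_act (p x) f (map p s).
Proof.
elim: s x f => [|y s IHs] x f //=.
by rewrite gmulfM (IHs _ (fun r => f (p x :: r))).
Qed.

Lemma bar_diff_map (p : {multiplicative G -> K}) f s :
  bar_diff (fun r => f (map p r)) s = bar_diff f (map p s).
Proof. by case: s => //= x s; rewrite bar_act_map. Qed.

Section Prism.
Variables p q : {multiplicative G -> K}.
Implicit Types (f : seq K -> F) (c : K).

(** The alternating sum of f(p x_1, .., p x_i, c_i, q x_(i+1), .., q x_n) over i,
where c_i = (p x_1 .. p x_i)^-1 c (q x_1 .. q x_i) is the vertical edge of the
prism between the paths of p and of q that starts with the edge c. *)
Fixpoint prism f c (s : seq G) : F :=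
  if s is x :: s' then f [:: c, q x & map q s'] -
    prism (fun r => f (p x :: r)) ((p x)^-1 * c * q x)%g s'
  else f [:: c].

Lemma prism_cons f c x s : prism f c (x :: s) =
  f [:: c, q x & map q s] -
  prism (fun r => f (p x :: r)) ((p x)^-1 * c * q x)%g s.
Proof. by []. Qed.

Lemma eq_prism f g c s : f =1 g -> prism f c s = prism g c s.
Proof.
move=> fg; elim: s f g c fg => [|x s IHs] f g c fg /=; first exact: fg.
by rewrite fg; congr (_ - _); apply: IHs => r; exact: fg.
Qed.

Lemma prismB f g c s :
  prism (fun r => f r - g r) c s = prism f c s - prism g c s.
Proof. by elim: s f g c => [|x s IHs] f g c //=; rewrite IHs; ring. Qed.

Lemma prism0 f c s : (forall r, f r = 0) -> prism f c s = 0.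
Proof. by move=> f0; elim: s f c f0 => [|x s IHs] f c f0 //=; rewrite f0 IHs // subr0. Qed.

(** Contracting by the first argument turns the homotopy formula into a statement
on the action, which is the form that can be proved by induction. *)
Lemma prism_act f c x s :
  prism (bar_act (p x) f) ((p x)^-1 * c * q x)%g s =
    f ((c * q x)%g :: map q s) - bar_act (q x) (fun r => f (c :: r)) (map q s)
    - f (p x :: map p s) + bar_act x (prism f c) s.
Proof.
elim: s f c x => [|y s IHs] f c x /=.
  by rewrite !mulgA mulgV mul1g; ring.
rewrite prismB (IHs (fun r => f (p x :: r))) bar_actB.
rewrite (bar_act_map q (fun r => f [:: c, q x & r])) !gmulfM invgM !mulgA.
by rewrite mulgV mul1g; ring.
Qed.

(** If q is the conjugate of p by c, so that (p x)^-1 c (q x) = c, the last two terms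
are the value of - d (prism f c), and this is a homotopy between the pullbacks
by p and by q. For other c the edge moves with the base point; this is needed
for [shapiro_retract], where the formula holds only on a subgroup. *)
Lemma prism_homotopy f c x s :
  prism (bar_diff f) c (x :: s) =
    f (map q (x :: s)) - f (map p (x :: s))
    - prism f ((p x)^-1 * c * q x)%g s + bar_act x (prism f c) s.
Proof. by rewrite /= prismB prism_act; ring. Qed.

End Prism.
End TwoGroups.

Section Retract.
Variables G K : groupType.

(** Both ends of the prism are the pullback by i, so they cancel. *)
Lemma prism_central (i : {multiplicative G -> K}) f c :
  (forall x, c * i x = i x * c)%g -> forall s,
  prism i i (bar_diff f) c s = - bar_diff (prism i i f c) s.
Proof.
move=> cz [|x s]; first by rewrite /= subrr oppr0.
by rewrite prism_homotopy -mulgA cz mulKg /=; ring.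
Qed.

Variable p : {multiplicative G -> G}.
Hypothesis pp : forall x, p (p x) = p x.

(** Shapiro's lemma for a retract. The prism between p and the identity that starts
with c = 1 keeps this edge along elements of the image of p, and all its terms
for the differential of f have their first argument in that image. Therefore it
is enough that f be closed for such first arguments, which is all that holds for
the cochain d of [central_product_cocycle]. *)
Lemma shapiro_retract f : (forall x s, bar_diff f (p x :: s) = 0) ->
  forall x s, f (p x :: s) =
    f (map p (p x :: s)) + bar_diff (prism p idfun f 1%g) (p x :: s).
Proof.
move=> df x s.
(* All first arguments are 1 = p 1 or of the form p y. *)
have e : prism p idfun (bar_diff f) 1%g (p x :: s) = 0.
  rewrite prism_cons -(gmul1 p) df prism0 ?subrr // => r; exact: df.
move: e; rewrite prism_homotopy pp mulg1 mulVg map_id /=.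
by move=> e; apply/eqP; rewrite -subr_eq0 -[X in _ == X]e pp; apply/eqP; ring.
Qed.

End Retract.
End BarComplex.

(** * Cocycles of free products and of products with an infinite cyclic group *)

Section FreeProductCochains.
Variables (F : fieldType) (G K L : groupType).
Variables (iG : {multiplicative G -> L}) (iK : {multiplicative K -> L}).
Variables (pG : {multiplicative L -> G}) (pK : {multiplicative L -> K}).
Hypotheses (iGK : cancel iG pG) (iKK : cancel iK pK).
Hypothesis gen : forall P : L -> Prop,
  P 1%g -> (forall x y, P x -> P y -> P (x * y)%g) ->
  (forall g, P (iG g)) -> (forall k, P (iK k)) -> forall x, P x.
Hypothesis split : forall phi : L -> F, exists psi : L -> F,
  (forall g x, psi (iG g * x)%g = psi x) /\
  (forall k x, phi (iK k * x)%g - psi (iK k * x)%g = phi x - psi x).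

Lemma shapiro_cobounding (H : groupType) (i : {multiplicative H -> L})
    (p : {multiplicative L -> H}) (f : seq L -> F) (h : seq H -> F) :
  cancel i p -> (forall s, bar_diff f s = 0) ->
  (forall x s, f (map i (x :: s)) = bar_diff h (x :: s)) ->
  exists e : seq L -> F, forall x s, f (i x :: s) = bar_diff e (i x :: s).
Proof.
move=> ip df fh; pose r : {multiplicative L -> L} := (i \o p : L -> L).
exists (fun s => h (map p s) + prism r idfun f 1%g s) => x s.
rewrite bar_diffD bar_diff_map /=.
have rr y : r (r y) = r y by rewrite /= ip.
have -> : i x = r (i x) by rewrite /= ip.
rewrite (shapiro_retract rr) => [|*]; last exact: df.
by congr (_ + _); have := fh x (map p s); rewrite /= !ip -map_comp.
Qed.

(** The action of x involves f only through f(x y, .) and f(x, .). *)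
Lemma bar_act_const (H : groupType) (f : seq H -> F) x s :
  (forall y r, f ((x * y)%g :: r) = f (y :: r)) ->
  bar_act x f s = bar_act 1%g f s.
Proof.
move=> fx; case: s => [|y s] //=; rewrite fx mul1g; congr (_ - _).
by apply: eq_bar_act => r; rewrite -[x]mulg1 fx.
Qed.

(** The unit kills f(1, .) by the derivation rule for 1 = 1 1, and then so does every
element. This coboundary therefore accounts for the values f(1, s), by which f
fails to be normalized. *)
Lemma bar_diff_first (H : groupType) (f : seq H -> F) x s :
  (forall s, bar_diff f s = 0) ->
  bar_diff (fun r => f (1%g :: r)) (x :: s) = f (1%g :: s).
Proof.
move=> df; have h r : bar_act 1%g (fun r => f (1%g :: r)) r = 0.
  have := bar_cocycleM (df [:: 1%g, 1%g & r]); rewrite mulg1.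
  by move/eqP; rewrite addrC -subr_eq subrr eq_sym => /eqP.
rewrite /= -{1}[x]mul1g -bar_actM bar_act0 ?subr0 //.
Qed.

(** After Shapiro's lemma the derivation of f is inner on G, given by eG, and inner on
K, given by eK. The difference eG - eK, as a function of its first argument, is
a G-invariant u plus a K-invariant v; then eG - u = eK + v defines the same inner
derivation as eG on G and as eK on K. *)
Lemma free_product_cocycle (f : seq L -> F) (hG : seq G -> F) (hK : seq K -> F) :
  (forall s, bar_diff f s = 0) ->
  (forall x s, f (map iG (x :: s)) = bar_diff hG (x :: s)) ->
  (forall x s, f (map iK (x :: s)) = bar_diff hK (x :: s)) ->
  exists e, forall x s, f (x :: s) = bar_diff e (x :: s).
Proof.
move=> df fG fK.
have [eG feG] := shapiro_cobounding iGK df fG.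
have [eK feK] := shapiro_cobounding iKK df fK.
pose phi s x := eG (x :: s) - eK (x :: s).
have /choice[psi psiP] : forall s, exists psi : L -> F,
  (forall g x, psi (iG g * x)%g = psi x) /\
  (forall k x, phi s (iK k * x)%g - psi (iK k * x)%g = phi s x - psi x).
  by move=> s; exact: split.
pose u s := if s is x :: s' then psi s' x else 0.
pose v s := if s is x :: s' then phi s' x - psi s' x else eG [::] - eK [::].
have uv s : eG s - u s = eK s + v s.
  by case: s => [|x s]; rewrite /u /v /phi; ring.
(* The unit projects to the part of the cochain on which it acts trivially; the
   second summand takes care of the values f(1, s). *)
pose e s := bar_act 1%g (fun r => eG r - u r) s + f (1%g :: s).
exists e.
have De x s : bar_diff e (x :: s) = bar_act 1%g (fun r => eG r - u r) s
     - bar_act x (fun r => eG r - u r) s + f (1%g :: s).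
  rewrite /e bar_diffD bar_diff_first // [X in X + _]/=.
  by rewrite bar_actM mul1g.
have D1 x s (h : seq L -> F) : f (x :: s) = bar_diff h (x :: s) ->
   f (1%g :: s) = bar_diff h (1%g :: s) ->
   f (x :: s) = bar_act 1%g h s - bar_act x h s + f (1%g :: s).
  by move=> -> -> /=; ring.
apply: gen => [s|x y hx hy|g s|k s].
- by rewrite De; ring.
- by apply: (agreeM (g := bar_diff e)) hx hy => // s; exact: bar_diffK.
- rewrite De !bar_actB (@bar_act_const _ u (iG g)); last first.
    by move=> y r; exact: (psiP r).1.
  rewrite (D1 _ _ eG) //; first by ring.
  by rewrite -(gmul1 iG) feG.
- have h x : bar_act x (fun r => eG r - u r) s = bar_act x (fun r => eK r + v r) s.
    by apply: eq_bar_act; exact: uv.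
  rewrite De !h !bar_actD (@bar_act_const _ v (iK k)); last first.
    by move=> y r; exact: (psiP r).2.
  rewrite (D1 _ _ eK) //; first by ring.
  by rewrite -(gmul1 iK) feK.
Qed.

End FreeProductCochains.

Section CupHom.
Variables (F : fieldType) (L : groupType) (t : L -> F).
Hypothesis tM : forall x y, t (x * y)%g = t x + t y.

(** The cup product of the cocycle t of degree one with f. *)
Definition cup_hom (f : seq L -> F) (s : seq L) : F :=
  if s is x :: s' then t x * f s' else 0.

Lemma bar_diff_cup f s : bar_diff (cup_hom f) s = - cup_hom (bar_diff f) s.
Proof.
case: s => [|x [|y s]] /=; rewrite ?oppr0 ?mulr0 ?subrr ?oppr0 //.
  by rewrite addr0.
by rewrite bar_actZ tM; ring.
Qed.

End CupHom.

Section CentralCochains.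
Variables (F : fieldType) (G L : groupType).
Variables (i : {multiplicative G -> L}) (p : {multiplicative L -> G}).
Variables (z : L) (t : L -> F).
Hypotheses (iK : cancel i p) (zC : forall x, (z * i x = i x * z)%g).
Hypotheses (tM : forall x y, t (x * y)%g = t x + t y).
Hypotheses (ti : forall x, t (i x) = 0) (tz : t z = 1).
Hypothesis gen : forall P : L -> Prop,
  (forall x y, P x -> P y -> P (x * y)%g) ->
  (forall g, P (i g)) -> P z -> P z^-1%g -> forall x, P x.
Hypothesis solve : forall q : L -> F,
  (forall g x, q (i g * x)%g = q x) -> q 1%g = 0 -> exists e : L -> F,
  [/\ forall g x, e (i g * x)%g = e x, forall x, e x - e (z * x)%g = q x & e 1%g = 0].

(** Subtracting the pullback of the restriction to G, and by Shapiro's lemma a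
coboundary, one gets a cocycle f1 that vanishes for first arguments in G. Since z
is central its value d at z is G-invariant, so restricts to a cocycle b on G.
Up to the coboundary of e2, d is the pullback of b plus an invariant cochain q
that vanishes for first arguments in G; q depends on the coset of its first
argument only and is integrated along z. *)
Lemma central_product_cocycle (f : seq L -> F) :
  (forall s, bar_diff f s = 0) -> exists (b : seq G -> F) (e : seq L -> F),
  (forall s, bar_diff b s = 0) /\
  forall x s, f (x :: s) = f (map (i \o p) (x :: s)) +
      t x * b (map p s) + bar_diff e (x :: s).
Proof.
move=> df; pose r : {multiplicative L -> L} := (i \o p : L -> L).
have rr y : r (r y) = r y by rewrite /= iK.
have ri x : r (i x) = i x by rewrite /= iK.
pose fr s := f (map r s).
have dfr s : bar_diff fr s = 0 by rewrite bar_diff_map.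
pose e1 := prism r idfun f 1%g.
pose f1 s := f s - fr s - bar_diff e1 s.
have df1 s : bar_diff f1 s = 0 by rewrite !bar_diffB df dfr bar_diffK !subrr.
have f1i x s : f1 (i x :: s) = 0.
  rewrite /f1 -ri (shapiro_retract rr (f := f)) => [|*]; last exact: df.
  by rewrite -/e1 -/(fr _); ring.
pose d s := f1 (z :: s).
(* Compare the derivation rule for z (i x) and for (i x) z. *)
have dact x s : bar_act (i x) d s = d s.
  have := bar_cocycleM (df1 [:: z, i x & s]).
  rewrite zC (bar_cocycleM (df1 [:: i x, z & s])) f1i add0r => <-.
  by rewrite bar_act0 ?addr0 // => *; exact: f1i.
have dd x s : bar_diff d (i x :: s) = 0 by rewrite /= dact subrr.
pose b s := d (map i s).
have db s : bar_diff b s = 0 by rewrite bar_diff_map; case: s => // x s; exact: dd.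
pose e2 := prism r idfun d 1%g.
pose q s := d s - b (map p s) - bar_diff e2 s.
have bp s : b (map p s) = d (map r s) by rewrite /b -map_comp.
have qi x s : q (i x :: s) = 0.
  rewrite /q bp -ri (shapiro_retract rr (f := d)) => [|y w]; last exact: dd.
  by rewrite -/e2; ring.
have qact x s : bar_act (i x) q s = q s.
  rewrite /q 2!bar_actB dact; congr (_ - _ - _); last first.
    exact: bar_diff_cocycle (bar_diffK _ _).
  by apply: bar_diff_cocycle; rewrite bar_diff_map.
have q1 s : q (1%g :: s) = 0 by rewrite -(gmul1 i) qi.
have qM x y s : q ((i x * y)%g :: s) = q (y :: s).
  rewrite -(qact x (y :: s)) /= bar_act0 ?subr0 // => *; exact: qi.
have /choice[e3 e3P] s : exists e : L -> F,
    [/\ forall g x, e (i g * x)%g = e x,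
        forall x, e x - e (z * x)%g = q (x :: s) & e 1%g = 0].
  by apply: solve => // g x; exact: qM.
pose c3 s := if s is x :: s' then e3 s' x else 0.
(* The term in e2 is a primitive of t times the coboundary of e2. *)
exists b, (fun s => e1 s - cup_hom t e2 s + c3 s); split=> // x s.
pose g s := cup_hom t (fun s => b (map p s)) s
   - bar_diff (cup_hom t e2) s + bar_diff c3 s.
suff fg : f1 (x :: s) = g (x :: s).
  have -> : f (x :: s) = fr (x :: s) + bar_diff e1 (x :: s) + f1 (x :: s).
    by rewrite /f1; ring.
  by rewrite fg bar_diffD bar_diffB /g /cup_hom /fr; ring.
have dg s' : bar_diff g s' = 0.
  rewrite bar_diffD bar_diffB !bar_diffK bar_diff_cup //.
  have -> : cup_hom t (bar_diff (fun s => b (map p s))) s' = 0.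
    by case: s' => //= y s'; rewrite bar_diff_map db mulr0.
  by rewrite !oppr0 !addr0.
have gi y s' : f1 (i y :: s') = g (i y :: s').
  rewrite f1i /g bar_diff_cup // /cup_hom ti !mul0r oppr0 subrr add0r.
  have e30 r' : c3 (i y :: r') = 0.
    by have [h _ h1] := e3P r'; rewrite /c3 -[i y]mulg1 h.
  case: s' => [|w s']; rewrite /= ?subrr // bar_act0 //.
  by have [-> _ _] := e3P s'; rewrite subr0 subrr.
have gz s' : f1 (z :: s') = g (z :: s').
  rewrite /g bar_diff_cup // /cup_hom tz !mul1r opprK.
  have -> : f1 (z :: s') = b (map p s') + bar_diff e2 s' + q s'.
    by rewrite /q /d; ring.
  congr (_ + _).
  have e30 r' : c3 (z :: r') = 0.
    have [_ h h1] := e3P r'; have := h 1%g.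
    by rewrite /c3 mulg1 h1 q1 => /eqP; rewrite sub0r oppr_eq0 => /eqP.
  case: s' => [|w s'] /=; last first.
    by rewrite bar_act0 // subr0; have [_ -> _] := e3P s'.
  by rewrite /q /b /= subr0 !subrr.
have g1 s' : f1 (1%g :: s') = g (1%g :: s') by rewrite -(gmul1 i) gi.
by apply: (gen (P := fun x => forall s, f1 (x :: s) = g (x :: s))) x s => //;
  [move=> x y; exact: agreeM | exact: agreeV].
Qed.

(** The restriction to G is b. The slant product with the class of z, which is the
prism for conjugation by z, sends t c to c and coboundaries to coboundaries. *)
Lemma central_product_inj (b c : seq G -> F) (e : seq L -> F) :
  (forall x s, b (map p (x :: s)) + t x * c (map p s) = bar_diff e (x :: s)) ->
  (exists e', forall x s, b (x :: s) = bar_diff e' (x :: s)) /\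
  (exists e', forall s, c s = bar_diff e' s).
Proof.
move=> he.
have ipK s : map p (map i s) = s by rewrite -map_comp map_id_in // => x _ /=.
have hb x s : b (x :: s) = bar_diff (fun r => e (map i r)) (x :: s).
  have := he (i x) (map i s); rewrite ti mul0r addr0 -map_cons ipK => ->.
  by rewrite bar_diff_map.
split; first by exists (fun r => e (map i r)).
pose e' s := e s - e (map i (map p s)).
pose g := cup_hom t (fun s => c (map p s)).
have ge s : bar_diff e' s = g s.
  case: s => // x s.
  rewrite bar_diffB -he (bar_diff_map p (fun r => e (map i r))) -hb.
  by rewrite addrAC subrr add0r.
have gi x r : g (i x :: r) = 0 by rewrite /g /= ti mul0r.
have cg s : c s = prism i i g z s.
  case: s => [|x s]; first by rewrite /= tz mul1r.
  rewrite prism_cons prism0 ?subr0; last by move=> r; exact: gi.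
  by rewrite /g /= tz mul1r iK ipK.
exists (fun r => - prism i i e' z r) => s.
rewrite cg -(eq_prism _ _ _ _ ge) prism_central //.
have -> : bar_diff (fun r => - prism i i e' z r) s =
    bar_diff (fun r => 0 - prism i i e' z r) s.
  by apply: eq_bar_diff => r; rewrite sub0r.
by rewrite bar_diffB (@bar_diff0 _ _ (fun=> 0)) ?sub0r.
Qed.

End CentralCochains.

(** * Cohomology classes and pullbacks *)

Section CohomologyClasses.
Variables (F : fieldType) (G : groupType).
Local Notation cochain := (wordfun G F).
Local Notation H := (cohomology G F).

Lemma cocycle_bar (z : cocycles G F) s : bar_diff (z : seq G -> F) s = 0.
Proof. by have /(congr1 (fun f : cochain => f s)) := cocycle_diff z; rewrite -bar_diffE. Qed.

(** Primitives are constructed as arbitrary functions on tuples; this cuts them off to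
cochains. *)
Lemma truncate_short (N : pred nat) n (f : seq G -> F) : (forall m, N m -> m < n)%N ->
  (fun s => if N (size s) then f s else 0 : F^o) \in @short_support G F.
Proof.
move=> hN; apply/asboolP; exists n => s hs.
by case: ifP => // /hN; rewrite ltnNge hs.
Qed.

Lemma coh_class_eq0P (z : cocycles G F) :
  coh_class z = 0 <->
  exists e : seq G -> F, forall s, z s = bar_diff e s :> F.
Proof.
rewrite coh_class_eq0; split=> [/asboolP[h hz]|[e he]].
  by exists (h : seq G -> F) => s; rewrite -hz /= bar_diffE.
have [n hn] := wordfun_shortP (z : cochain).
apply/asboolP; exists (WordFun (@truncate_short (fun m => m < n)%N n e (fun m h => h))).
apply: wordfunP => s; rewrite [LHS]bar_diffE.
have [hs|hs] := leqP (size s) n.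
  case: s hs => [|x s] hs; first by rewrite he.
  rewrite he; refine (@bar_diff_local F G _ e (x :: s) _) => r /= ->.
  by rewrite (_ : (size s < n)%N).
rewrite hn 1?ltnW // -[RHS](@bar_diff0 F G (fun=> 0) s) //.
by refine (@bar_diff_local F G _ (fun=> 0) s _) => r /= ->; case: ltnP => //; lia.
Qed.

Lemma cocycle_of n (f : seq G -> F) : (forall s, bar_diff f s = 0) ->
  exists2 z : cocycles G F, word_homog n (z : cochain) &
    forall s, size s = n -> z s = f s :> F.
Proof.
move=> df.
have hN m : (fun m => m == n) m -> (m < n.+1)%N by move=> /eqP->.
have zc : WordFun (truncate_short f hN) \in @cocycle G F.
  apply/eqP/wordfunP => s; rewrite [LHS]bar_diffE.
  have [hs|hs] := eqVneq (size s) n.+1.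
    rewrite -[RHS](df s); refine (@bar_diff_local F G _ f s _) => r /= ->.
    by rewrite hs eqxx.
  rewrite -[RHS](@bar_diff0 F G (fun=> 0) s) //.
  case: s hs => [|x s] hs //; refine (@bar_diff_local F G _ (fun=> 0) (x :: s) _) => r /= ->.
  by rewrite ifN.
exists (Cocycle zc) => [s hs|s hs] /=; first by rewrite (negbTE hs).
by rewrite hs eqxx.
Qed.

Lemma coh_homog_rep n (X : H) : coh_homog n X ->
  exists2 z : cocycles G F, word_homog n (z : cochain) & coh_class z = X.
Proof. by case=> z [hz zX]; exists z. Qed.

Lemma coh_homog0P (X : H) : coh_homog 0 X -> exists c : F, X = c *: 1.
Proof.
case/coh_homog_rep=> z hz <-; exists (z [::]).
pose c : F := z [::]; rewrite -/c.
have -> : c *: (1 : H) = coh_class (c *: 1) by rewrite coh_classZ.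
congr coh_class.
apply/val_inj/wordfunP => s; transitivity (c * unit_fun F s); last by [].
case: s => [|x s]; first by rewrite /= mulr1.
by rewrite hz //= mulr0.
Qed.

Lemma cocycle1_hom (z : cocycles G F) : forall x y,
  z [:: (x * y)%g] = z [:: x] + z [:: y].
Proof.
by move=> x y; rewrite (@bar_cocycleM _ _ (z : seq G -> F)) ?cocycle_bar //= addrC.
Qed.

(** The homomorphism t is the cup product of t with the unit cochain. *)
Lemma hom_cocycle (t : G -> F) : (forall x y, t (x * y)%g = t x + t y) ->
  exists2 z : cocycles G F, word_homog 1 (z : cochain) & forall x, z [:: x] = t x.
Proof.
move=> tM; have [|z hz zt] := @cocycle_of 1 (cup_hom t (fun s => if s is [::] then 1 else 0)).
  move=> s; rewrite bar_diff_cup //; case: s => [|x s]; rewrite /cup_hom ?oppr0 //.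
  case: s => [|y s] /=; rewrite ?mulr0 ?oppr0 //.
  by case: s => [|w s]; rewrite /= ?subrr ?subr0 ?bar_act0 ?subrr ?mulr0 ?oppr0.
by exists z => // x; rewrite zt //= mulr1.
Qed.

Lemma cocyclesME (y z : cocycles G F) s : (y * z) s = conv y z s.
Proof. by []. Qed.

Lemma cup_degree1l (y z : cocycles G F) s : word_homog 1 (y : cochain) ->
  (y * z) s = cup_hom (fun x => y [:: x]) (z : seq G -> F) s.
Proof.
move=> hy; rewrite cocyclesME /conv.
case: s => [|x s]; first by rewrite big_ord1 /= hy // mul0r.
rewrite big_ord_recl /= hy // mul0r add0r big_ord_recl /= take0 drop0.
rewrite big1 ?addr0 // => i _; rewrite hy ?mul0r //=.
by case: s i => [|w s] [] // i hi.
Qed.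

Lemma cup_degree1r (y z : cocycles G F) x1 x2 : word_homog 1 (z : cochain) ->
  (y * z) [:: x1; x2] = y [:: x1] * z [:: x2].
Proof.
move=> hz; rewrite cocyclesME /conv !big_ord_recl big_ord0 /= addr0.
by rewrite (hz [::]) // (hz [:: x1; x2]) // !mulr0 add0r addr0.
Qed.

(** A primitive of y z + z y is the function - y(x) z(x). *)
Lemma degree1_anticomm (X Y : H) : coh_homog 1 X -> coh_homog 1 Y -> X * Y = - (Y * X).
Proof.
move=> /coh_homog_rep[y hy <-] /coh_homog_rep[z hz <-].
apply/eqP; rewrite -addr_eq0 -!coh_classM -coh_classD; apply/eqP/coh_class_eq0P.
exists (fun s => if s is [:: x] then - (y [:: x] * z [:: x]) else 0) => s.
have -> : (y * z + z * y : cocycles G F) s = (y * z) s + (z * y) s by [].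
rewrite !cup_degree1l //; case: s => [|x [|x2 [|x3 s]]] /=.
- by rewrite addr0.
- by rewrite (hz [::]) // (hy [::]) // !mulr0 addr0 subrr.
- by rewrite !cocycle1_hom; ring.
- rewrite (hz [:: x2, x3 & s]) // (hy [:: x2, x3 & s]) // !mulr0 addr0.
  by rewrite bar_act0 ?subrr //; case: s.
Qed.

End CohomologyClasses.

Section Pullback.
Variables (F : fieldType) (G K : groupType) (p : {multiplicative G -> K}).

Fact pull_short (f : wordfun K F) :
  (fun s => f (map p s)) \in @short_support G F.
Proof.
have [n hn] := wordfun_shortP f; apply/asboolP; exists n => s hs.
by rewrite hn // size_map.
Qed.

Definition pull_cochain (f : wordfun K F) : wordfun G F := WordFun (pull_short f).

Fact pull_cocycle_subproof (z : cocycles K F) :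
  pull_cochain (z : wordfun K F) \in @cocycle G F.
Proof.
apply/eqP/wordfunP => s; rewrite [LHS]bar_diffE.
by rewrite (bar_diff_map p (z : seq K -> F)) cocycle_bar.
Qed.

Definition pull_cocycle (z : cocycles K F) : cocycles G F :=
  Cocycle (pull_cocycle_subproof z).

Definition pullback (X : cohomology K F) : cohomology G F :=
  coh_class (pull_cocycle (repr X)).

Lemma pullbackE z : pullback (coh_class z) = coh_class (pull_cocycle z).
Proof.
apply/eqP; rewrite -subr_eq0 -[- coh_class _]scaleN1r -coh_classZ -coh_classD.
have : repr (coh_class z) - z \in @coboundary K F := repr_coh_class z.
move/coh_class_eq0/coh_class_eq0P => [e he]; apply/eqP/coh_class_eq0P.
exists (fun s => e (map p s)) => s; rewrite bar_diff_map -he.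
have -> : (pull_cocycle (repr (coh_class z)) + (-1) *: pull_cocycle z : cocycles G F) s
  = repr (coh_class z) (map p s) + -1 * z (map p s) by [].
by rewrite mulN1r.
Qed.

Fact pullback_linear : linear pullback.
Proof.
move=> a X Y; rewrite -[X]coh_classK -[Y]coh_classK -coh_classZ -coh_classD.
by rewrite !pullbackE -coh_classZ -coh_classD; congr coh_class; apply/val_inj/wordfunP.
Qed.

HB.instance Definition _ :=
  GRing.isLinear.Build F (cohomology K F) (cohomology G F) _ pullback pullback_linear.

Fact pullback_monoid : monoid_morphism pullback.
Proof.
split; first by rewrite [LHS]pullbackE; congr coh_class; apply/val_inj/wordfunP => -[].
move=> X Y; rewrite -[X]coh_classK -[Y]coh_classK -coh_classM.
rewrite !pullbackE -coh_classM; congr coh_class; apply/val_inj/wordfunP => s.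
transitivity (conv (repr X : cocycles K F) (repr Y : cocycles K F) (map p s)); first by [].
rewrite cocyclesME /conv size_map.
by apply: eq_bigr => j _ /=; rewrite map_take map_drop.
Qed.

HB.instance Definition _ :=
  GRing.isMonoidMorphism.Build (cohomology K F) (cohomology G F) pullback pullback_monoid.

Lemma pullback_homog n X : coh_homog n X -> coh_homog n (pullback X).
Proof.
case/coh_homog_rep => z hz <-; rewrite pullbackE; exists (pull_cocycle z).
by split=> // s hs; rewrite /= hz // size_map.
Qed.

End Pullback.

Lemma pullbackK (F : fieldType) (G K : groupType) (p : {multiplicative G -> K})
  (q : {multiplicative K -> G}) : cancel p q ->
  cancel (@pullback F K G q) (@pullback F G K p).
Proof.
move=> pq X; rewrite -[X]coh_classK !pullbackE; congr coh_class.
apply/val_inj/wordfunP => s /=; rewrite -map_comp map_id_in // => x _ /=; exact: pq.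
Qed.

(** For a cocycle z the contraction by 1 is a primitive of z along the constant
sequences of units. *)
Lemma pullback_const (F : fieldType) (G K : groupType) (p : {multiplicative G -> K}) n X :
  (forall x, p x = 1%g) -> coh_homog n.+1 X -> @pullback F G K p X = 0.
Proof.
move=> p1 /coh_homog_rep[z hz <-]; rewrite pullbackE; apply/coh_class_eq0P.
exists (fun s => z (1%g :: map p s)) => s.
transitivity (@bar_diff F K (fun r => z (1%g :: r)) (map p s)); last first.
  exact/esym/(bar_diff_map p (fun r => (z : seq K -> F) (1%g :: r))).
case: s => [|x s]; first by rewrite /= hz.
have h := bar_diff_first (p x) (map p s) (@cocycle_bar F K z).
by rewrite [map p _]/= [RHS]h -{1}(p1 x).
Qed.

(** * Cohomology of free products, central products and RAAGs *)

Section FreeProductCohomology.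
Variables (F : fieldType) (G K L : groupType).
Variables (iG : {multiplicative G -> L}) (iK : {multiplicative K -> L}).
Variables (pG : {multiplicative L -> G}) (pK : {multiplicative L -> K}).
Hypotheses (iGK : cancel iG pG) (iKK : cancel iK pK).
Hypothesis gen : forall P : L -> Prop,
  P 1%g -> (forall x y, P x -> P y -> P (x * y)%g) ->
  (forall g, P (iG g)) -> (forall k, P (iK k)) -> forall x, P x.
Hypothesis split : forall phi : L -> F, exists psi : L -> F,
  (forall g x, psi (iG g * x)%g = psi x) /\
  (forall k x, phi (iK k * x)%g - psi (iK k * x)%g = phi x - psi x).

Lemma free_product_coh_inj n (X : cohomology L F) : coh_homog n.+1 X ->
  pullback iG X = 0 -> pullback iK X = 0 -> X = 0.
Proof.
case/coh_homog_rep=> z hz <-; rewrite !pullbackE.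
move=> /coh_class_eq0P[hG zG] /coh_class_eq0P[hK zK].
have [||e he] := free_product_cocycle iGK iKK gen split (cocycle_bar z) (hG := hG) (hK := hK).
- by move=> x s; exact: zG (x :: s).
- by move=> x s; exact: zK (x :: s).
by apply/coh_class_eq0P; exists e => -[|x s]; [rewrite hz | exact: he].
Qed.

End FreeProductCohomology.

Section CentralCohomology.
Variables (F : fieldType) (G L : groupType).
Variables (i : {multiplicative G -> L}) (p : {multiplicative L -> G}).
Variables (z : L) (tau : cocycles L F).
Hypotheses (iK : cancel i p) (zC : forall x, (z * i x = i x * z)%g).
Hypotheses (tau1 : word_homog 1 (tau : wordfun L F)).
Hypotheses (ti : forall x, tau [:: i x] = 0) (tz : tau [:: z] = 1).
Hypothesis gen : forall P : L -> Prop,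
  (forall x y, P x -> P y -> P (x * y)%g) ->
  (forall g, P (i g)) -> P z -> P z^-1%g -> forall x, P x.
Hypothesis solve : forall q : L -> F,
  (forall g x, q (i g * x)%g = q x) -> q 1%g = 0 -> exists e : L -> F,
  [/\ forall g x, e (i g * x)%g = e x, forall x, e x - e (z * x)%g = q x & e 1%g = 0].

(** The terms of degree n in [central_product_cocycle] are the only ones that matter. *)
Lemma central_coh_dec n (X : cohomology L F) : coh_homog n.+1 X ->
  exists2 Y : cohomology G F, coh_homog n Y &
    X = pullback p (pullback i X) + coh_class tau * pullback p Y.
Proof.
case/coh_homog_rep=> c hc <-.
have [b [e [db he]]] := @central_product_cocycle F G L i p z _ iK zC
  (cocycle1_hom tau) ti tz gen solve (c : seq L -> F) (cocycle_bar c).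
have [y hy yb] := cocycle_of n db.
exists (coh_class y); first by exists y.
rewrite !pullbackE -coh_classM -coh_classD; apply/coh_classP.
apply/coh_class_eq0/coh_class_eq0P; exists (fun s => if size s == n then e s else 0) => s.
transitivity (c s - (c (map i (map p s)) + (tau * pull_cocycle p y) s)); first by [].
rewrite cup_degree1l //.
have [sn|sn] := eqVneq (size s) n.+1; last first.
  rewrite !hc ?size_map // sub0r add0r.
  rewrite (_ : bar_diff _ s = 0 :> F); last first.
    transitivity (@bar_diff F L (fun=> 0) s); last exact: bar_diff0.
    by case: s sn => // x s sn; apply: bar_diff_local => r /= ->; rewrite ifN.
  by case: s sn => [|x s] sn /=; rewrite ?oppr0 // hy ?size_map // mulr0 oppr0.
rewrite (_ : bar_diff _ s = bar_diff e s); last first.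
  by apply: bar_diff_local => r ->; rewrite sn eqxx.
case: s sn => // x s [sn]; rewrite he.
by rewrite /cup_hom /= yb ?size_map // -map_comp; ring.
Qed.

Lemma central_coh_inj (Y : cohomology G F) :
  coh_class tau * pullback p Y = 0 -> Y = 0.
Proof.
rewrite -[Y]coh_classK pullbackE -coh_classM => /coh_class_eq0P[e he].
apply/coh_class_eq0P.
have [|_ //] := @central_product_inj F G L i p z (fun x => tau [:: x]) iK zC ti tz
  (fun=> 0) (repr Y : cocycles G F) e.
by move=> x s; rewrite add0r -he cup_degree1l.
Qed.

End CentralCohomology.

Section RaagCup.
Variables (F : fieldType) (Gamma : graph).
Local Notation G := (raag Gamma).
Local Notation gen := (@pgen Gamma (@raag_relators Gamma)).

Lemma raag_hom (c : Gamma -> F) :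
  exists2 z : cocycles G F, word_homog 1 (z : wordfun G F) &
    forall v, z [:: gen v] = c v.
Proof.
have [|t [tM tc]] := @presented_to_field _ (@raag_relators Gamma) F c.
  move=> _ [v [w [_ ->]]] u; rewrite /= /letter_step /=; ring.
have [z z1 zt] := hom_cocycle tM; exists z => // v; rewrite zt; exact: tc.
Qed.

(** The increments y(v) z(u) for the left multiplication by v at u integrate to a
function E, because around the relator of an edge vw they add up to
y(v) z(w) - y(w) z(v), up to sign. By construction - E is a primitive of y z. *)
Lemma raag_cup (y z : cocycles G F) :
  word_homog 1 (y : wordfun G F) -> word_homog 1 (z : wordfun G F) ->
  (forall v w, edge v w -> y [:: gen v] * z [:: gen w] = y [:: gen w] * z [:: gen v]) ->
  coh_class y * coh_class z = 0.
Proof.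
move=> hy hz hyz.
have z1 : z [:: 1%g] = 0.
  by apply: (addrI (z [:: 1%g])); rewrite addr0 -cocycle1_hom mulg1.
have y1 : y [:: 1%g] = 0.
  by apply: (addrI (y [:: 1%g])); rewrite addr0 -cocycle1_hom mulg1.
have zV x : z [:: x^-1%g] = - z [:: x].
  by apply/eqP; rewrite -addr_eq0 -cocycle1_hom mulVg z1.
have yV x : y [:: x^-1%g] = - y [:: x].
  by apply/eqP; rewrite -addr_eq0 -cocycle1_hom mulVg y1.
have [|E [E1 hE]] := @presented_potential _ (@raag_relators Gamma) F
    (fun v u => y [:: gen v] * z [:: u]).
  move=> _ [v [w [vw ->]]] u.
  rewrite /= /letter_step /= !pres_word_cons !pres_word_nil /= !cocycle1_hom !zV z1.
  by have := hyz v w vw => e; ring: e.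
have EM x u : E (x * u)%g = E x + E u + y [:: x] * z [:: u].
  move: x u; apply: presented_ind => [u|x x' ex ex' u|x u|x u].
  - by rewrite mul1g E1 y1; ring.
  - by rewrite -mulgA !ex !ex' !cocycle1_hom; ring.
  - by rewrite hE -[in E (gen x)](mulg1 (gen x)) hE E1 z1; ring.
  - rewrite (potentialV _ _ hE) -[in E _^-1%g](mulg1 (gen x)^-1%g) (potentialV _ _ hE).
    by rewrite E1 !cocycle1_hom zV yV z1; ring.
rewrite -coh_classM; apply/coh_class_eq0P.
exists (fun s => if s is [:: x] then - E x else 0) => s.
rewrite cup_degree1l //; case: s => [|x [|x2 [|x3 s]]] //=.
- by rewrite hz // mulr0 subrr.
- by rewrite EM; ring.
- by rewrite (hz [:: x2, x3 & s]) // mulr0 bar_act0 ?subrr //; case: s.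
Qed.

End RaagCup.

(** * Graded algebras and evaluation of words *)

Local Open Scope classical_set_scope.

Section GradedAlgebra.
Variables (F : fieldType) (A : gradedAlg F).
Implicit Types (a b x y : A) (V W P : set A).

Lemma homogD n x y : homog n x -> homog n y -> homog n (x + y).
Proof. by move=> hx hy; rewrite -[x]scale1r; exact: homogP. Qed.

Lemma homogZ n c x : homog n x -> homog n (c *: x).
Proof. by move=> hx; rewrite -[_ *: _]addr0; apply: homogP => //; exact: homog0. Qed.

Lemma homogN n x : homog n x -> homog n (- x).
Proof. by rewrite -scaleN1r; exact: homogZ. Qed.

Lemma homog_big n (T : Type) (r : seq T) (Q : pred T) (c : T -> A) :
  (forall i, Q i -> homog n (c i)) -> homog n (\sum_(i <- r | Q i) c i).
Proof. by move=> hc; apply: big_ind => //; [exact: homog0 | exact: homogD]. Qed.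

Lemma homog_comp_uniq N (c d : nat -> A) : (forall i, homog i (c i)) ->
  (forall i, homog i (d i)) -> \sum_(i < N) c i = \sum_(i < N) d i ->
  forall i, (i < N)%N -> c i = d i.
Proof.
move=> hc hd e i hi; apply/eqP; rewrite -subr_eq0; apply/eqP.
apply: (@homog_direct _ A N (fun i => c i - d i)) => //.
  by move=> j; apply: homogD => //; exact: homogN.
by rewrite sumrB e subrr.
Qed.

Lemma big_ord_eq_one N n (c : nat -> A) : (n < N)%N ->
  \sum_(i < N) (if i == n :> nat then c i else 0) = c n.
Proof.
move=> nN; rewrite (bigD1 (Ordinal nN)) //= eqxx big1 ?addr0 // => i.
by rewrite -val_eqE /= => /negbTE ->.
Qed.

Lemma homog_comp_eq N n (c : nat -> A) a : (forall i, homog i (c i)) ->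
  homog n a -> a = \sum_(i < N) c i -> (n < N)%N -> a = c n.
Proof.
move=> hc ha e nN.
have := @homog_comp_uniq N (fun i => if i == n then a else 0) c.
rewrite (@big_ord_eq_one N n (fun=> a)) // => /(_ _ hc e n nN); rewrite eqxx; apply.
by move=> i; case: eqP => [->|_] //; exact: homog0.
Qed.

Lemma homog_decomp a : exists c : nat -> A, (forall i, homog i (c i)) /\
  exists N, forall M, (N <= M)%N -> a = \sum_(i < M) c i.
Proof.
have [N [c [hc e]]] := homog_sum a.
exists (fun i => if (i < N)%N then c i else 0); split.
  by move=> i; case: ifP => // _; exact: homog0.
exists N => M NM; rewrite e (big_ord_widen _ c NM) big_mkcond /=.
by apply: eq_bigr => i _.
Qed.

(** Keeping the degrees of the left factors explicit makes membership in a linear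
ideal a statement about each degree separately. *)
Definition prodspan P V : set A := [set y | exists t : seq (A * A),
  (forall p, p \in t -> P p.1 /\ V p.2) /\ y = \sum_(p <- t) p.1 * p.2].

Lemma prodspan0 P V : prodspan P V 0.
Proof. by exists [::]; rewrite big_nil. Qed.

Lemma prodspanD P V x y : prodspan P V x -> prodspan P V y -> prodspan P V (x + y).
Proof.
move=> [t [ht ->]] [u [hu ->]]; exists (t ++ u); rewrite big_cat; split=> // q.
by rewrite mem_cat => /orP[/ht|/hu].
Qed.

Lemma prodspan_mul P V x y : P x -> V y -> prodspan P V (x * y).
Proof.
move=> hx hy; exists [:: (x, y)]; rewrite big_seq1; split=> // q.
by rewrite inE => /eqP ->.
Qed.

Lemma prodspan_big P V (T : Type) (r : seq T) (c : T -> A) :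
  (forall i, prodspan P V (c i)) -> prodspan P V (\sum_(i <- r) c i).
Proof. by move=> hc; apply: big_ind => //; [exact: prodspan0 | exact: prodspanD]. Qed.

Lemma prodspan_ind P V (Q : A -> Prop) : Q 0 -> (forall x y, Q x -> Q y -> Q (x + y)) ->
  (forall x y, P x -> V y -> Q (x * y)) -> forall a, prodspan P V a -> Q a.
Proof.
move=> Q0 QD QM a [t [ht ->]]; elim: t ht => [|q t IHt] ht; first by rewrite big_nil.
rewrite big_cons; apply: QD; last by apply: IHt => r rt; apply: ht; rewrite inE rt orbT.
by have [] := ht q (mem_head _ _); exact: QM.
Qed.

Lemma prodspanZ n V c x : prodspan (homog n) V x -> prodspan (homog n) V (c *: x).
Proof.
apply: (@prodspan_ind _ _ (fun x => prodspan (homog n) V (c *: x))).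
- by rewrite scaler0; exact: prodspan0.
- by move=> u v hu hv; rewrite scalerDr; exact: prodspanD.
- by move=> u v hu hv; rewrite scalerAl; apply: prodspan_mul => //; exact: homogZ.
Qed.

Lemma prodspanN n V x : prodspan (homog n) V x -> prodspan (homog n) V (- x).
Proof. by rewrite -scaleN1r; exact: prodspanZ. Qed.

Lemma prodspan_mull m n V x y : homog m y -> prodspan (homog n) V x ->
  prodspan (homog (m + n)%N) V (y * x).
Proof.
move=> hy; apply: (@prodspan_ind _ _ (fun x => prodspan (homog (m + n)%N) V (y * x))).
- by rewrite mulr0; exact: prodspan0.
- by move=> u v hu hv; rewrite mulrDr; exact: prodspanD.
- by move=> u v hu hv; rewrite mulrA; apply: prodspan_mul => //; exact: homogM.
Qed.

Definition subspace V := V 0 /\ forall (c : F) x y, V x -> V y -> V (c *: x + y).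

Definition linear_colon V b : set A :=
  [set w | homog 1 w /\ prodspan (homog 1) V (w * b)].

(** Universal Koszulity in terms of elements: what multiplies b into the ideal of V
is generated in degree one. The element b may lie in V; then the condition only
says that degree one generates. It has to be allowed because the condition is
applied to projections, where the image of b may fall into the image of V. *)
Definition colon_condition := forall V b, V `<=` homog 1 -> subspace V -> homog 1 b ->
  forall n a, homog n.+1 a -> prodspan (homog n.+1) V (a * b) ->
  prodspan (homog n) (linear_colon V b) a.

(** In degree one the colon condition is void. *)
Lemma colon_condition1 V b a : homog 1 a -> prodspan (homog 1) V (a * b) ->
  prodspan (homog 0) (linear_colon V b) a.
Proof.
by move=> ha hab; rewrite -[a]mul1r; apply: prodspan_mul => //; exact: homog_one.
Qed.

Lemma square0_anticomm : (forall x : A, homog 1 x -> x * x = 0) ->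
  forall x y, homog 1 x -> homog 1 y -> x * y = - (y * x).
Proof.
move=> sq x y hx hy; apply/eqP; rewrite -addr_eq0; apply/eqP.
have := sq _ (homogD hx hy).
by rewrite mulrDl !mulrDr !sq // add0r addr0.
Qed.

End GradedAlgebra.

Section Ideals.
Variables (F : fieldType) (A : gradedAlg F) (S : set A).

Lemma generated_ideal_ideal : ideal (generated_ideal S).
Proof.
split.
- by exists [::]; rewrite big_nil.
- move=> x y [t [ht ->]] [u [hu ->]]; exists (t ++ u); rewrite big_cat; split=> // q.
  by rewrite mem_cat => /orP[/ht|/hu].
- move=> a x [t [ht ->]]; split.
    exists [seq ((a * p.1.1, p.1.2), p.2) | p <- t]; split.
      by move=> _ /mapP[p /ht hp ->].
    by rewrite big_map mulr_sumr; apply: eq_bigr => p _; rewrite !mulrA.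
  exists [seq (p.1, p.2 * a) | p <- t]; split.
    by move=> _ /mapP[p /ht hp ->].
  by rewrite big_map mulr_suml; apply: eq_bigr => p _; rewrite !mulrA.
Qed.

Lemma generated_ideal_sub : S `<=` generated_ideal S.
Proof.
move=> x Sx; exists [:: ((1, x), 1)]; split.
  by move=> p; rewrite inE => /eqP ->.
by rewrite big_seq1 mul1r mulr1.
Qed.

Lemma generated_ideal_min (J : set A) : ideal J -> S `<=` J -> generated_ideal S `<=` J.
Proof.
move=> [J0 JD JM] sJ x [t [ht ->]]; elim: t ht => [|q t IHt] ht; first by rewrite big_nil.
rewrite big_cons; apply: JD; last by apply: IHt => r rt; apply: ht; rewrite inE rt orbT.
by apply: (JM _ _ _).2; apply: (JM _ _ _).1; apply/sJ/ht/mem_head.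
Qed.
End Ideals.

Lemma preimage_ideal (F : fieldType) (A B : gradedAlg F) (f : {lrmorphism A -> B})
  (J : set B) : ideal J -> ideal (f @^-1` J).
Proof.
move=> [J0 JD JM]; split; rewrite /preimage /=; first by rewrite linear0.
  by move=> x y Jx Jy; rewrite linearD; exact: JD.
by move=> a x Jx; rewrite !rmorphM; exact: JM.
Qed.

Section Monomials.
Variables (F : fieldType) (I : finType).
Local Notation T := (word_algebra I F).

Definition words n : seq (seq I) :=
  flatten [seq [seq val w | w <- enum {: m.-tuple I}] | m <- iota 0 n].

Lemma mem_words n w : (w \in words n) = (size w < n)%N.
Proof.
apply/flatten_mapP/idP => [[m]|hw].
  by rewrite mem_iota add0n /= => hm /mapP[u _ ->]; rewrite size_tuple.
exists (size w); first by rewrite mem_iota.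
by apply/mapP; exists (in_tuple w); rewrite ?mem_enum.
Qed.

Lemma uniq_words n : uniq (words n).
Proof.
rewrite /words; elim: n => // n IHn.
rewrite -addn1 iotaD map_cat flatten_cat /= cats0 cat_uniq IHn.
rewrite (map_inj_uniq val_inj) enum_uniq andbT; apply/hasPn => _ /mapP[u _ ->].
by rewrite -[X in _ \notin X]/(words n) mem_words size_tuple ltnn.
Qed.

Lemma wordsD n m : exists2 r, words (n + m) = words n ++ r &
  forall w, w \in r -> (n <= size w)%N.
Proof.
rewrite /words iotaD map_cat flatten_cat; eexists; first by [].
move=> w /flatten_mapP[k]; rewrite mem_iota => /andP[hk _] /mapP[u _ ->].
by rewrite size_tuple.
Qed.

Fact delta_short (u : seq I) :
  (fun s => (s == u)%:R : F^o) \in @short_support I F.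
Proof.
apply/asboolP; exists (size u).+1 => s hs; case: eqP => // e.
by rewrite e ltnn in hs.
Qed.

Definition delta u : T := WordFun (delta_short u).

Lemma deltaM u v : delta u * delta v = delta (u ++ v).
Proof.
apply: wordfunP => s; rewrite wordfun_mulE /conv /=.
have [->|ne] := eqVneq s (u ++ v).
  have hu : (size u < (size (u ++ v)).+1)%N by rewrite size_cat ltnS leq_addr.
  rewrite (bigD1 (Ordinal hu)) //= take_size_cat // drop_size_cat // !eqxx mul1r.
  rewrite big1 ?addr0 // => i ne; case: eqP => [e|]; last by rewrite mul0r.
  case/eqP: ne; apply/val_inj => /=.
  by have /= <- := congr1 size e; rewrite size_takel // -ltnS.
rewrite big1 // => i _; case: eqP => [e1|]; last by rewrite mul0r.
case: eqP => [e2|]; last by rewrite mulr0.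
by rewrite -(cat_take_drop i s) e1 e2 eqxx in ne.
Qed.

Lemma word_linE (c : F) (f g : T) s : (c *: f + g : T) s = c * f s + g s.
Proof. by []. Qed.

Lemma delta_nil : delta [::] = 1.
Proof. by apply: wordfunP => -[|i s]. Qed.

Lemma delta_homog u : homog (size u) (delta u).
Proof. by move=> s; case: eqP => //= h _; case: eqP => // e; rewrite e in h. Qed.

Lemma delta_sum n (f : T) : (forall s, (n <= size s)%N -> f s = 0) ->
  f = \sum_(w <- words n) (f w : F) *: delta w.
Proof.
move=> hf; apply: wordfunP => s; rewrite wordfun_sumE.
under eq_bigr => w _ do rewrite wordfun_scaleE /=.
have [hs|hs] := leqP n (size s).
  rewrite hf // big_seq big1 // => w; rewrite mem_words => hw.
  case: eqP => [e|]; last by rewrite mulr0.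
  by rewrite -e ltnNge hs in hw.
rewrite (bigD1_seq s) ?mem_words ?uniq_words //= eqxx mulr1 big1 ?addr0 // => w.
by rewrite eq_sym => /negbTE ->; rewrite mulr0.
Qed.

Section Eval.
Variables (A : gradedAlg F) (x : I -> A).

Definition monomial (w : seq I) : A := \prod_(i <- w) x i.

(** The universal property of the tensor algebra, for an arbitrary finite set of
letters: the value on the letter i is x i. All words below some bound for the
support are summed over. *)
Definition word_eval (f : T) : A :=
  \sum_(w <- words (projT1 (cid (wordfun_shortP f)))) (f w : F) *: monomial w.

Lemma word_evalE n (f : T) : (forall s, (n <= size s)%N -> f s = 0) ->
  word_eval f = \sum_(w <- words n) (f w : F) *: monomial w.
Proof.
move=> hn; rewrite /word_eval; case: cid => m /= hm.
have aux k l : (k <= l)%N -> (forall s, (k <= size s)%N -> f s = 0) ->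
    \sum_(w <- words k) (f w : F) *: monomial w = \sum_(w <- words l) (f w : F) *: monomial w.
  move=> kl hk; have [r e hr] := wordsD k (l - k).
  move: e; rewrite subnKC // => ->; rewrite big_cat /= [X in _ + X]big_seq.
  rewrite [X in _ + X]big1 ?addr0 //.
  by move=> w /hr/hk ->; rewrite scale0r.
by case/orP: (leq_total m n) => /aux h; [exact: h | apply/esym/h].
Qed.

Fact word_eval_linear : linear word_eval.
Proof.
move=> c f g; have [[m hm] [n hn]] := (wordfun_shortP f, wordfun_shortP g).
have hf s : (m + n <= size s)%N -> f s = 0 by move=> h; apply: hm; lia.
have hg s : (m + n <= size s)%N -> g s = 0 by move=> h; apply: hn; lia.
rewrite (word_evalE hf) (word_evalE hg) (@word_evalE (m + n)%N); last first.
  by move=> s h; rewrite word_linE hf // hg // mulr0 addr0.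
rewrite scaler_sumr -big_split; apply: eq_bigr => w _.
by rewrite word_linE [in LHS]scalerDl scalerA.
Qed.

HB.instance Definition _ := GRing.isLinear.Build F T A _ word_eval word_eval_linear.

Lemma word_eval_delta w : word_eval (delta w) = monomial w.
Proof.
rewrite (@word_evalE (size w).+1) => [|s hs]; last first.
  by rewrite delta_homog // gtn_eqF.
rewrite (bigD1_seq w) ?mem_words ?uniq_words //= eqxx scale1r big1 ?addr0 // => u.
by move=> /negbTE ->; rewrite scale0r.
Qed.

Fact word_eval_monoid : monoid_morphism word_eval.
Proof.
split; first by rewrite -delta_nil word_eval_delta /monomial big_nil.
move=> f g; have [[m /delta_sum ->] [n /delta_sum ->]] :=
  (wordfun_shortP f, wordfun_shortP g).
rewrite mulr_suml !linear_sum mulr_suml; apply: eq_bigr => u _.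
rewrite mulr_sumr !linear_sum mulr_sumr; apply: eq_bigr => v _.
rewrite -scalerAl -scalerAr !linearZ /= -scalerAl -scalerAr deltaM.
by rewrite !word_eval_delta /monomial big_cat.
Qed.

HB.instance Definition _ :=
  GRing.isMonoidMorphism.Build T A word_eval word_eval_monoid.

Lemma word_eval_delta1 i : word_eval (delta [:: i]) = x i.
Proof. by rewrite word_eval_delta /monomial big_seq1. Qed.

Hypothesis x1 : forall i, homog 1 (x i).

Lemma monomial_homog w : homog (size w) (monomial w).
Proof.
elim: w => [|i w IHw]; rewrite /monomial; first by rewrite big_nil; exact: homog_one.
by rewrite big_cons; exact: (homogM (x1 i) IHw).
Qed.

Lemma word_eval_homog n (f : T) : homog n f -> homog n (word_eval f).
Proof.
move=> hf; rewrite (@word_evalE n.+1) => [|s hs]; last by rewrite hf // gtn_eqF.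
apply: homog_big => w _; have [<-|ne] := eqVneq (size w) n.
  by apply: homogZ; exact: monomial_homog.
by rewrite hf // scale0r; exact: homog0.
Qed.

End Eval.

Lemma word_eval_uniq (A : gradedAlg F) (f : {lrmorphism T -> A}) :
  f =1 word_eval (fun i => f (delta [:: i])).
Proof.
move=> g; have [n /delta_sum ->] := wordfun_shortP g; rewrite !linear_sum.
apply: eq_bigr => w _; rewrite !linearZ /= word_eval_delta; congr (_ *: _).
elim: w => [|i w IHw]; first by rewrite delta_nil rmorph1 /monomial big_nil.
rewrite -cat1s -deltaM rmorphM /= IHw /monomial.
by rewrite big_cons.
Qed.

End Monomials.

Lemma eq_word_eval (F : fieldType) (I : finType) (A : gradedAlg F) (x y : I -> A) :
  x =1 y -> word_eval x =1 word_eval y.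
Proof.
move=> xy f; rewrite /word_eval; apply: eq_bigr => w _; congr (_ *: _).
exact: eq_bigr.
Qed.

Lemma word_eval_comp (F : fieldType) (I : finType) (A B : gradedAlg F)
  (f : {lrmorphism A -> B}) (x : I -> A) g :
  f (word_eval x g) = word_eval (f \o x) g.
Proof.
rewrite [LHS](word_eval_uniq (f \o word_eval x)); apply: eq_word_eval => i /=.
by rewrite word_eval_delta1.
Qed.

(** * Universal Koszulity as a condition on elements *)

Section Presentations.
Variable F : fieldType.

Definition quadratic_relations (A : gradedAlg F) (I : finType) (x : I -> A) :
    set (word_algebra I F) :=
  [set f | homog 2 f /\ word_eval x f = 0].

Definition generators (A : gradedAlg F) (I : finType) (x : I -> A) :=
  (forall i, homog 1 (x i)) /\ forall a, exists f, word_eval x f = a.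

Definition quadratic_presentation (A : gradedAlg F) (I : finType) (x : I -> A) :=
  generators x /\
  forall f, word_eval x f = 0 -> generated_ideal (quadratic_relations x) f.

Lemma quadratic_relations_eval (A : gradedAlg F) (I : finType) (x : I -> A) f :
  generated_ideal (quadratic_relations x) f -> word_eval x f = 0.
Proof.
apply: (@generated_ideal_min _ _ _ [set f | word_eval x f = 0]); last by move=> g [].
split=> [|g h|g h]; rewrite /= ?linear0 //.
  by move=> gx hx; rewrite linearD /= gx hx addr0.
by move=> hx; rewrite !rmorphM /= hx mulr0 mul0r.
Qed.

(** Relations of B become relations of A under a substitution of letters that covers
a morphism h from B to A. *)
Lemma quadratic_relations_map (A B : gradedAlg F) (I J : finType) (x : I -> B)
    (y : J -> A) (h : {lrmorphism B -> A}) (g : I -> word_algebra J F) :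
  (forall i, homog 1 (g i)) -> (forall i, word_eval y (g i) = h (x i)) ->
  forall f, generated_ideal (quadratic_relations x) f ->
  generated_ideal (quadratic_relations y) (word_eval g f).
Proof.
move=> g1 gy; apply: generated_ideal_min.
  exact: (preimage_ideal (word_eval g) (@generated_ideal_ideal _ _ _)).
move=> f [f2 f0]; apply: generated_ideal_sub; split; first exact: word_eval_homog.
have -> : word_eval y (word_eval g f) = word_eval (h \o x) f.
  by rewrite (word_eval_comp (word_eval y)); apply: eq_word_eval => i /=.
by rewrite -word_eval_comp f0 linear0.
Qed.

Lemma word_eval0 (A : gradedAlg F) (I : finType) f :
  word_eval (fun _ : I => 0 : A) f = (f [::] : F) *: 1.
Proof.
have [n hn] := wordfun_shortP f.
have hn1 s : (n.+1 <= size s)%N -> f s = 0 by move=> h; apply: hn; exact: ltnW.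
rewrite (word_evalE _ hn1) (bigD1_seq [::]) ?mem_words ?uniq_words //=.
rewrite {1}/monomial big_nil big1 ?addr0 // => -[|i w] //= _.
by rewrite /monomial big_cons mul0r scaler0.
Qed.

Lemma word_algebra_ind (I : finType) (P : word_algebra I F -> Prop) :
  P 1 -> (forall (c : F) f g, P f -> P g -> P (c *: f + g)) ->
  (forall i f, P f -> P (delta F [:: i] * f)) -> forall f, P f.
Proof.
move=> P1 Plin Pmul f.
have P0 : P 0 by rewrite -[0](addNr 1) -scaleN1r; exact: Plin.
have Pd w : P (delta F w).
  by elim: w => [|i w IHw]; rewrite ?delta_nil // -cat1s -deltaM; exact: Pmul.
have [n /delta_sum ->] := wordfun_shortP f.
elim: (words I n) => [|w r IHr]; first by rewrite big_nil.
by rewrite big_cons; exact: Plin.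
Qed.

Section Generators.
Variables (A : gradedAlg F) (I : finType) (x : I -> A).
Hypothesis gx : generators x.

(** The components of a preimage of a are sent to the components of a. *)
Lemma generators_comp n (a : A) : homog n a ->
  exists2 f : word_algebra I F, homog n f & word_eval x f = a.
Proof.
move=> ha; have [f fa] := gx.2 a; have [m hm] := wordfun_shortP f.
exists (word_comp n f); first exact: word_comp_homog.
apply/esym/(@homog_comp_eq _ A (m + n.+1) n (fun i => word_eval x (word_comp i f))) => //.
- by move=> i; apply: word_eval_homog; [exact: gx.1 | exact: word_comp_homog].
- rewrite -linear_sum -{1}fa; congr word_eval; apply: word_comp_sum => s hs.
  by apply: hm; apply: leq_trans hs; exact: leq_addr.
- by rewrite ltn_addl.
Qed.

Lemma generators_homog0 (a : A) : homog 0 a -> exists c : F, a = c *: 1.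
Proof.
case/generators_comp=> f hf <-; exists (f [::]).
have f1 s : (1 <= size s)%N -> f s = 0 by case: s => // i s _; exact: hf.
rewrite (word_evalE _ f1) (bigD1_seq [::]) ?mem_words ?uniq_words //=.
rewrite {1}/monomial big_nil big1 ?addr0 // => -[|i w] //= _.
by rewrite hf // scale0r.
Qed.

Lemma generators_span n (a : A) : homog n.+1 a -> prodspan (homog n) (homog 1) a.
Proof.
case/generators_comp=> f hf <-.
rewrite (@word_evalE _ _ _ _ n.+2) => [|s hs]; last by rewrite hf // gtn_eqF.
apply: prodspan_big => w; have [hw|hw] := eqVneq (size w) n.+1; last first.
  by rewrite hf // scale0r; exact: prodspan0.
apply: prodspanZ; case/lastP: w hw => // w i; rewrite size_rcons => -[<-].
rewrite /monomial -cats1 big_cat big_seq1.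
by apply: prodspan_mul; [apply: monomial_homog; exact: gx.1 | exact: gx.1].
Qed.

Hypothesis sq : forall a : A, homog 1 a -> a * a = 0.

(** Degree-one elements anticommute by polarization of the vanishing of squares. *)
Lemma generators_sign n (a b : A) : homog n a -> homog 1 b ->
  a * b = (-1) ^+ n *: (b * a).
Proof.
move=> ha hb; elim: n a ha => [|n IHn] a ha.
  by have [c ->] := generators_homog0 ha; rewrite scale1r -scalerAl -scalerAr mul1r mulr1.
apply: (@prodspan_ind _ _ (homog n) (homog 1)
  (fun a => a * b = (-1) ^+ n.+1 *: (b * a))) (generators_span ha).
- by rewrite mul0r mulr0 scaler0.
- by move=> u v hu hv; rewrite mulrDl hu hv mulrDr scalerDr.
- move=> u v hu hv; rewrite -mulrA (square0_anticomm sq hv hb) mulrN (mulrA u) IHn //.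
  by rewrite exprS mulN1r scaleNr -scalerAl mulrA.
Qed.

(** Elements of degree one are normal, so that left ideals generated in degree one are
two-sided. *)
Lemma generators_normal (a b : A) : homog 1 b -> exists c, a * b = b * c.
Proof.
move=> hb; have [c [hc [N /(_ N (leqnn N)) ->]]] := homog_decomp a.
exists (\sum_(i < N) (-1) ^+ i *: c i); rewrite mulr_suml mulr_sumr.
by apply: eq_bigr => i _; rewrite (generators_sign (hc i) hb) scalerAr.
Qed.

End Generators.

(** The form of universal Koszulity, with a quadratic presentation on an arbitrary
finite set of letters, that is carried through the construction of groups of
elementary type. Vanishing of squares makes left and two-sided ideals agree. *)
Definition strictly_koszul (A : gradedAlg F) :=
  [/\ exists (I : finType) (x : I -> A), quadratic_presentation x,
      forall a : A, homog 1 a -> a * a = 0 & colon_condition A].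

Lemma graded_ideal_comp (A : gradedAlg F) (J : set A) N (c : nat -> A) :
  graded_ideal J -> (forall i, homog i (c i)) -> J (\sum_(i < N) c i) ->
  forall i, (i < N)%N -> J (c i).
Proof.
move=> [[J0 JD JM] Jg] hc /Jg[M [d [hd e]]] i hi.
pose d' i := if (i < M)%N then d i else 0.
pose c' i := if (i < N)%N then c i else 0.
have hd' j : homog j (d' j) by rewrite /d'; case: ifP => // _; [exact: (hd j).2 | exact: homog0].
have hc' j : homog j (c' j) by rewrite /c'; case: ifP => // _; exact: homog0.
have := @homog_comp_uniq _ A (N + M)%N c' d' hc' hd'.
have -> : \sum_(j < N + M) c' j = \sum_(i < N) c i.
  by rewrite (big_ord_widen _ c (leq_addr M N)) [RHS]big_mkcond.
have -> : \sum_(j < N + M) d' j = \sum_(i < M) d i.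
  by rewrite (big_ord_widen _ d (leq_addl N M)) [RHS]big_mkcond.
move=> /(_ e i); rewrite ltn_addr // => /(_ isT); rewrite /c' hi => ->.
by rewrite /d'; case: ifP => // _; exact: (hd i).1.
Qed.

(** Degree by degree, the elements of the colon ideal are handled by the colon
condition; in degree zero there is nothing, because b is not in J. *)
Lemma strictly_koszul_colon (A : gradedAlg F) : strictly_koszul A ->
  forall J : set A, linear_ideal J ->
  forall b, (homog 1 `\` (J `&` homog 1)) b ->
    linear_ideal (colon J (generated_ideal [set b])).
Proof.
move=> [[I [x [gx _]]] sq ukA] J [gJ JE] b [hb nJb].
have [[J0 JD JM] _] := gJ.
set C := colon _ _.
have Cb a : C a <-> J (a * b).
  split=> [|hab]; first by apply; exact: generated_ideal_sub.
  move=> _ [t [ht ->]]; rewrite mulr_sumr big_seq; apply: big_ind => //.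
  move=> p /ht; rewrite /= => ->; rewrite !mulrA.
  rewrite -(mulrA a); have [c ->] := generators_normal gx sq p.1.1 hb.
  by rewrite mulrA; do 2!apply: (JM _ _ _).2.
have Cideal : ideal C.
  split=> [|y z /Cb hy /Cb hz|a y hy]; first by apply/Cb; rewrite mul0r.
    by apply/Cb; rewrite mulrDl; exact: JD.
  split; first by apply/Cb; rewrite -mulrA; apply: (JM _ _ _).1; exact/Cb.
  move=> z hz; rewrite -mulrA; apply: hy.
  by have [_ _ h] := @generated_ideal_ideal _ A [set b]; exact: (h _ _ hz).1.
(* The subspace V generates J, so elements of J of degree n + 1 are combinations
   of elements of V with coefficients of degree n. *)
pose V := J `&` homog 1.
have subV : subspace V.
  split; first by split=> //; exact: homog0.
  move=> c y z [Jy hy] [Jz hz]; split; last exact: homogP.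
  by apply: JD => //; rewrite -[y]mul1r scalerAl; exact: (JM _ _ _).1.
have V1 : V `<=` homog 1 by move=> y [].
have Jspan n a : homog n.+1 a -> J a -> prodspan (homog n) V a.
  rewrite {1}JE => ha [t [ht ae]].
  have /choice[d hd] : forall p : A * A, exists c : nat -> A, (forall i, homog i (c i)) /\
      exists N, forall M, (N <= M)%N -> p.1 = \sum_(i < M) c i.
    by move=> p; exact: homog_decomp.
  have /choice[N hN] : forall p : A * A, exists N, forall M, (N <= M)%N ->
      p.1 = \sum_(i < M) d p i by move=> p; have [_] := hd p.
  pose M := (n.+1 + \max_(p <- t) N p)%N.
  have tE p : p \in t -> p.1 = \sum_(i < M) d p i.
    by move=> pt; apply: hN; rewrite (leq_trans _ (leq_addl _ _)) //
      (@leq_bigmax_seq _ _ xpredT N).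
  pose e i := if i is i'.+1 then \sum_(p <- t) (d p i' * (if p \in t then p.2 else 0)) else 0.
  have he i : homog i (e i).
    case: i => [|i]; first exact: homog0.
    apply: homog_big => p _; case: ifP => pt; last by rewrite mulr0; exact: homog0.
    by rewrite -addn1; apply: homogM; [exact: (hd p).1 | exact: (ht p pt).2].
  have -> : a = e n.+1.
    apply: (homog_comp_eq (N := M.+1) he ha); last by rewrite ltnS leq_addr.
    rewrite big_ord_recl add0r /= exchange_big /= ae; apply: eq_big_seq => p pt.
    by rewrite -mulr_suml pt -tE.
  apply: prodspan_big => p; case: ifP => pt; last by rewrite mulr0; exact: prodspan0.
  by apply: prodspan_mul; [exact: (hd p).1 | exact: ht].
have Cspan n a : homog n a -> C a -> left_multiples (C `&` homog 1) a.
  (* A nonzero scalar in the colon ideal would put b into J. *)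
  move=> ha /Cb hab; case: n ha => [|n] ha.
    have [c ac] := generators_homog0 gx ha.
    have [c0|c0] := eqVneq c 0.
      by exists [::]; rewrite big_nil ac c0 scale0r.
    case: nJb; split=> //; have := (JM (c^-1 *: 1) _ hab).1.
    by rewrite ac -!scalerAl !mul1r scalerA mulVf // scale1r.
  have [|t [ht ->]] := ukA V b V1 subV hb n a ha.
    apply: Jspan => //; rewrite -addn1; exact: homogM.
  exists t; split=> // p /ht[_ [h1 h2]]; split=> //; apply/Cb.
  move: h2; apply: prodspan_ind => // u v _ [Jv _]; exact: (JM _ _ _).1.
have Cg : graded_ideal C.
  split=> // a Ca; have [c [hc [N /(_ N (leqnn N)) e]]] := homog_decomp a.
  exists N, (fun i => if (i < N)%N then c i else 0); split; last first.
    by rewrite e; apply: eq_bigr => i _; rewrite ltn_ord.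
  move=> i; case: ifP => hi; last by split; [case: Cideal | exact: homog0].
  split=> //; apply/Cb; move/Cb: Ca; rewrite e mulr_suml => Ca.
  pose c' i := if i is i'.+1 then c i' * b else 0.
  have hc' j : homog j (c' j).
    case: j => [|j]; first exact: homog0.
    by have := homogM (hc j) hb; rewrite addn1.
  by apply: (graded_ideal_comp (N := N.+1) gJ hc' _ (i := i.+1)) => //;
    rewrite big_ord_recl add0r.
split=> //; apply/seteqP; split=> a.
  case/(Cg.2) => N [c [hc ->]].
  have hs i : left_multiples (C `&` homog 1) (c i).
    exact: Cspan (hc i).2 (hc i).1.
  elim/big_ind: _ => //; first by exists [::]; rewrite big_nil.
  move=> _ _ [t [ht ->]] [u [hu ->]]; exists (t ++ u); rewrite big_cat; split=> // q.
  by rewrite mem_cat => /orP[/ht|/hu].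
case=> t [ht ->]; have [C0 CD CM] := Cideal.
rewrite big_seq; apply: big_ind => // p /ht[Cp _]; exact: (CM _ _ Cp).1.
Qed.

(** The letters are numbered; the relations are all quadratic elements of the kernel. *)
Lemma strictly_koszul_quadratic (A : gradedAlg F) : strictly_koszul A -> quadratic A.
Proof.
move=> [[I [x [gx px]]] _ _].
pose y (i : 'I_#|I|) := x (enum_val i).
exists #|I|, (quadratic_relations y), (word_eval y : {lrmorphism tensor_algebra F #|I| -> A}).
have y1 i : homog 1 (y i) by exact: gx.1.
pose up := word_eval (fun i : 'I_#|I| => delta F [:: enum_val i] : word_algebra I F).
pose dn := word_eval (fun i : I => delta F [:: enum_rank i] : word_algebra 'I_#|I| F).
have upE f : word_eval x (up f) = word_eval y f.
  rewrite (word_eval_comp (word_eval x)); apply: eq_word_eval => i /=.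
  by rewrite word_eval_delta1.
have dnE f : word_eval y (dn f) = word_eval x f.
  rewrite (word_eval_comp (word_eval y)); apply: eq_word_eval => i /=.
  by rewrite word_eval_delta1 /y enum_rankK.
have updn f : dn (up f) = f.
  rewrite /dn /up (word_eval_comp (word_eval _)).
  rewrite [RHS](word_eval_uniq idfun); apply: eq_word_eval => i /=.
  by rewrite word_eval_delta1 enum_valK.
split.
- by move=> f [].
- by split; [exact: homog0 | rewrite linear0].
- move=> c f g [hf f0] [hg g0]; split; first exact: homogP.
  by rewrite linearP /= f0 g0 scaler0 addr0.
- split=> [n f hf|a]; first exact: word_eval_homog.
  by have [f <-] := gx.2 a; exists (dn f); exact: dnE.
- apply/seteqP; split=> f; last exact: quadratic_relations_eval.
  move=> /= f0; rewrite -(updn f).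
  apply: (quadratic_relations_map (x := x) (h := idfun)) => [i|i|].
  + exact: (@delta_homog F _ [:: enum_rank i]).
  + by rewrite word_eval_delta1 /y enum_rankK.
  + by apply: px; rewrite upE.
Qed.

Lemma strictly_koszulP (A : gradedAlg F) : strictly_koszul A -> universally_koszul A.
Proof.
by move=> kA; split; [exact: strictly_koszul_quadratic | exact: strictly_koszul_colon].
Qed.

End Presentations.

(** * Direct sums of augmentation ideals *)

Section Trivial.
Variables (F : fieldType) (A : gradedAlg F).
Hypothesis A0 : forall a : A, homog 0 a -> exists c : F, a = c *: 1.
Hypothesis A1 : forall n (a : A), homog n.+1 a -> a = 0.

Lemma strictly_koszul_trivial : strictly_koszul A.
Proof.
split; last first.
- by move=> V b _ _ _ n a /A1 -> _; exact: prodspan0.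
- by move=> a /A1 ->; rewrite mulr0.
exists 'I_0, (fun i : 'I_0 => 0 : A); split.
  split; first by case.
  move=> a; have [c [hc [N /(_ N.+1 (leqnSn N)) ->]]] := homog_decomp a.
  have [d cd] := A0 (hc 0%N); exists (d *: 1).
  rewrite linearZ rmorph1 /= -cd big_ord_recl big1 ?addr0 // => i _.
  exact: A1 (hc _).
move=> f; rewrite word_eval0 => /eqP; rewrite scaler_eq0 oner_eq0 orbF => /eqP f0.
have -> : f = 0 by apply: wordfunP => -[|[]].
by have [] := @generated_ideal_ideal F (word_algebra 'I_0 F) 
  (quadratic_relations (fun i : 'I_0 => 0 : A)).
Qed.
End Trivial.

Section DirectSum.
Variables (F : fieldType) (A B C : gradedAlg F).
Variables (iB : {lrmorphism B -> A}) (iC : {lrmorphism C -> A}).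
Variables (rB : {lrmorphism A -> B}) (rC : {lrmorphism A -> C}).
Hypotheses (iBh : forall n b, homog n b -> homog n (iB b))
           (iCh : forall n c, homog n c -> homog n (iC c))
           (rBh : forall n a, homog n a -> homog n (rB a))
           (rCh : forall n a, homog n a -> homog n (rC a)).
Hypotheses (iBK : cancel iB rB) (iCK : cancel iC rC).
Hypotheses (rBC : forall n c, homog n.+1 c -> rB (iC c) = 0)
           (rCB : forall n b, homog n.+1 b -> rC (iB b) = 0).
Hypothesis A0 : forall a : A, homog 0 a -> exists c : F, a = c *: 1.
Hypothesis inj : forall n (a : A), homog n.+1 a -> rB a = 0 -> rC a = 0 -> a = 0.

Lemma direct_sum_dec n (a : A) : homog n.+1 a -> a = iB (rB a) + iC (rC a).
Proof.
move=> ha; apply/eqP; rewrite -subr_eq0; apply/eqP; apply: (inj (n := n)).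
- by apply: homogD => //; apply: homogN; apply: homogD; auto.
- by rewrite !linearB !linearD /= iBK (rBC (rCh ha)) subr0 subrr.
- by rewrite !linearB !linearD /= iCK (rCB (rBh ha)) oppr0 add0r subrr.
Qed.

(** Elements of positive degree of the image of B see only the projection to B. *)
Lemma direct_sum_proj n m b (a : A) : homog n.+1 b -> homog m a ->
  iB b * a = iB (b * rB a).
Proof.
move=> hb ha; apply/eqP; rewrite -subr_eq0; apply/eqP.
have hbr : homog (n + m).+1 (b * rB a) by rewrite -addSn; apply: homogM; auto.
apply: (inj (n := (n + m)%N)).
- apply: homogD; first by rewrite -addSn; apply: homogM; auto.
  by apply: homogN; auto.
- by rewrite linearB rmorphM /= !iBK subrr.
- by rewrite linearB rmorphM /= (rCB hb) (rCB hbr) mul0r subrr.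
Qed.

(** Let VB be the projection of V to B. In degrees at least two the ideals of V and
of VB have the same projection to B, and the witnesses found in B lift to A
because iB b * a = iB (b * rB a). *)
Lemma direct_sum_colon V b n (a : A) : colon_condition B ->
  V `<=` homog 1 -> subspace V -> homog 1 b -> homog n.+2 a ->
  prodspan (homog n.+2) V (a * b) ->
  prodspan (homog n.+1) (linear_colon V b) (iB (rB a)).
Proof.
move=> ukB V1 [V0 Vl] hb ha hab.
pose VB : set B := [set v | exists2 u, V u & v = rB u].
have VB1 : VB `<=` homog 1 by move=> _ [u /V1 hu ->]; exact: rBh.
have sVB : subspace VB.
  split; first by exists 0; rewrite ?linear0.
  by move=> c _ _ [u hu ->] [v hv ->]; exists (c *: u + v); rewrite ?linearP //; exact: Vl.
have := ukB VB (rB b) VB1 sVB (rBh hb) n.+1 (rB a) (rBh ha).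
case; first rewrite -rmorphM.
  move: hab; apply: (prodspan_ind (Q := fun y => prodspan (homog n.+2) VB (rB y))).
  - by rewrite linear0; exact: prodspan0.
  - by move=> y z hy hz; rewrite linearD; exact: prodspanD.
  - by move=> p v hp hv; rewrite rmorphM; apply: prodspan_mul; [exact: rBh | exists v].
move=> t [ht ->]; rewrite linear_sum.
exists [seq (iB p.1, iB p.2) | p <- t]; rewrite big_map; split; last first.
  by apply: eq_bigr => p _; rewrite rmorphM.
move=> _ /mapP[[p w] /ht[hp [hw hwb]] ->] /=; split; first exact: iBh.
split; first exact: iBh.
rewrite (direct_sum_proj hw hb).
move: hwb; apply: (prodspan_ind (Q := fun y => prodspan (homog 1) V (iB y))).
- by rewrite linear0; exact: prodspan0.
- by move=> y z hy hz; rewrite linearD; exact: prodspanD.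
- move=> u _ hu [v hv ->]; rewrite -(direct_sum_proj hu (V1 _ hv)).
  by apply: prodspan_mul => //; exact: iBh.
Qed.

End DirectSum.

Section DirectSumKoszul.
Variables (F : fieldType) (A B C : gradedAlg F).
Variables (iB : {lrmorphism B -> A}) (iC : {lrmorphism C -> A}).
Variables (rB : {lrmorphism A -> B}) (rC : {lrmorphism A -> C}).
Hypotheses (iBh : forall n b, homog n b -> homog n (iB b))
           (iCh : forall n c, homog n c -> homog n (iC c))
           (rBh : forall n a, homog n a -> homog n (rB a))
           (rCh : forall n a, homog n a -> homog n (rC a)).
Hypotheses (iBK : cancel iB rB) (iCK : cancel iC rC).
Hypotheses (rBC : forall n c, homog n.+1 c -> rB (iC c) = 0)
           (rCB : forall n b, homog n.+1 b -> rC (iB b) = 0).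
Hypothesis A0 : forall a : A, homog 0 a -> exists c : F, a = c *: 1.
Hypothesis inj : forall n (a : A), homog n.+1 a -> rB a = 0 -> rC a = 0 -> a = 0.

(** The presentation has the letters and the relations of B and of C, and the mixed
products of letters as further relations. A word that is not in the letters of
one of the two contains such a product. *)
Lemma strictly_koszul_direct_sum :
  strictly_koszul B -> strictly_koszul C -> strictly_koszul A.
Proof.
move=> [[I [x [gx px]]] sqB ukB] [[J [y [gy py]]] sqC ukC].
have dec := direct_sum_dec iBh iCh rBh rCh iBK iCK rBC rCB inj.
have inj' n (a : A) : homog n.+1 a -> rC a = 0 -> rB a = 0 -> a = 0.
  by move=> ha h1 h2; exact: inj ha h2 h1.
split; last first.
- move=> V b V1 sV hb [|n] a ha hab; first exact: colon_condition1.
  rewrite (dec _ _ ha); apply: prodspanD.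
    exact: (direct_sum_colon iBh rBh iBK rCB inj ukB V1 sV hb ha hab).
  exact: (direct_sum_colon iCh rCh iCK rBC inj' ukC V1 sV hb ha hab).
- move=> a ha; apply: (inj (n := 1)); first exact: (homogM ha ha).
    by rewrite rmorphM sqB //; exact: rBh.
  by rewrite rmorphM sqC //; exact: rCh.
pose z (i : I + J) : A := match i with inl i => iB (x i) | inr j => iC (y j) end.
have z1 i : homog 1 (z i) by case: i => i; [exact: iBh (gx.1 i) | exact: iCh (gy.1 i)].
pose d (i : I + J) : word_algebra (I + J)%type F := delta F [:: i].
have d1 i : homog 1 (d i) by exact: (@delta_homog F _ [:: i]).
pose l : {lrmorphism word_algebra I F -> word_algebra (I + J)%type F} :=
  word_eval (fun i => d (inl i)).
pose r : {lrmorphism word_algebra J F -> word_algebra (I + J)%type F} :=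
  word_eval (fun j => d (inr j)).
have lE f : word_eval z (l f) = iB (word_eval x f).
  rewrite (word_eval_comp (word_eval z)) (word_eval_comp iB); apply: eq_word_eval => i /=.
  by rewrite word_eval_delta1.
have rE f : word_eval z (r f) = iC (word_eval y f).
  rewrite (word_eval_comp (word_eval z)) (word_eval_comp iC); apply: eq_word_eval => i /=.
  by rewrite word_eval_delta1.
exists (I + J)%type, z; split.
  split=> // a; have [c [hc [N /(_ N (leqnn N)) ->]]] := homog_decomp a.
  elim/big_ind: _ => [|_ _ [f <-] [g <-]|i _]; first by exists 0; rewrite linear0.
    by exists (f + g); rewrite linearD.
  case: (i : nat) (hc i) => [|n] ha.
    by have [e ->] := A0 ha; exists (e *: 1); rewrite linearZ rmorph1.
  have [[f fb] [g gc]] := (gx.2 (rB (c n.+1)), gy.2 (rC (c n.+1))).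
  by exists (l f + r g); rewrite linearD /= lE rE fb gc -(dec _ _ ha).
pose Q := generated_ideal (quadratic_relations z).
have [Q0 QD QM] : ideal Q by exact: generated_ideal_ideal.
have Qlr i j : Q (d (inl i) * d (inr j)).
  apply: generated_ideal_sub; split; first exact: (homogM (d1 _) (d1 _)).
  rewrite rmorphM /= !word_eval_delta1 /=.
  rewrite (direct_sum_proj iBh rBh iBK rCB inj (gx.1 i) (iCh (gy.1 j))).
  by rewrite (rBC (gy.1 j)) mulr0 linear0.
have Qrl i j : Q (d (inr j) * d (inl i)).
  apply: generated_ideal_sub; split; first exact: (homogM (d1 _) (d1 _)).
  rewrite rmorphM /= !word_eval_delta1 /=.
  rewrite (direct_sum_proj iCh rCh iCK rBC inj' (gy.1 j) (iBh (gx.1 i))).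
  by rewrite (rCB (gx.1 i)) mulr0 linear0.
(* Modulo the mixed products only words in the letters of one summand remain. *)
have words_dec w : [\/ exists u, w = map inl u,
    exists j v, w = map inr (j :: v) | Q (delta F w)].
  elim: w => [|[i|j] w [[u ->]|[j' [v ->]]|Qw]]; first by constructor 1; exists [::].
  - by constructor 1; exists (i :: u).
  - constructor 3; rewrite (_ : _ :: _ = [:: inl i] ++ [:: inr j'] ++ map inr v) //.
    by rewrite -!deltaM mulrA; apply: (QM _ _ (Qlr i j')).2.
  - by constructor 3; rewrite -cat1s -deltaM; exact: (QM _ _ Qw).1.
  - case: u => [|i u]; first by constructor 2; exists j, [::].
    constructor 3; rewrite (_ : _ :: _ = [:: inr j] ++ [:: inl i] ++ map inl u) //.
    by rewrite -!deltaM mulrA; apply: (QM _ _ (Qrl i j)).2.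
  - by constructor 2; exists j, (j' :: v).
  - by constructor 3; rewrite -cat1s -deltaM; exact: (QM _ _ Qw).1.
have ldelta u : l (delta F u) = delta F (map inl u).
  rewrite /l /= word_eval_delta; elim: u => [|i u IHu]; rewrite /monomial.
    by rewrite big_nil -delta_nil.
  by rewrite big_cons -/(monomial _ u) IHu deltaM.
have rdelta u : r (delta F u) = delta F (map inr u).
  rewrite /r /= word_eval_delta; elim: u => [|i u IHu]; rewrite /monomial.
    by rewrite big_nil -delta_nil.
  by rewrite big_cons -/(monomial _ u) IHu deltaM.
have l0 : l 0 = 0 by exact: linear0.
have r0 : r 0 = 0 by exact: linear0.
have fdec f : exists (f1 : word_algebra I F) (f2 : word_algebra J F),
    Q (f - l f1 - r f2) /\ f2 [::] = 0.
  have [n /delta_sum ->] := wordfun_shortP f.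
  elim/big_ind: _ => [|g h [g1 [g2 [Qg g0]]] [h1 [h2 [Qh h0]]]|w _].
  - by exists 0, 0; rewrite l0 r0 !subr0.
  - exists (g1 + h1), (g2 + h2); split; last by rewrite [LHS]wordfun_addE g0 h0 addr0.
    rewrite (linearD l) (linearD r) (_ : _ - _ - _ = (g - l g1 - r g2) + (h - l h1 - r h2)).
      exact: QD.
    by rewrite !opprD (addrACA g) (addrACA (g - _)).
  - case: (words_dec w) => [[u ->]|[j [v ->]]|Qw].
    + by exists ((f (map inl u) : F) *: delta F u), 0; rewrite r0 linearZ /= ldelta subrr subr0.
    + exists 0, ((f (map inr (j :: v)) : F) *: delta F (j :: v)); split.
        by rewrite l0 linearZ /= rdelta subr0 subrr.
      by rewrite [LHS]wordfun_scaleE mulr0.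
    + exists 0, 0; rewrite l0 r0 !subr0; split=> //.
      by rewrite -[delta F w]mul1r scalerAl; exact: (QM _ _ Qw).1.
move=> f f0; have [f1 [f2 [Qf f20]]] := fdec f.
have := quadratic_relations_eval Qf.
rewrite !linearB /= f0 lE rE sub0r -opprD => /eqP; rewrite oppr_eq0 => /eqP e.
(* f2 has no constant term, so its value lies in positive degree, which rB kills. *)
have rBy : rB (iC (word_eval y f2)) = 0.
  rewrite (word_eval_comp iC) (word_eval_comp rB) -[RHS](scale0r 1) -f20 -(word_eval0 B f2).
  by apply: eq_word_eval => j /=; exact: (rBC (gy.1 j)).
have ex : word_eval x f1 = 0.
  by have := congr1 rB e; rewrite linearD linear0 /= iBK rBy addr0.
have ey : word_eval y f2 = 0.
  by have := congr1 rC e; rewrite ex linear0 add0r linear0 iCK.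
have Ql : Q (l f1).
  apply: (quadratic_relations_map (x := x) (h := iB)) => // [i|]; last exact: px.
  by rewrite word_eval_delta1.
have Qr : Q (r f2).
  apply: (quadratic_relations_map (x := y) (h := iC)) => // [i|]; last exact: py.
  by rewrite word_eval_delta1.
have fE : f = f - l f1 - r f2 + l f1 + r f2 by rewrite [_ + l f1]addrAC !subrK.
rewrite fE; exact: (QD _ _ (QD _ _ Qf Ql) Qr).
Qed.

End DirectSumKoszul.

(** * Exterior extensions *)

Section ExteriorExtension.
Variables (F : fieldType) (A B : gradedAlg F).
Variable i : {lrmorphism B -> A}.
Hypothesis ih : forall n b, homog n b -> homog n (i b).
Hypothesis B0 : forall b : B, homog 0 b -> exists c : F, b = c *: 1.
Hypothesis sqA : forall a : A, homog 1 a -> a * a = 0.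
Hypothesis sgn : forall n (b : B) (a : A), homog n b -> homog 1 a ->
  a * i b = (-1) ^+ n *: (i b * a).

Definition free_over (t : A) :=
  [/\ homog 1 t,
      forall n a, homog n.+1 a -> exists b c, [/\ homog n.+1 b, homog n c & a = i b + t * i c]
    & forall b c, i b + t * i c = 0 -> b = 0 /\ c = 0].

(** The generator t may be replaced by any element of degree one outside B. This
reduces the colon condition to three cases: t in V; V inside B and t = b; V and
b inside B. *)
Lemma free_over_change t be (la : F) : free_over t -> homog 1 be -> la != 0 ->
  free_over (i be + la *: t).
Proof.
move=> [t1 tdec tinj] hbe la0; split.
- by apply: homogD; [exact: ih | exact: homogZ].
- move=> n a /tdec[b [c [hb hc ->]]].
  exists (b - la^-1 *: (be * c)), (la^-1 *: c); split.
  + by apply: homogD => //; apply/homogN/homogZ; exact: (homogM hbe hc).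
  + exact: homogZ.
  + rewrite linearB !linearZ /= rmorphM mulrDl -!scalerAr -scalerAl scalerA mulVf // scale1r.
    by rewrite scalerN addrA subrK.
- move=> b c; rewrite mulrDl -scalerAl -rmorphM addrA -linearD scalerAr -linearZ.
  case/tinj => e /eqP; rewrite scaler_eq0 (negbTE la0) /= => /eqP c0.
  by move: e; rewrite c0 mulr0 addr0.
Qed.

Section Fixed.
Variable t : A.
Hypothesis ft : free_over t.
Let t1 : homog 1 t. Proof. by case: ft. Qed.

Lemma free_over_inj b c b' c' : i b + t * i c = i b' + t * i c' -> b = b' /\ c = c'.
Proof.
have [_ _ h] := ft; move/eqP; rewrite -subr_eq0 opprD addrACA -mulrBr -!linearB.
by move/eqP/h=> [/eqP + /eqP]; rewrite !subr_eq0 => /eqP-> /eqP->.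
Qed.

Lemma sign_swap n b : homog n b -> i b * t = (-1) ^+ n *: (t * i b).
Proof. by move=> hb; rewrite (sgn hb t1) scalerA -exprMn mulrNN mulr1 expr1n scale1r. Qed.

Lemma tit n b : homog n b -> t * i b * t = 0.
Proof. by move=> hb; rewrite -mulrA (sign_swap hb) -scalerAr mulrA sqA // mul0r scaler0. Qed.

Lemma deg1_dec a : homog 1 a -> exists b (c : F), homog 1 b /\ a = i b + c *: t.
Proof.
have [_ h _] := ft => /h[b [c [hb hc ->]]]; have [d ->] := B0 hc.
by exists b, d; rewrite linearZ rmorph1 -scalerAr mulr1.
Qed.

Lemma prodspan_i n (V : set B) (W : set A) (b : B) :
  (forall v, V v -> W (i v)) -> prodspan (homog n) V b -> prodspan (homog n) W (i b).
Proof.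
move=> VW; apply: (prodspan_ind (Q := fun b => prodspan (homog n) W (i b))).
- by rewrite linear0; exact: prodspan0.
- by move=> x y hx hy; rewrite linearD; exact: prodspanD.
- by move=> p v hp /VW hv; rewrite rmorphM; apply: prodspan_mul => //; exact: ih.
Qed.

Variables (V : set A) (V1 : V `<=` homog 1) (sV : subspace V).
Let VB : set B := [set v | homog 1 v /\ V (i v)].

Lemma VB_subspace : subspace VB.
Proof.
have [V0 Vl] := sV; split; first by split; [exact: homog0 | rewrite linear0].
by move=> c x y [hx Vx] [hy Vy]; split; [exact: homogP | rewrite linearP; exact: Vl].
Qed.

Let VB1 : VB `<=` homog 1. Proof. by move=> v []. Qed.

(** Everything can be computed modulo t, that is, in B. *)
Lemma colon_with_t b n a : colon_condition B -> V t -> homog 1 b ->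
  homog n.+1 a -> prodspan (homog n.+1) V (a * b) -> prodspan (homog n) (linear_colon V b) a.
Proof.
move=> ukB Vt hb ha hab; have [V0 Vl] := sV.
have [be [la [hbe bE]]] := deg1_dec hb.
have [_ dec _] := ft; have [a0 [a1 [ha0 ha1 aE]]] := dec _ _ ha.
have Wt : linear_colon V b t.
  split=> //; rewrite (square0_anticomm sqA t1 hb); apply: prodspanN.
  exact: prodspan_mul.
have [y0 [y1 [yE hy0]]] : exists y0 y1, a * b = i y0 + t * i y1 /\
    prodspan (homog n.+1) VB y0.
  move: hab; apply: (prodspan_ind (Q := fun y => exists y0 y1, y = i y0 + t * i y1 /\
    prodspan (homog n.+1) VB y0)).
  - by exists 0, 0; rewrite !linear0 mulr0 addr0; split=> //; exact: prodspan0.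
  - move=> _ _ [x0 [x1 [-> h0]]] [z0 [z1 [-> h1]]]; exists (x0 + z0), (x1 + z1).
    by rewrite !linearD mulrDr addrACA; split=> //; exact: prodspanD.
  - move=> p v hp Vv; have [p0 [p1 [hp0 hp1 ->]]] := dec _ _ hp.
    have [v0 [mu [hv0 vE]]] := deg1_dec (V1 Vv).
    have VBv0 : VB v0.
      split=> //; have -> : i v0 = (- mu) *: t + v by rewrite vE scaleNr addrC addrK.
      exact: Vl.
    exists (p0 * v0), (p1 * v0 + (mu * (-1) ^+ n.+1) *: p0); split; last exact: prodspan_mul.
    rewrite vE mulrDl !mulrDr -!scalerAr (tit hp1) scaler0 addr0 (sign_swap hp0) scalerA.
    by rewrite linearD linearZ !rmorphM /= mulrDr -scalerAr -!mulrA addrA addrAC.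
have a0be : a0 * be = y0.
  apply: (@free_over_inj _ (a1 * be + (la * (-1) ^+ n.+1) *: a0) _ y1 _).1.
  rewrite -yE aE bE mulrDl !mulrDr -!scalerAr (tit ha1) scaler0 addr0 (sign_swap ha0) scalerA.
  by rewrite linearD linearZ !rmorphM /= mulrDr -scalerAr -!mulrA addrA addrAC.
have ha0W := ukB VB be VB1 VB_subspace hbe n a0 ha0.
rewrite a0be in ha0W; have {}ha0W := ha0W hy0.
rewrite aE; apply: prodspanD; last first.
  by rewrite (sgn ha1 t1); apply: prodspanZ; apply: prodspan_mul => //; exact: ih.
apply: (prodspan_i _ ha0W) => w [hw hwbe]; split; first exact: ih.
rewrite bE mulrDr -rmorphM; apply: prodspanD.
  by apply: (prodspan_i _ hwbe) => v [].
by rewrite -scalerAr; apply: prodspanZ; apply: prodspan_mul => //; exact: ih.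
Qed.

Hypothesis VE : forall v, V v -> exists2 v0, homog 1 v0 & v = i v0.

(** For V inside B the ideal of V in A is the sum of the ideal of V in B and of its
multiple by t. *)
Lemma prodspan_over m y : prodspan (homog m.+1) V y -> exists y0 y1,
  [/\ y = i y0 + t * i y1, prodspan (homog m.+1) VB y0 & prodspan (homog m) VB y1].
Proof.
have [_ dec _] := ft.
apply: (prodspan_ind (Q := fun y => exists y0 y1,
  [/\ y = i y0 + t * i y1, prodspan (homog m.+1) VB y0 & prodspan (homog m) VB y1])).
- by exists 0, 0; rewrite !linear0 mulr0 addr0; split=> //; exact: prodspan0.
- move=> _ _ [x0 [x1 [-> h0 h0']]] [z0 [z1 [-> h1 h1']]]; exists (x0 + z0), (x1 + z1).
  by rewrite !linearD mulrDr addrACA; split=> //; exact: prodspanD.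
- move=> p v hp Vv; have [p0 [p1 [hp0 hp1 ->]]] := dec _ _ hp.
  have [v0 hv0 vE] := VE Vv; have VBv : VB v0 by split; rewrite -?vE.
  exists (p0 * v0), (p1 * v0); rewrite vE mulrDl !rmorphM mulrA.
  by split=> //; exact: prodspan_mul.
Qed.

(** For a = a0 + t a1 one has a t = t a0 up to sign, so that a0 lies in the ideal of V,
while t a1 is a multiple of t, and t t = 0. *)
Lemma colon_by_t n a : homog n.+1 a -> prodspan (homog n.+1) V (a * t) ->
  prodspan (homog n) (linear_colon V t) a.
Proof.
move=> ha /prodspan_over[y0 [y1 [yE hy0 hy1]]].
have [_ dec _] := ft; have [a0 [a1 [ha0 ha1 aE]]] := dec _ _ ha.
have e : (-1) ^+ n.+1 *: a0 = y1.
  apply: (@free_over_inj 0 _ y0 _ _).2.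
  by rewrite -yE aE mulrDl (tit ha1) addr0 (sign_swap ha0) linear0 add0r linearZ /= scalerAr.
have {}e : a0 = (-1) ^+ n.+1 *: y1.
  by rewrite -e scalerA -exprMn mulrNN mulr1 expr1n scale1r.
rewrite aE; apply: prodspanD.
  rewrite e linearZ; apply: prodspanZ; apply: (prodspan_i _ hy1) => v [hv Vv].
  split; first exact: ih.
  rewrite (square0_anticomm sqA (ih hv) t1); apply: prodspanN; exact: prodspan_mul.
rewrite (sgn ha1 t1); apply: prodspanZ; apply: prodspan_mul; first exact: ih.
by split=> //; rewrite sqA //; exact: prodspan0.
Qed.

(** The two components of a = a0 + t a1 satisfy the colon condition of B separately;
a1 has positive degree because that of a is at least two. *)
Lemma colon_from_B be n a : colon_condition B -> homog 1 be ->
  homog n.+2 a -> prodspan (homog n.+2) V (a * i be) ->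
  prodspan (homog n.+1) (linear_colon V (i be)) a.
Proof.
move=> ukB hbe ha /prodspan_over[y0 [y1 [yE hy0 hy1]]].
have [_ dec _] := ft; have [a0 [a1 [ha0 ha1 aE]]] := dec _ _ ha.
have [e0 e1] : a0 * be = y0 /\ a1 * be = y1.
  by apply: free_over_inj; rewrite -yE aE mulrDl !rmorphM mulrA.
have W w : linear_colon VB be w -> linear_colon V (i be) (i w).
  move=> [hw hwbe]; split; first exact: ih.
  by rewrite -rmorphM; apply: (prodspan_i _ hwbe) => v [].
rewrite aE; apply: prodspanD.
  by apply: (prodspan_i W); apply: ukB => //; [exact: VB_subspace | rewrite e0].
rewrite -addn1 addnC; apply: prodspan_mull => //.
by apply: (prodspan_i W); apply: ukB => //; [exact: VB_subspace | rewrite e1].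
Qed.

End Fixed.

Lemma exterior_colon t : free_over t -> colon_condition B -> colon_condition A.
Proof.
move=> ft ukB V b V1 sV hb [|n] a ha hab; first exact: colon_condition1.
have [V0 Vl] := sV.
(* If V is not inside B, an element of V outside B can serve as t. *)
have [[v [Vv [be [la [hbe la0 vE]]]]]|nV] := pselect (exists v, V v /\
    exists be (la : F), [/\ homog 1 be, la != 0 & v = i be + la *: t]).
  have fv := free_over_change ft hbe la0; rewrite -vE in fv.
  exact: (colon_with_t fv V1 sV ukB Vv hb ha hab).
have VE v : V v -> exists2 v0, homog 1 v0 & v = i v0.
  move=> Vv; have [be [la [hbe vE]]] := deg1_dec ft (V1 _ Vv).
  have [la0|la0] := eqVneq la 0; first by exists be; rewrite // vE la0 scale0r addr0.
  by case: nV; exists v; split=> //; exists be, la.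
have [be [la [hbe bE]]] := deg1_dec ft hb.
have [la0|la0] := eqVneq la 0; last first.
  (* If b is not in B, it can serve as t. *)
  have fb := free_over_change ft hbe la0; rewrite -bE in fb.
  exact: (colon_by_t fb VE ha hab).
move: bE; rewrite la0 scale0r addr0 => bE; rewrite bE in hab *.
exact: (colon_from_B ft sV VE ukB hbe ha hab).
Qed.

End ExteriorExtension.

Section ExteriorKoszul.
Variables (F : fieldType) (A B : gradedAlg F).
Variables (i : {lrmorphism B -> A}) (t : A).
Hypothesis ih : forall n b, homog n b -> homog n (i b).
Hypothesis A0 : forall a : A, homog 0 a -> exists c : F, a = c *: 1.
Hypotheses (ft : free_over i t) (tt : t * t = 0).
Hypothesis anti : forall b, homog 1 b -> t * i b = - (i b * t).

(** The presentation has one more letter for t, which squares to zero and anticommutes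
with the letters of B; modulo these relations t can be moved to the front. *)
Lemma strictly_koszul_exterior : strictly_koszul B -> strictly_koszul A.
Proof.
move=> [[I [x [gx px]]] sqB ukB].
have B0 := generators_homog0 gx.
have [t1 tdec tinj] := ft.
have sqA (a : A) : homog 1 a -> a * a = 0.
  case/tdec=> b [c [hb hc ->]]; have [d ->] := B0 _ hc.
  rewrite linearZ rmorph1 -scalerAr mulr1 mulrDl !mulrDr -rmorphM sqB // rmorph0 add0r.
  by rewrite -!scalerAl -!scalerAr tt !scaler0 addr0 (anti hb) scalerN subrr.
pose z (j : option I) : A := if j is Some j then i (x j) else t.
have z1 j : homog 1 (z j) by case: j => [j|] //; exact: ih (gx.1 j).
pose d (j : option I) : word_algebra (option I) F := delta F [:: j].
have d1 j : homog 1 (d j) by exact: (@delta_homog F _ [:: j]).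
pose l : {lrmorphism word_algebra I F -> word_algebra (option I) F} :=
  word_eval (fun j => d (Some j)).
have lE f : word_eval z (l f) = i (word_eval x f).
  rewrite (word_eval_comp (word_eval z)) (word_eval_comp i); apply: eq_word_eval => j /=.
  by rewrite word_eval_delta1.
have zgen : generators z.
  split=> // a; have [c [hc [N /(_ N (leqnn N)) ->]]] := homog_decomp a.
  elim/big_ind: _ => [|_ _ [f <-] [g <-]|j _]; first by exists 0; rewrite linear0.
    by exists (f + g); rewrite linearD.
  case: (j : nat) (hc j) => [|n] ha.
    by have [e ->] := A0 ha; exists (e *: 1); rewrite linearZ rmorph1.
  have [b [e [_ _ ->]]] := tdec _ _ ha.
  have [[f <-] [g <-]] := (gx.2 b, gx.2 e).
  by exists (l f + d None * l g); rewrite linearD rmorphM /= !lE word_eval_delta1.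
have sgn n (b : B) (a : A) : homog n b -> homog 1 a -> a * i b = (-1) ^+ n *: (i b * a).
  move=> hb ha; rewrite (generators_sign zgen sqA (ih hb) ha).
  by rewrite scalerA -exprMn mulrNN mulr1 expr1n scale1r.
split=> //; last exact: (exterior_colon ih B0 sqA sgn ft ukB).
exists (option I), z; split=> // f f0.
pose Q := generated_ideal (quadratic_relations z).
have [Q0 QD QM] : ideal Q by exact: generated_ideal_ideal.
have QZ (c : F) g : Q g -> Q (c *: g).
  by move=> Qg; rewrite -[g]mul1r scalerAl; exact: (QM _ _ Qg).1.
have Qtt : Q (d None * d None).
  apply: generated_ideal_sub; split; first exact: (homogM (d1 _) (d1 _)).
  by rewrite rmorphM /= !word_eval_delta1.
have Qt j : Q (d (Some j) * d None + d None * d (Some j)).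
  apply: generated_ideal_sub; split.
    by apply: homogD; exact: (homogM (d1 _) (d1 _)).
  rewrite linearD !rmorphM /= !word_eval_delta1 /=.
  by rewrite (anti (gx.1 j)) addrN.
(* Normal form modulo the relations: the letter None, for t, occurs only in front. *)
have [f1 [f2 Qf]] : exists f1 f2 : word_algebra I F, Q (f - (l f1 + d None * l f2)).
  move: f {f0}; apply: word_algebra_ind.
  - by exists 1, 0; rewrite rmorph1 linear0 mulr0 addr0 subrr.
  - move=> c g h [g1 [g2 Qg]] [h1 [h2 Qh]]; exists (c *: g1 + h1), (c *: g2 + h2).
    rewrite (linearP l) (linearP l) mulrDr -scalerAr addrACA -scalerDr opprD addrACA.
    by rewrite -scalerBr; apply: QD => //; exact: QZ.
  - case=> [j|] g [g1 [g2 Qg]]; last first.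
      exists 0, g1; rewrite linear0 add0r.
      have -> : delta F [:: None] * g - d None * l g1 =
          d None * (g - (l g1 + d None * l g2)) + d None * d None * l g2.
        by rewrite mulrBr mulrDr mulrA opprD addrA subrK.
      by apply: QD; [exact: (QM _ _ Qg).1 | exact: (QM _ _ Qtt).2].
    have lj : l (delta F [:: j]) = d (Some j) by exact: word_eval_delta1.
    exists (delta F [:: j] * g1), (- (delta F [:: j] * g2)).
    rewrite linearN !rmorphM /= -!/(l _) lj.
    rewrite (_ : _ - _ = d (Some j) * (g - (l g1 + d None * l g2)) +
        (d (Some j) * d None + d None * d (Some j)) * l g2).
      by apply: QD; [exact: (QM _ _ Qg).1 | exact: (QM _ _ (Qt j)).2].
    rewrite mulrBr mulrDl mulrDr !mulrA !opprD -!addrA; congr (_ + (_ + _)).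
    by rewrite mulrN opprK mulrA addrA addNr add0r.
have := quadratic_relations_eval Qf.
rewrite linearB linearD rmorphM /= f0 !lE word_eval_delta1 sub0r => /eqP.
rewrite oppr_eq0 => /eqP/tinj[e1 e2].
have Ql g : word_eval x g = 0 -> Q (l g).
  move=> g0; apply: (quadratic_relations_map (x := x) (h := i)) => // [j|]; last exact: px.
  by rewrite word_eval_delta1.
rewrite -[f](subrK (l f1 + d None * l f2)); apply: (QD _ _ Qf).
by apply: QD; [exact: Ql | apply: (QM _ _ _).1; exact: Ql].
Qed.

End ExteriorKoszul.

(** * Groups of elementary type have universally Koszul cohomology *)

Section ElementaryKoszul.
Variable F : fieldType.
Local Notation H G := (cohomology_algebra G F).

Lemma pullback_comp (G K L : groupType) (p : {multiplicative G -> K})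
    (q : {multiplicative K -> L}) (X : cohomology L F) :
  pullback p (pullback q X) = pullback (q \o p) X.
Proof.
rewrite -[X]coh_classK !pullbackE; congr coh_class; apply/val_inj/wordfunP => s /=.
by rewrite -map_comp.
Qed.

Lemma strictly_koszul_free_product (G K L : groupType)
    (iG : {multiplicative G -> L}) (iK : {multiplicative K -> L})
    (pG : {multiplicative L -> G}) (pK : {multiplicative L -> K}) :
  cancel iG pG -> cancel iK pK ->
  (forall g, pK (iG g) = 1%g) -> (forall k, pG (iK k) = 1%g) ->
  (forall P : L -> Prop,
    P 1%g -> (forall x y, P x -> P y -> P (x * y)%g) ->
    (forall g, P (iG g)) -> (forall k, P (iK k)) -> forall x, P x) ->
  (forall phi : L -> F, exists psi : L -> F,
    (forall g x, psi (iG g * x)%g = psi x) /\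
    (forall k x, phi (iK k * x)%g - psi (iK k * x)%g = phi x - psi x)) ->
  strictly_koszul (H G) -> strictly_koszul (H K) -> strictly_koszul (H L).
Proof.
move=> iGK iKK iGpK iKpG gen split.
apply: (@strictly_koszul_direct_sum F (H L) (H G) (H K)
  (@pullback F _ _ pG) (@pullback F _ _ pK) (@pullback F _ _ iG) (@pullback F _ _ iK)).
- by move=> n b; exact: pullback_homog.
- by move=> n b; exact: pullback_homog.
- by move=> n b; exact: pullback_homog.
- by move=> n b; exact: pullback_homog.
- exact: pullbackK.
- exact: pullbackK.
- by move=> n c hc; rewrite /= pullback_comp (pullback_const _ hc).
- by move=> n c hc; rewrite /= pullback_comp (pullback_const _ hc).
- by move=> a; exact: coh_homog0P.
- by move=> n a; exact: (free_product_coh_inj iGK iKK gen split).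
Qed.

Lemma strictly_koszul_trivial_group (G : groupType) : (forall x : G, x = 1%g) ->
  strictly_koszul (H G).
Proof.
move=> G1; apply: strictly_koszul_trivial => [a|n a ha]; first exact: coh_homog0P.
have idK : cancel (idfun : {multiplicative G -> G}) (idfun : {multiplicative G -> G}) by [].
by rewrite -(pullbackK idK a) (pullback_const _ ha) ?linear0.
Qed.

Definition trivial_group : groupType := {perm void}.

Lemma trivial_groupP (x : trivial_group) : x = 1%g.
Proof. by apply/permP => -[]. Qed.

(** A group isomorphic to G is the free product of G and the trivial group. *)
Lemma strictly_koszul_iso (G L : groupType) : group_iso G L ->
  strictly_koszul (H G) -> strictly_koszul (H L).
Proof.
move=> [f [g fK gK]] kG.
have [g' g'E] := @multiplicative_of L G g (can2_gmulfM fK gK).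
pose iK : {multiplicative trivial_group -> L} := @one_fun trivial_group L.
pose pK : {multiplicative L -> trivial_group} := @one_fun L trivial_group.
apply: (@strictly_koszul_free_product G trivial_group L f iK g' pK) => //.
- by move=> x; rewrite g'E fK.
- by move=> x; rewrite [RHS]trivial_groupP [LHS]trivial_groupP.
- by move=> k; rewrite /iK /= gmul1.
- by move=> P P1 PM Pf _ x; rewrite -[x]gK.
- move=> phi; exists (fun=> 0); split=> // k x.
  by rewrite /iK /= mul1g.
- exact/strictly_koszul_trivial_group/trivial_groupP.
Qed.

(** The splitting of a function phi into invariant parts: integrate the increments
of phi along elements of K and no increments along elements of G. *)
Lemma strictly_koszul_free G K : strictly_koszul (H G) -> strictly_koszul (H K) ->
  strictly_koszul (H (free_product G K)).
Proof.
pose R := @free_product_relators G K.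
have [iG iGE] := free_product_inl G K.
have [iK iKE] := free_product_inr G K.
have [pG [pG1 pG2]] := free_product_lift (idfun : {multiplicative G -> G})
  (@one_fun K G : {multiplicative K -> G}).
have [pK [pK1 pK2]] := free_product_lift (@one_fun G K : {multiplicative G -> K})
  (idfun : {multiplicative K -> K}).
apply: (@strictly_koszul_free_product G K (free_product G K) iG iK pG pK).
- by move=> g; rewrite iGE; exact: pG1.
- by move=> k; rewrite iKE; exact: pK2.
- by move=> g; rewrite iGE; exact: pK1.
- by move=> k; rewrite iKE; exact: pG2.
- move=> P P1 PM PG PK; apply: presented_ind => // -[x|x].
  + by have := PG x; rewrite iGE.
  + by have := PK x; rewrite iKE.
  + by have := PG x^-1%g; rewrite gmulV iGE.
  + by have := PK x^-1%g; rewrite gmulV iKE.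
- move=> phi.
  pose psi (x : G + K) (u : free_product G K) :=
    if x is inr k then phi (iK k * u)%g - phi u else 0 : F.
  have [|E [E1 hE]] := @presented_potential _ R F psi.
    move=> _ [[x [y ->]]|[x [y ->]]] u.
      by rewrite /= /letter_step /=; ring.
    rewrite /= /letter_step /psi /= !pres_word_cons !pres_word_nil /=.
    rewrite -!iKE !mulg1 !mul1g -!mulgA (mulgA (iK x)) -gmulfM; ring.
  exists E; split=> [g x|k x]; first by rewrite iGE hE /psi addr0.
  by rewrite [in E (_ * _)%g]iKE hE /psi; ring.
Qed.

(** The class T is the pullback of the generator of H^1(Z); its square is the
pullback of a product that vanishes because the graph of Z has no edges. *)
Lemma strictly_koszul_prod G : strictly_koszul (H G) ->
  strictly_koszul (H (G * Zgroup)%type).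
Proof.
move=> kG; pose L : groupType := (G * Zgroup)%type.
pose zeta : Zgroup := pgen _ tt.
have iM : {morph (fun g : G => (g, 1%g) : L) : x y / (x * y)%g}.
  by move=> x y; congr (_, _); rewrite mulg1.
have [i iE] := @multiplicative_of G L _ iM.
pose p : {multiplicative L -> G} := fst.
pose s : {multiplicative L -> Zgroup} := snd.
have [t0 t01 t0E] := @raag_hom F point_graph (fun=> 1).
pose tau : cocycles L F := pull_cocycle s t0.
have tau1 : word_homog 1 (tau : wordfun L F).
  by move=> w hw; rewrite /= t01 // size_map.
pose z : L := (1%g, zeta).
have iK : cancel i p by move=> g; rewrite iE.
have zC g : (z * i g = i g * z)%g by rewrite iE; congr (_, _); rewrite ?mul1g ?mulg1.
have t0_1 : t0 [:: 1%g] = 0.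
  by apply: (addrI (t0 [:: 1%g])); rewrite addr0 -cocycle1_hom mulg1.
have ti g : tau [:: i g] = 0 by rewrite /= iE.
have tz : tau [:: z] = 1 by exact: t0E.
have genZ (P : L -> Prop) : (forall x y, P x -> P y -> P (x * y)%g) ->
    (forall g, P (i g)) -> P z -> P z^-1%g -> forall x, P x.
  move=> PM Pi Pz PzV [g h].
  have -> : (g, h) = (i g * (1%g, h))%g :> L by rewrite iE; congr (_, _); rewrite ?mulg1 ?mul1g.
  apply: (PM) => //; move: h; apply: presented_ind => [|x y Px Py|[]|[]] //.
  - by have := Pi 1%g; rewrite iE.
  - have -> : (1%g, (x * y)%g) = ((1%g, x) * (1%g, y))%g :> L.
      by congr (_, _); rewrite mulg1.
    exact: PM.
  - rewrite (_ : (1%g, _) = z^-1%g) //; apply: (mulgI z); rewrite mulgV.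
    by congr (_, _); rewrite ?mulg1 ?mulgV.
have solve (q : L -> F) : (forall g x, q (i g * x)%g = q x) -> q 1%g = 0 ->
    exists e : L -> F, [/\ forall g x, e (i g * x)%g = e x,
      forall x, e x - e (z * x)%g = q x & e 1%g = 0].
  move=> qi q1.
  have [|E [E1 hE]] := @presented_potential _ (@raag_relators point_graph) F
      (fun _ u => - q (1%g, u)); first by move=> _ [[] [[] [] //]].
  exists (fun x => E x.2); split=> // [g [x h]|[x h]]; first by rewrite iE /= mul1g.
  rewrite /= hE -[RHS](qi x^-1%g) iE.
  have -> : ((x^-1%g, 1%g) * (x, h))%g = (1%g, h) :> L by congr (_, _); rewrite ?mulVg ?mul1g.
  ring.
pose T : cohomology L F := coh_class tau.
have iT : pullback i T = 0.
  rewrite pullbackE; apply/coh_class_eq0P; exists (fun=> 0) => w.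
  rewrite bar_diff0 //; case: w => [|x [|y w]].
  - by rewrite /= t01.
  - exact: ti.
  - by rewrite [LHS]/= t01 //.
apply: (@strictly_koszul_exterior F (H L) (H G) (@pullback F _ _ p) T) kG.
- by move=> n b; exact: pullback_homog.
- by move=> a; exact: coh_homog0P.
- split; first by exists tau.
  + move=> n a ha.
    have [Y hY aE] := central_coh_dec iK zC tau1 ti tz genZ solve ha.
    by exists (pullback i a), Y; split=> //; exact: pullback_homog.
  + move=> b c e.
    have b0 : b = 0.
      have := congr1 (pullback i) e; rewrite linearD rmorphM /= iT mul0r addr0 linear0.
      by rewrite (pullbackK iK).
    split=> //; apply: (central_coh_inj iK zC tau1 ti tz).
    by rewrite -[RHS]e b0 linear0 add0r.
- have -> : T = pullback s (coh_class t0) by rewrite pullbackE.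
  by rewrite -rmorphM (raag_cup t01 t01) ?rmorph0.
- move=> b hb; apply: degree1_anticomm; first by exists tau.
  exact: pullback_homog.
Qed.

(** The infinite cyclic group is obtained from the trivial group by one product. *)
Lemma strictly_koszul_elementary G : elementary_type G -> strictly_koszul (H G).
Proof.
elim=> {G} [|G K _ kG _ kK|G _ kG|G K iGK _ kG].
- have k1 := strictly_koszul_prod (strictly_koszul_trivial_group trivial_groupP).
  apply: strictly_koszul_iso k1.
  exists (snd : {multiplicative _ -> _}); exists (fun h => (1%g, h)) => // -[x h] /=.
  by rewrite [in RHS](trivial_groupP x).
- exact: strictly_koszul_free.
- exact: strictly_koszul_prod.
- exact: strictly_koszul_iso iGK kG.
Qed.

End ElementaryKoszul.

(** * An obstruction to universal Koszulity *)

Section LinearIdeals.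
Variables (F : fieldType) (A : gradedAlg F) (I : finType) (x : I -> A).
Hypothesis gx : generators x.
Hypothesis sq : forall a : A, homog 1 a -> a * a = 0.

Lemma generators_normal_r (a b : A) : homog 1 b -> exists c, b * a = c * b.
Proof.
move=> hb; have [c [hc [N /(_ N (leqnn N)) ->]]] := homog_decomp a.
exists (\sum_(i < N) (-1) ^+ i *: c i); rewrite mulr_suml mulr_sumr.
apply: eq_bigr => i _; rewrite -scalerAl (generators_sign gx sq (hc i) hb).
by rewrite scalerA -exprMn mulrNN mulr1 expr1n scale1r.
Qed.

Lemma left_multiplesD (S : set A) y z :
  left_multiples S y -> left_multiples S z -> left_multiples S (y + z).
Proof.
move=> [t [ht ->]] [u [hu ->]]; exists (t ++ u); rewrite big_cat; split=> // q.
by rewrite mem_cat => /orP[/ht|/hu].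
Qed.

Lemma left_multiples_ind (S : set A) (Q : A -> Prop) : Q 0 ->
  (forall y z, Q y -> Q z -> Q (y + z)) -> (forall a s, S s -> Q (a * s)) ->
  forall y, left_multiples S y -> Q y.
Proof.
move=> Q0 QD QM y [t [ht ->]]; elim: t ht => [|q t IHt] ht; first by rewrite big_nil.
rewrite big_cons; apply: QD; first by apply/QM/ht/mem_head.
by apply: IHt => r rt; apply: ht; rewrite inE rt orbT.
Qed.

Lemma left_multiples_mul (S : set A) a s : S s -> left_multiples S (a * s).
Proof.
move=> Ss; exists [:: (a, s)]; rewrite big_seq1; split=> // q.
by rewrite inE => /eqP ->.
Qed.

(** Degree-one elements being normal, the left ideal is two-sided; its homogeneous
components come from those of the left factors, shifted by one. *)
Lemma left_multiples_linear (S : set A) : S `<=` homog 1 ->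
  linear_ideal (left_multiples S).
Proof.
move=> S1; pose L := left_multiples S.
have L0 : L 0 by exists [::]; rewrite big_nil.
have LD y z : L y -> L z -> L (y + z) by exact: left_multiplesD.
have LM a y : L y -> L (a * y).
  apply: (left_multiples_ind (Q := fun y => L (a * y))) => [|u v hu hv|b s Ss].
    by rewrite mulr0.
    by rewrite mulrDr; exact: LD.
  by rewrite mulrA; exact: left_multiples_mul.
have iL : ideal L.
  split=> // a y hy; split; first exact: LM.
  move: hy; apply: (left_multiples_ind (Q := fun y => L (y * a))) => [|u v hu hv|b s Ss].
  - by rewrite mul0r.
  - by rewrite mulrDl; exact: LD.
  - have [c e] := generators_normal_r a (S1 _ Ss).
    by rewrite -mulrA e mulrA; exact: left_multiples_mul.
have gL : graded_ideal L.
  pose Q y := exists (c : nat -> A) N, (forall i, (L `&` homog i) (c i)) /\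
      forall M, (N <= M)%N -> y = \sum_(i < M) c i.
  split=> // y hy; have : Q y.
    move: hy; apply: (left_multiples_ind (Q := Q)) => [|u v [c [N [hc Nc]]] [d [M [hd Md]]]|b s Ss].
    - by exists (fun=> 0), 0%N; split=> [i|M _]; [split=> //; exact: homog0 | rewrite big1].
    - exists (fun i => c i + d i), (N + M)%N; split=> [i|K hK].
        by have [[? ?] [? ?]] := (hc i, hd i); split; [exact: LD | exact: homogD].
      by rewrite big_split /= -Nc ?(leq_trans (leq_addr _ _) hK) // -Md // (leq_trans (leq_addl _ _) hK).
    - have [c [hc [N hN]]] := homog_decomp b.
      exists (fun i => if i is i'.+1 then c i' * s else 0), N.+1; split=> [[|i]|[//|M] hM].
      + by split=> //; exact: homog0.
      + split; first exact: left_multiples_mul.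
        by have := homogM (hc i) (S1 _ Ss); rewrite addn1.
      + by rewrite (hN M) // big_ord_recl add0r mulr_suml.
  by case=> c [N [hc /(_ N (leqnn N)) ->]]; exists N, c.
split=> //; apply/seteqP; split=> y.
  move=> [t [ht ->]]; exists t; split=> // p /ht Sp; split; last exact: S1.
  by rewrite -[p.2]mul1r; exact: left_multiples_mul.
by apply: left_multiples_ind => // a s [Ls _]; exact: LM.
Qed.

End LinearIdeals.

Section Quadruple.
Variables (Gamma : graph) (F : fieldType).
Local Notation G := (raag Gamma).
Local Notation H := (cohomology_algebra G F).
Local Notation gen := (@pgen Gamma (@raag_relators Gamma)).

Lemma raag_square0 (a : H) : homog 1 a -> a * a = 0.
Proof. by case/coh_homog_rep=> z hz <-; apply: raag_cup => // v w _; exact: mulrC. Qed.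

(** Coboundaries of degree one vanish, so this does not depend on the representative. *)
Definition eval1 (X : cohomology G F) (v : Gamma) : F := (repr X : cocycles G F) [:: gen v].

Lemma eval1_class (z : cocycles G F) v : eval1 (coh_class z) v = z [:: gen v].
Proof.
have /coh_class_eq0/coh_class_eq0P[e he] := repr_coh_class z.
apply/eqP; rewrite -subr_eq0; apply/eqP.
transitivity (bar_diff e [:: gen v]); first exact: he.
by rewrite /= subrr.
Qed.

(** For an edge vw the chain [v|w] - [w|v] is a cycle, the fundamental class of the
torus on which v and w act, and this is a linear functional on cohomology. *)
Definition eval2 (X : cohomology G F) (v w : Gamma) : F :=
  (repr X : cocycles G F) [:: gen v; gen w] - (repr X : cocycles G F) [:: gen w; gen v].

Lemma eval2_class (z : cocycles G F) v w : edge v w ->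
  eval2 (coh_class z) v w = z [:: gen v; gen w] - z [:: gen w; gen v].
Proof.
move=> vw; have /coh_class_eq0/coh_class_eq0P[e he] := repr_coh_class z.
have h s : (repr (coh_class z) : cocycles G F) s = z s + bar_diff e s.
  rewrite -he; transitivity (z s + ((repr (coh_class z) : cocycles G F) s - z s)) => //.
  by rewrite addrC subrK.
by rewrite /eval2 !h /= (raag_gen_comm vw); ring.
Qed.

Lemma eval2D X Y v w : edge v w -> eval2 (X + Y) v w = eval2 X v w + eval2 Y v w.
Proof.
move=> vw; rewrite -[X]coh_classK -[Y]coh_classK -coh_classD !eval2_class //.
set y := repr X; set z := repr Y.
have h s : (y + z : cocycles G F) s = y s + z s by [].
by rewrite !h; ring.
Qed.

Lemma eval1D X Y v : eval1 (X + Y) v = eval1 X v + eval1 Y v.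
Proof. by rewrite -[X]coh_classK -[Y]coh_classK -coh_classD !eval1_class. Qed.

Lemma eval2_mul X Y v w : edge v w -> coh_homog 1 Y ->
  eval2 (X * Y) v w = eval1 X v * eval1 Y w - eval1 X w * eval1 Y v.
Proof.
move=> vw /coh_homog_rep[z hz <-]; rewrite -[X]coh_classK -coh_classM eval2_class //.
by rewrite !cup_degree1r // !eval1_class.
Qed.

Lemma eval1_mul X Y v : coh_homog 1 Y ->
  exists c, eval1 (X * Y) v = c * eval1 Y v.
Proof.
move=> /coh_homog_rep[z hz <-]; rewrite -[X]coh_classK -coh_classM !eval1_class.
exists ((repr X : cocycles G F) [::]).
by rewrite cocyclesME /conv !big_ord_recl big_ord0 /= (hz [::]) // mulr0 !addr0.
Qed.

(** The element b* c* kills y = a* + d*, but does not lie in the ideal generated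
by the classes of degree one that multiply y into I; the latter is seen by evaluating on
the edges ab, cd and bc. *)
Lemma universally_koszul_no_quadruple (a b c d : Gamma) : universally_koszul H ->
  edge a b -> edge b c -> edge c d -> a != c -> b != d -> ~~ edge a c -> ~~ edge b d ->
  False.
Proof.
move=> [[k [Om [phi [_ _ _ [phih phiS] _]]]] uk] ab bc cd nac nbd eac ebd.
have ad : a != d.
  by apply: contraNneq eac => ->; rewrite edge_sym.
pose x (i : 'I_k) : H := phi (delta F [:: i]).
have gx : generators x.
  split=> [i|y]; first by apply: phih; exact: (@delta_homog F _ [:: i]).
  have [f <-] := phiS y; exists f; apply/esym.
  exact: (word_eval_uniq (phi : {lrmorphism word_algebra 'I_k F -> H})).
have sq := raag_square0.
have /choice[X hX] (u : Gamma) : exists X : cohomology G F, coh_homog 1 X /\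
    forall v, eval1 X v = (v == u)%:R.
  have [z z1 zu] := raag_hom (fun v => (v == u)%:R : F).
  exists (coh_class z); split; first by exists z.
  by move=> v; rewrite eval1_class zu.
have X1 u : homog 1 (X u : H) := (hX u).1.
have Xe u := (hX u).2.
have XX u v : ~~ edge u v -> X u * X v = 0.
  move=> nuv; have [[y y1 yE] [z z1 zE]] := (coh_homog_rep (X1 u), coh_homog_rep (X1 v)).
  rewrite -yE -zE; apply: raag_cup => // p q pq.
  have ye r : y [:: gen r] = (r == u)%:R by rewrite -eval1_class yE Xe.
  have ze r : z [:: gen r] = (r == v)%:R by rewrite -eval1_class zE Xe.
  rewrite !ye !ze; have h r s : edge r s -> (r == u)%:R * (s == v)%:R = 0 :> F.
    move=> rs; case: eqP => [ru|]; rewrite ?mul0r //; case: eqP => [sv|]; rewrite ?mulr0 //.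
    by rewrite -ru -sv rs in nuv.
  by rewrite !h // edge_sym.
(* The generators of the ideal I. *)
pose S : set H := [set s : cohomology G F | coh_homog 1 s /\
  forall v, v \in [:: a; b; c; d] -> eval1 s v = 0].
have S1 : S `<=` homog 1 by move=> s [].
pose y : H := X a + X d.
have y1 : homog 1 y by exact: homogD.
have ye v : eval1 y v = (v == a)%:R + (v == d)%:R by rewrite eval1D !Xe.
have S2 v w s : v \in [:: a; b; c; d] -> w \in [:: a; b; c; d] -> edge v w ->
    left_multiples S s -> eval2 s v w = 0.
  move=> hv hw vw; apply: (@left_multiples_ind F H _ (fun s : H => eval2 s v w = 0))
    => [|p q hp hq|p q [q1 q0]].
  - by apply: (addrI (eval2 0 v w)); rewrite -eval2D // !addr0.
  - by rewrite eval2D // hp hq addr0.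
  - by rewrite eval2_mul // !q0 // !mulr0 subrr.
have Sy : ~ left_multiples S y.
  have h s : left_multiples S s -> eval1 s a = 0.
    apply: (@left_multiples_ind F H _ (fun s : H => eval1 s a = 0)) => [|p q hp hq|p q [q1 q0]].
    - by apply: (addrI (eval1 0 a)); rewrite -eval1D // !addr0.
    - by rewrite eval1D hp hq addr0.
    - by have [e ->] := eval1_mul p a q1; rewrite q0 ?mulr0 // mem_head.
  by move/h/eqP; rewrite ye eqxx (negbTE ad) addr0 oner_eq0.
have bcy : X b * X c * y = 0.
  rewrite mulrDr -[X b * X c * X a]mulrA (XX c a) 1?edge_sym // mulr0 add0r.
  rewrite -mulrA (square0_anticomm sq (X1 c) (X1 d)) mulrN mulrA (XX b d) //.
  by rewrite mul0r oppr0.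
have [] := uk _ (left_multiples_linear gx sq S1) y; first by split=> // -[].
set J := colon _ _ => _ JE.
have : J (X b * X c).
  move=> _ [t [ht ->]]; rewrite mulr_sumr big_seq big1.
    by exists [::]; rewrite big_nil.
  move=> p /ht ->; have [e pe] := generators_normal gx sq p.1.1 y1.
  by rewrite pe !mulrA bcy !mul0r.
rewrite JE => hbc.
have : eval2 (X b * X c) b c = 0.
  have ea : a \in [:: a; b; c; d] by rewrite inE eqxx.
  have eb : b \in [:: a; b; c; d] by rewrite !inE eqxx orbT.
  have ec : c \in [:: a; b; c; d] by rewrite !inE eqxx !orbT.
  have ed : d \in [:: a; b; c; d] by rewrite !inE eqxx !orbT.
  have nab : a == b = false by apply/eqP => e; rewrite e edge_irr in ab.
  have ncd : c == d = false by apply/eqP => e; rewrite e edge_irr in cd.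
  move: hbc; apply: (@left_multiples_ind F H _ (fun s : H => eval2 s b c = 0))
    => [|p q hp hq|p q [Jq q1]].
  - by apply: (addrI (eval2 0 b c)); rewrite -eval2D // !addr0.
  - by rewrite eval2D // hp hq addr0.
  have Iqy : left_multiples S (q * y) by apply: Jq; exact: generated_ideal_sub.
  (* The edge ab gives q(b) = 0, the edge cd gives q(c) = 0. *)
  have := S2 a b _ ea eb ab Iqy; rewrite eval2_mul // !ye.
  rewrite eqxx (negbTE ad) (eq_sym b a) nab (negbTE nbd) !addr0 mulr0 mulr1 sub0r.
  move/eqP; rewrite oppr_eq0 => /eqP qb.
  have := S2 c d _ ec ed cd Iqy; rewrite eval2_mul // !ye.
  rewrite eqxx (eq_sym d a) (negbTE ad) (eq_sym c a) (negbTE nac) ncd !addr0 add0r mulr0 mulr1 subr0.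
  move=> qc.
  by rewrite eval2_mul // qb qc !mulr0 subrr.
have nbc : b == c = false by apply/eqP => e; rewrite e edge_irr in bc.
rewrite (eval2_mul _ bc (X1 c)) !Xe !eqxx (eq_sym c b) nbc mulr1 mulr0 subr0.
by move/eqP; rewrite oner_eq0.
Qed.

End Quadruple.

(** * The characterization *)

Theorem theorem1p2 (Gamma : graph) (F : finFieldType) :
  universally_koszul (cohomology_algebra (raag Gamma) F)
  <-> elementary_type (raag Gamma).
Proof.
split=> [uk|et]; last exact/strictly_koszulP/strictly_koszul_elementary.
apply: quadruple_free_elementary => a b c d ab bc cd ac bd.
apply/negPn/negP; rewrite negb_or => /andP[nac nbd].
exact: (@universally_koszul_no_quadruple Gamma F a b c d).
Qed.
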